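(* $c(5) \le \omega + 1$.
   Context: A tournament is an orientation of a complete graph. For a fixed tournament $T$, $T$-COUNT asks for the number of copies of $T$ (as a subgraph) in an input $n$-vertex tournament $G$. $c(T)$ is the infimum over all reals $t$ such that $T$-COUNT can be solved in $O(n^t)$ time, and $c(k)$ is the maximum of $c(T)$ over all tournaments $T$ on $k$ vertices. $\omega$ denotes the matrix multiplication exponent, i.e. the infimum over all reals $t$ such that two $n \times n$ matrices can be multiplied using $O(n^t)$ field operations. *)

(* Defs.v *)
From HB Require Import structures.
From mathcomp Require Import all_boot all_order all_algebra.
From mathcomp Require Import all_classical all_reals all_analysis.

Set Implicit Arguments.
Unset Strict Implicit.
Unset Printing Implicit Defensive.

Import Order.TTheory GRing.Theory Num.Theory.
Import numFieldNormedType.Exports.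

Local Open Scope ring_scope.

Definition orients_complete_graph (n : nat) (E : {set 'I_n * 'I_n}) : bool :=
  [forall x, (x, x) \notin E] &&
  [forall x, forall y, (x != y) ==> (((x, y) \in E) (+) ((y, x) \in E))].

Record tournament (n : nat) := Tournament {
  arcs :> {set 'I_n * 'I_n};
  arcsP : orients_complete_graph arcs }.

HB.instance Definition _ n := [isSub for @arcs n].
HB.instance Definition _ n := [Finite of tournament n by <:].

(* [H = (vertices, arcs)] is a subgraph of [G] and [f], for some [f], is an
   isomorphism from [T] onto [H]. *)
Definition is_copy (k n : nat) (T : tournament k) (G : tournament n)
    (H : {set 'I_n} * {set 'I_n * 'I_n}) : bool :=
  (H.2 \subset arcs G) &&
  [exists f : {ffun 'I_k -> 'I_n},
     [&& injectiveb f,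
         H.1 == [set f x | x in 'I_k]
       & H.2 == [set (f e.1, f e.2) | e in arcs T]]].

Definition copies (k n : nat) (T : tournament k) (G : tournament n) : nat :=
  #|[set H | is_copy T G H]|.

(* Running times are those of a unit-cost word RAM.  Control flow is structured
   (Skip/Seq/If/While); by the usual program-counter simulation this changes
   running times with respect to jumps by a constant factor only. *)

Inductive operand := Reg of nat | Const of int.

Inductive arith_op := Add | Sub | Mul | Div | Mod.

Inductive cmd :=
| Skip
| Arith of nat & arith_op & operand & operand (* reg r := x op y *)
| Read of nat & operand                       (* reg r := cells[x] *)
| Write of operand & operand                  (* cells[x] := y *)
| Seq of cmd & cmd
| If of operand & operand & cmd & cmd         (* if x < y *)
| While of operand & operand & cmd.           (* while x < y *)

Record state := State { reg : nat -> int; cells : int -> int }.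

Definition operand_val (s : state) (x : operand) : int :=
  match x with Reg r => reg s r | Const c => c end.

Definition arith_val (op : arith_op) (a b : int) : int :=
  match op with
  | Add => a + b
  | Sub => a - b
  | Mul => a * b
  | Div => (a %/ b)%Z
  | Mod => (a %% b)%Z
  end.

Definition upd_reg (s : state) (r : nat) (v : int) : state :=
  State (fun r' => if r' == r then v else reg s r') (cells s).

Definition upd_cell (s : state) (a v : int) : state :=
  State (reg s) (fun a' => if a' == a then v else cells s a').

(* [exec B c s s' t]: run from [s], [c] halts in [s'] after [t] steps, and every
   value written on the way is at most [B] in absolute value.  A computation
   that would write a larger value has no execution. *)
Inductive exec (B : nat) : cmd -> state -> state -> nat -> Prop :=
| exec_skip s : exec B Skip s s 1
| exec_arith s r op x y :
    let v := arith_val op (operand_val s x) (operand_val s y) in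
    (`|v| <= B)%N -> exec B (Arith r op x y) s (upd_reg s r v) 1
| exec_read s r x :
    exec B (Read r x) s (upd_reg s r (cells s (operand_val s x))) 1
| exec_write s x y :
    (`|operand_val s y| <= B)%N ->
    exec B (Write x y) s (upd_cell s (operand_val s x) (operand_val s y)) 1
| exec_seq c1 c2 s1 s2 s3 t1 t2 :
    exec B c1 s1 s2 t1 -> exec B c2 s2 s3 t2 ->
    exec B (Seq c1 c2) s1 s3 (t1 + t2)
| exec_if x y c1 c2 s s' t :
    exec B (if operand_val s x < operand_val s y then c1 else c2) s s' t ->
    exec B (If x y c1 c2) s s' t.+1
| exec_while_done x y c s :
    ~~ (operand_val s x < operand_val s y) -> exec B (While x y c) s s 1
| exec_while_loop x y c s1 s2 s3 t1 t2 :
    operand_val s1 x < operand_val s1 y ->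
    exec B c s1 s2 t1 -> exec B (While x y c) s2 s3 t2 ->
    exec B (While x y c) s1 s3 (t1 + t2).+1.

(* Register 0 holds [n]; [cells] holds the adjacency matrix, row by row, with
   entry (i, j) at address [i * n + j]; everything else is 0. *)
Definition input (n : nat) (G : tournament n) : state :=
  State (fun r => if r == 0%N then n%:Z else 0)
        (fun a => if [exists e in arcs G, a == (e.1 * n + e.2)%N%:Z]
                  then 1 else 0).

(* [P] counts the copies of [T] in time [f], with words of [O(log n)] bits (the
   bound [n.+2 ^ w]); the answer is left in register 0. *)
Definition counts_within (k : nat) (T : tournament k) (P : cmd) (w : nat)
    (f : nat -> nat) : Prop :=
  forall (n : nat) (G : tournament n), exists (s : state) (t : nat),
    [/\ exec (n.+2 ^ w) P (input G) s t, (t <= f n)%N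
      & reg s 0 = (copies T G)%:Z].

Local Open Scope classical_set_scope.
Local Open Scope ring_scope.

Definition big_O_pow (R : realType) (f : nat -> nat) (t : R) : Prop :=
  (fun n => (f n)%:R : R^o) =O_\oo (fun n => n%:R `^ t : R^o).

Definition count_time (R : realType) (k : nat) (T : tournament k) : set R :=
  [set t | exists (P : cmd) (w : nat) (f : nat -> nat),
             counts_within T P w f /\ big_O_pow f t].
Arguments count_time R {k} T.

Definition c_of (R : realType) (k : nat) (T : tournament k) : \bar R :=
  ereal_inf [set t%:E | t in count_time R T].

Definition c_max (R : realType) (k : nat) : \bar R :=
  \big[maxe/-oo%E]_(T : tournament k) c_of R T.

(* Running time of an algorithm in field operations, as usual in the definition
   of the exponent, is the size of a straight-line program over [K], one for each
   dimension.  The arguments of an operation, and the outputs, are inputs,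
   constants or results of earlier operations; [Res j] is the result of the
   [j]-th one (0 if there is none). *)
Inductive field_op := FAdd | FSub | FMul | FDiv.

Inductive slp_arg (K I : Type) := Var of I | Cst of K | Res of nat.
Arguments Var {K I}.
Arguments Cst {K I}.
Arguments Res {K I}.

Definition slp (K I : Type) := seq (field_op * slp_arg K I * slp_arg K I).

Definition slp_arg_val (K : fieldType) (I : Type) (env : I -> K) (vs : seq K)
    (a : slp_arg K I) : K :=
  match a with Var i => env i | Cst c => c | Res j => nth 0 vs j end.

Definition field_op_val (K : fieldType) (op : field_op) (a b : K) : option K :=
  match op with
  | FAdd => Some (a + b)
  | FSub => Some (a - b)
  | FMul => Some (a * b)
  | FDiv => if b == 0 then None else Some (a / b)
  end.

(* [vs] lists the results so far, in order; [None] means division by 0. *)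
Fixpoint slp_run (K : fieldType) (I : Type) (env : I -> K) (p : slp K I)
    (vs : seq K) : option (seq K) :=
  if p is (op, a, b) :: p' then
    if field_op_val op (slp_arg_val env vs a) (slp_arg_val env vs b) is Some v
    then slp_run env p' (rcons vs v) else None
  else Some vs.

(* [inl (i, j)] is entry (i, j) of the first factor, [inr (i, j)] of the
   second. *)
Definition mx_index (n : nat) : Type := ('I_n * 'I_n) + ('I_n * 'I_n).

Definition mx_entries (K : fieldType) (n : nat) (A B : 'M[K]_n)
    (x : mx_index n) : K :=
  match x with inl e => A e.1 e.2 | inr e => B e.1 e.2 end.

Definition multiplies (K : fieldType) (n : nat) (p : slp K (mx_index n))
    (out : 'I_n -> 'I_n -> slp_arg K (mx_index n)) : Prop :=
  forall A B : 'M[K]_n, exists vs : seq K,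
    slp_run (mx_entries A B) p [::] = Some vs /\
    forall i j, slp_arg_val (mx_entries A B) vs (out i j) = (A *m B) i j.

Definition mx_mul_time (R : realType) (K : fieldType) : set R :=
  [set t | exists f : nat -> nat,
     (forall n : nat, exists (p : slp K (mx_index n))
        (out : 'I_n -> 'I_n -> slp_arg K (mx_index n)),
        multiplies p out /\ (size p <= f n)%N) /\
     big_O_pow f t].
Arguments mx_mul_time R K : clear implicits.

Definition omega (R : realType) (K : fieldType) : \bar R :=
  ereal_inf [set t%:E | t in mx_mul_time R K].

(* Main.v *)
Require Import Defs.
From mathcomp Require Import all_boot all_order all_algebra all_fingroup.
From mathcomp Require Import all_classical all_reals all_analysis.
From mathcomp Require Import zify ring lra.

(** If [T'] is the tournament [T] with the arc between [a] and [b] reversed, then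
    the embeddings of [T] and of [T'] are together those of [T] minus that pair, a
    digraph with 9 arcs.  When [a] and [b] are twins, exchanging them shows that [T]
    and [T'] have equally many embeddings; any two vertices become twins after at
    most three flips, so twice the number of embeddings of [T] is an integer
    combination of counts for 9-arc digraphs.  In such a digraph the two nonadjacent
    vertices only have to differ once the other three are placed at [x], [y], [z]: it
    suffices to know, for each pattern, how many vertices see [x], [y], [z] in that
    pattern, and for fixed [x] this is a product of two 0/1 matrices.  Hence [n]
    matrix products are enough.

    A straight-line program for [m x m] matrices is turned into a bilinear algorithm
    by Strassen's argument: along the line [t (A, B)] all results are rational
    functions regular at [t = 0], and in their expansions up to [t^2] each operation
    creates one product of two linear forms.  Clearing denominators gives an integer
    identity for [D] times the product with [r] multiplications, where [r] is at
    most twice the length of the program.  Applied recursively, breadth first, to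
    matrices of dimension [m ^ L >= n], it multiplies integer matrices on the
    machine in [O(L r ^ L)] steps with polynomially bounded numbers, and the constant
    factors disappear in the exponent as [m] grows. *)

Set Implicit Arguments.
Unset Strict Implicit.
Unset Printing Implicit Defensive.

Import Order.TTheory GRing.Theory Num.Theory.
Import numFieldNormedType.Exports.

Local Open Scope ring_scope.

(** * Expressions, loops and running times *)

(** The exponent provides unrelated straight-line programs, one per dimension, over the rationals
    and with arbitrary constants and divisions, whereas one machine program must serve all [n] with
    integers of O(log n) bits. So a single dimension [m] is used: its algorithm is a finite table of
    integers, wired into the machine program as constants. As [c(T)] is an infimum, a loss of [e] in
    the exponent is allowed, and [m] is chosen so large that [m ^ e] outweighs the constant factors
    of a level.

    Strassen's expansion usually needs a shift to a point where no denominator vanishes. Here a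
    program has to run without division by 0 on all inputs, so the zero matrices can serve as that
    point. A product of two linear forms in [(A, B)] has two mixed parts, whence the factor 2 in
    [r].

    Every level contributes one factor [D], and the final division by [D ^ L] is exact. Words stay
    short because [L] is logarithmic: a constant to the power [L] is polynomial in [n]. *)

Inductive expr :=
| EReg of nat
| ECst of int
| EBin of arith_op & expr & expr
| ELoad of expr.

Fixpoint eval (s : state) (e : expr) : int :=
  match e with
  | EReg r => reg s r
  | ECst c => c
  | EBin op a b => arith_val op (eval s a) (eval s b)
  | ELoad a => cells s (eval s a)
  end.

(* Temporaries live in the registers from [nregs] on. *)
Definition nregs : nat := 20.

Fixpoint ewf (e : expr) : bool :=
  match e with
  | EReg r => (r < nregs)%N
  | ECst _ => true
  | EBin _ a b => ewf a && ewf b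
  | ELoad a => ewf a
  end.

(* Bounds the running time of the compiled expression, and also the size of the
   intermediate values when used as an exponent; see [ebounded_weight]. *)
Fixpoint weight (e : expr) : nat :=
  match e with
  | EReg _ => 1
  | ECst c => `|c|.+1
  | EBin _ a b => (weight a + weight b).+1
  | ELoad a => (weight a).+1
  end.

Fixpoint ebounded (B : nat) (s : state) (e : expr) : Prop :=
  (`|eval s e| <= B)%N /\
  match e with
  | EReg _ | ECst _ => True
  | EBin _ a b => ebounded B s a /\ ebounded B s b
  | ELoad a => ebounded B s a
  end.

Fixpoint compile_expr (k : nat) (e : expr) : cmd :=
  match e with
  | EReg r => Arith k Add (Reg r) (Const 0)
  | ECst c => Arith k Add (Const c) (Const 0)
  | EBin op a b =>
      Seq (compile_expr k a) (Seq (compile_expr k.+1 b) (Arith k op (Reg k) (Reg k.+1)))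
  | ELoad a => Seq (compile_expr k a) (Read k (Reg k))
  end.

Definition agree (s s' : state) : Prop :=
  (forall r, (r < nregs)%N -> reg s r = reg s' r) /\ cells s =1 cells s'.

Lemma ebounded_le B s e : ebounded B s e -> (`|eval s e| <= B)%N.
Proof. by case: e => [r|c|op a b|a] []. Qed.

Lemma exec_arith_val B s r op x y v :
  arith_val op (operand_val s x) (operand_val s y) = v -> (`|v| <= B)%N ->
  exec B (Arith r op x y) s (upd_reg s r v) 1.
Proof. by move=> <- le; apply: exec_arith. Qed.

Lemma exec_write_val B s x y a v : operand_val s x = a -> operand_val s y = v ->
  (`|v| <= B)%N -> exec B (Write x y) s (upd_cell s a v) 1.
Proof. by move=> <- <- le; apply: exec_write. Qed.

(** [compile_expr k] uses the registers from [k] on as a stack, so the left operand in register [k]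
    survives the evaluation of the right one. The reference state [s] stays fixed in the induction,
    while [s0] changes with the temporaries. *)
Lemma compile_expr_exec B k e s s0 : (nregs <= k)%N -> ewf e -> ebounded B s e ->
  (forall r, (r < nregs)%N -> reg s r = reg s0 r) -> cells s =1 cells s0 ->
  exists s1 t, [/\ exec B (compile_expr k e) s0 s1 t, (t <= weight e)%N,
    reg s1 k = eval s e, (forall r, (r < k)%N -> reg s1 r = reg s0 r)
    & cells s1 = cells s0].
Proof.
elim: e k s0 => [r|c|op a IHa b IHb|a IHa] k s0 Kk /=.
- move=> rK [bd _] ag1 ag2; exists (upd_reg s0 k (reg s r)), 1%N; split => //.
  + by apply: exec_arith_val; rewrite /= -?ag1 // addr0.
  + by rewrite /= eqxx.
  + by move=> r' r'k /=; case: eqP => // e; lia.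
- move=> _ [bd _] ag1 ag2; exists (upd_reg s0 k c), 1%N; split => //.
  + by apply: exec_arith_val; rewrite //= addr0.
  + by rewrite /= eqxx.
  + by move=> r' r'k /=; case: eqP => // e; lia.
- move=> /andP[wa wb] [bd [ba bb]] ag1 ag2.
  have [s1 [t1 [e1 t1w v1 g1 c1]]] := IHa k s0 Kk wa ba ag1 ag2.
  have ag1' r : (r < nregs)%N -> reg s r = reg s1 r.
    by move=> rK; rewrite g1 ?ag1 //; apply: leq_trans rK _.
  have ag2' : cells s =1 cells s1 by rewrite c1.
  have [s2 [t2 [e2 t2w v2 g2 c2]]] := IHb k.+1 s1 (leqW Kk) wb bb ag1' ag2'.
  have v : arith_val op (reg s2 k) (reg s2 k.+1) =
           arith_val op (eval s a) (eval s b) by rewrite v2 g2 // v1.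
  exists (upd_reg s2 k (arith_val op (eval s a) (eval s b))).
  exists (t1 + (t2 + 1))%N; split.
  + apply: exec_seq e1 _; apply: exec_seq e2 _.
    exact: exec_arith_val.
  + lia.
  + by rewrite /= eqxx.
  + by move=> r' r'k /=; case: eqP => [e|_]; [lia | rewrite g2 ?g1 //; lia].
  + by rewrite /= c2.
- move=> wa [bd ba] ag1 ag2.
  have [s1 [t1 [e1 t1w v1 g1 c1]]] := IHa k s0 Kk wa ba ag1 ag2.
  eexists _, (t1 + 1)%N; split.
  + by apply: exec_seq e1 _; apply: exec_read.
  + lia.
  + by rewrite /= eqxx v1 c1 ag2.
  + by move=> r' r'k /=; case: eqP => [e|_]; [lia | rewrite g1].
  + by rewrite /= c1.
Qed.

Definition bounded (M : nat) (s : state) : Prop :=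
  (forall r, (r < nregs)%N -> (`|reg s r| <= M)%N) /\
  (forall a, (`|cells s a| <= M)%N).

Lemma absz_mod_le (a b : int) : (`|(a %% b)%Z| <= `|a| + `|b|)%N.
Proof.
have [->|b0] := eqVneq b 0; first by rewrite modz0 leq_addr.
have := modz_ge0 a b0; have := ltz_mod a b0; lia.
Qed.

Lemma weight_gt0 e : (0 < weight e)%N. Proof. by case: e. Qed.

Lemma addn_expn_le (M a b : nat) : (2 <= M)%N ->
  (M ^ a + M ^ b <= M ^ (a + b).+1)%N.
Proof.
move=> M2; rewrite expnS expnD.
have := expn_gt0 M a; have := expn_gt0 M b.
case: M M2 => // M M2 /= ha hb.
nia.
Qed.

Lemma arith_val_bound M op (a b : int) i j : (2 <= M)%N ->
  (`|a| <= M ^ i)%N -> (`|b| <= M ^ j)%N ->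
  (`|arith_val op a b| <= M ^ (i + j).+1)%N.
Proof.
move=> M2 ha hb; have hs := addn_expn_le i j M2.
have hm : (M ^ i * M ^ j <= M ^ (i + j).+1)%N.
  by rewrite -expnD leq_exp2l.
have hl : (M ^ i <= M ^ (i + j).+1)%N by rewrite leq_exp2l //; lia.
case: op => /=.
- lia.
- lia.
- by rewrite abszM; apply: leq_trans hm; apply: leq_mul.
- by apply: leq_trans (lez_div _ _) _; apply: leq_trans hl.
- by apply: leq_trans (absz_mod_le _ _) _; lia.
Qed.

Lemma ebounded_mono B B' s e : (B <= B')%N -> ebounded B s e -> ebounded B' s e.
Proof.
move=> BB; elim: e => [r|c|op a IHa b IHb|a IHa] /=.
- by case=> h _; split => //; apply: leq_trans BB.
- by case=> h _; split => //; apply: leq_trans BB.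
- case=> h [ha hb]; split; first exact: leq_trans BB.
  by split; [apply: IHa | apply: IHb].
- by case=> h ha; split; [apply: leq_trans BB | apply: IHa].
Qed.

(** Each operation at most multiplies powers of [M], up to one more factor [M], and a loaded value
    is at most [M] whatever its address. The exponent is independent of the state, so words are
    logarithmic when [M] is polynomial. *)
Lemma ebounded_weight M s e : (2 <= M)%N -> bounded M s -> ewf e ->
  ebounded (M ^ weight e) s e.
Proof.
move=> M2 [bg bc]; elim: e => [r|c|op a IHa b IHb|a IHa] /=.
- by move=> rK; rewrite expn1; split => //; apply: bg.
- move=> _; split => //; rewrite expnS.
  have : (`|c| < M ^ `|c|)%N by apply: ltn_expl.
  by move=> h; nia.
- case/andP=> wa wb; split.
    by apply: arith_val_bound => //; apply: ebounded_le; [apply: IHa | apply: IHb].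
  split; [apply: ebounded_mono (IHa wa) | apply: ebounded_mono (IHb wb)];
    rewrite leq_exp2l //; lia.
- move=> wa; split; last by apply: ebounded_mono (IHa wa); rewrite leq_exp2l.
  apply: leq_trans (bc _) _; rewrite -{1}(expn1 M) leq_exp2l //.
Qed.

(* [s] and the states in [Q] stand for machine states up to temporaries. *)
Definition spec (B : nat) (c : cmd) (s : state) (t : nat) (Q : state -> Prop) :=
  forall s0, agree s s0 -> exists s1 t1 s',
    [/\ exec B c s0 s1 t1, (t1 <= t)%N, agree s' s1 & Q s'].

Definition hset (r : nat) (e : expr) : cmd :=
  Seq (compile_expr nregs e) (Arith r Add (Reg nregs) (Const 0)).

Definition hstore (e1 e2 : expr) : cmd :=
  Seq (compile_expr nregs e1) (Seq (compile_expr nregs.+1 e2) (Write (Reg nregs) (Reg nregs.+1))).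

Definition hfor (i lim : nat) (e : expr) (c : cmd) : cmd :=
  Seq (hset lim e) (Seq (hset i (ECst 0))
    (While (Reg i) (Reg lim) (Seq c (hset i (EBin Add (EReg i) (ECst 1)))))).

Lemma spec_weaken B c s t t' (Q Q' : state -> Prop) : (t <= t')%N ->
  (forall s', Q s' -> Q' s') -> spec B c s t Q -> spec B c s t' Q'.
Proof.
move=> tt QQ h s0 ag; have [s1 [t1 [s' [e le a q]]]] := h s0 ag.
by exists s1, t1, s'; split => //; [apply: leq_trans tt | apply: QQ].
Qed.

Lemma spec_seq B c1 c2 s t1 t2 (Q1 Q : state -> Prop) :
  spec B c1 s t1 Q1 -> (forall s', Q1 s' -> spec B c2 s' t2 Q) ->
  spec B (Seq c1 c2) s (t1 + t2) Q.
Proof.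
move=> h1 h2 s0 ag; have [s1 [u1 [s1' [e1 le1 a1 q1]]]] := h1 s0 ag.
have [s2 [u2 [s2' [e2 le2 a2 q2]]]] := h2 s1' q1 s1 a1.
exists s2, (u1 + u2)%N, s2'; split => //; first exact: exec_seq e1 e2.
lia.
Qed.

Lemma spec_skip B s (Q : state -> Prop) : Q s -> spec B Skip s 1 Q.
Proof. by move=> q s0 ag; exists s0, 1%N, s; split => //; apply: exec_skip. Qed.

Lemma spec_set B r e s (Q : state -> Prop) : (r < nregs)%N -> ewf e -> ebounded B s e ->
  Q (upd_reg s r (eval s e)) -> spec B (hset r e) s (weight e).+1 Q.
Proof.
move=> rK we be q s0 [ag1 ag2].
have [s1 [t [e1 tw v g c]]] := compile_expr_exec (leqnn nregs) we be ag1 ag2.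
exists (upd_reg s1 r (eval s e)), (t + 1)%N, (upd_reg s r (eval s e)).
split => //.
- apply: exec_seq e1 _.
  by apply: exec_arith_val; rewrite /= ?v ?addr0 ?ebounded_le.
- lia.
- by split => [r' r'K|a] /=; [rewrite g // ag1 | rewrite c].
Qed.

Lemma spec_store B e1 e2 s (Q : state -> Prop) : ewf e1 -> ewf e2 ->
  ebounded B s e1 -> ebounded B s e2 ->
  Q (upd_cell s (eval s e1) (eval s e2)) ->
  spec B (hstore e1 e2) s (weight e1 + weight e2).+1 Q.
Proof.
move=> w1 w2 b1 b2 q s0 [ag1 ag2].
have [s1 [t1 [x1 tw1 v1 g1 c1]]] := compile_expr_exec (leqnn nregs) w1 b1 ag1 ag2.
have ag1' r : (r < nregs)%N -> reg s r = reg s1 r by move=> rK; rewrite g1 ?ag1.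
have ag2' : cells s =1 cells s1 by rewrite c1.
have [s2 [t2 [x2 tw2 v2 g2 c2]]] := compile_expr_exec (leqnSn nregs) w2 b2 ag1' ag2'.
exists (upd_cell s2 (eval s e1) (eval s e2)), (t1 + (t2 + 1))%N.
exists (upd_cell s (eval s e1) (eval s e2)).
split => //.
- apply: exec_seq x1 _; apply: exec_seq x2 _.
  apply: exec_write_val; [by rewrite /= g2 ?v1 | exact: v2 | exact: ebounded_le].
- lia.
- split => [r rK|a] /=; last by rewrite c2 c1 ag2.
  by rewrite g2 ?g1 ?ag1 // ltnW.
Qed.

(** The invariant speaks of the state in which the counter has just been set. An iteration costs [t]
    for the body, 5 for the increment and 1 for the test. *)
Lemma spec_for B i lim e c s (n t : nat) (I : nat -> state -> Prop)
    (Q : state -> Prop) :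
  (i < nregs)%N -> (lim < nregs)%N -> i != lim -> ewf e -> ebounded B s e ->
  (0 < B)%N -> eval s e = n ->
  I 0%N (upd_reg (upd_reg s lim n) i 0) ->
  (forall k s1, (k < n)%N -> reg s1 i = k -> reg s1 lim = n -> I k s1 ->
    spec B c s1 t (fun s2 => [/\ reg s2 i = k, reg s2 lim = n
                               & I k.+1 (upd_reg s2 i k.+1)])) ->
  (forall s1, reg s1 i = n -> reg s1 lim = n -> I n s1 -> Q s1) ->
  spec B (hfor i lim e c) s (weight e + 4 + n * (t + 6)) Q.
Proof.
move=> iK lK il we be B0 en I0 step fin.
have nB : (n <= B)%N by have := ebounded_le be; rewrite en.
(* Induction on the number [k] of iterations that remain, the counter being [n - k]. *)
have wh k : (k <= n)%N -> forall s1, reg s1 i = (n - k)%N -> reg s1 lim = n ->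
    I (n - k)%N s1 ->
    spec B (While (Reg i) (Reg lim) (Seq c (hset i (EBin Add (EReg i) (ECst 1)))))
      s1 (1 + k * (t + 6)) Q.
  elim: k => [|k IHk] kn s1 h1 h2 h3 s0 ag.
    rewrite subn0 in h1 h3.
    exists s0, 1%N, s1; split => //; last exact: fin.
    apply: exec_while_done; case: ag => ag1 _.
    by rewrite /= -!ag1 // h1 h2 ltxx.
  have kn1 : (n - k.+1 < n)%N by lia.
  have nk : (n - k.+1).+1 = (n - k)%N by lia.
  have st := step _ s1 kn1 h1 h2 h3.
  have body : spec B (Seq c (hset i (EBin Add (EReg i) (ECst 1)))) s1 (t + 5)
      (fun s2 => [/\ reg s2 i = (n - k)%N, reg s2 lim = n & I (n - k)%N s2]).
    apply: spec_seq st _ => s2 [r1 r2 r3].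
    have ev : eval s2 (EBin Add (EReg i) (ECst 1)) = (n - k)%N.
      by rewrite /= r1; lia.
    apply: (@spec_set _ _ (EBin Add (EReg i) (ECst 1))) => //.
    + by rewrite /= iK.
    + split; first by rewrite ev; lia.
      by rewrite /= r1; split; [split=> //; exact: leq_trans (leq_subr _ _) nB | split].
    + by rewrite ev /= eqxx [lim == i]eq_sym (negPf il) -nk.
  have [s2 [u1 [s2' [x1 le1 ag2 [q1 q2 q3]]]]] := body s0 ag.
  have [s3 [u2 [s3' [x2 le2 ag3 q]]]] := IHk (ltnW kn) s2' q1 q2 q3 s2 ag2.
  exists s3, (u1 + u2).+1, s3'; split => //; last by move: le1 le2; rewrite /= mulSn; lia.
  apply: exec_while_loop x1 x2; case: ag => ag1 _.
  by rewrite /= -!ag1 // h1 h2; lia.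
have -> : (weight e + 4 + n * (t + 6) = (weight e).+1 + (2 + (1 + n * (t + 6))))%N.
  by lia.
apply: (spec_seq (Q1 := fun s1 => s1 = upd_reg s lim n)) => [|_ ->].
  by apply: spec_set => //; rewrite en.
apply: (spec_seq (t1 := 2)
  (Q1 := fun s1 => s1 = upd_reg (upd_reg s lim n) i 0)) => [|_ ->].
  exact: (@spec_set _ _ (ECst 0)).
apply: (wh n) => //=.
- by rewrite eqxx subnn.
- by rewrite [lim == i]eq_sym (negPf il) eqxx.
- by rewrite subnn.
Qed.

(** * Loops that fill an array or add up terms *)

Definition map_idx : nat := 10.
Definition map_lim : nat := 11.

(** The memory after [k] iterations of a loop that fills an array with base [b]. *)
Definition setarr (h : int -> int) (b k : nat) (V : nat -> int) : int -> int :=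
  fun a => if (b%:Z <= a) && (a < (b + k)%N%:Z) then V `|a - b%:Z|%N else h a.

Definition loop_regs (s : state) (S k : nat) : nat -> int :=
  fun r => if r == map_idx then k%:Z else if r == map_lim then S%:Z else reg s r.

Lemma eval_ext s s' e : reg s =1 reg s' -> cells s =1 cells s' ->
  eval s e = eval s' e.
Proof.
move=> er ec; elim: e => [x|c|op a IHa b IHb|a IHa] //=.
- by rewrite IHa IHb.
- by rewrite IHa.
Qed.

Definition hmap (rd rs : nat) (e : expr) : cmd :=
  hfor map_idx map_lim (EReg rs) (hstore (EBin Add (EReg rd) (EReg map_idx)) e).

Definition hsum (acc rs : nat) (e : expr) : cmd :=
  hfor map_idx map_lim (EReg rs) (hset acc (EBin Add (EReg acc) e)).

Lemma setarr_out h b k V (a : int) : (a < b%:Z) || ((b + k)%N%:Z <= a) ->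
  setarr h b k V a = h a.
Proof. by rewrite /setarr; case: ifP => // /andP[h1 h2] /orP[]; lia. Qed.

Lemma setarr_in h b k V (x : nat) : (x < k)%N -> setarr h b k V (b + x)%N = V x.
Proof.
move=> xk; rewrite /setarr ifT; last by apply/andP; split; lia.
by congr (V _); lia.
Qed.

Lemma setarr_bound h b k V M : (forall a, (`|h a| <= M)%N) ->
  (forall x, (x < k)%N -> (`|V x| <= M)%N) ->
  forall a, (`|setarr h b k V a| <= M)%N.
Proof.
move=> hh hV a; rewrite /setarr; case: ifP => // /andP[h1 h2].
by apply: hV; lia.
Qed.

Lemma loop_regs_bound s S k M : bounded M s -> (S <= M)%N -> (k <= M)%N ->
  forall r, (r < nregs)%N -> (`|loop_regs s S k r| <= M)%N.
Proof. by move=> [br _] SM kM r rK; rewrite /loop_regs; do 2 case: ifP => // _; exact: br. Qed.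

Section Loops.

Variables (B M W : nat).
Hypotheses (M2 : (2 <= M)%N) (MB : (M ^ W <= B)%N).

(** The slack 12 covers the overhead of an iteration of [hmap] or [hsum] and the larger expressions
    built around [e] there, so that [W] serves both as a time bound and as an exponent. *)
Definition small (e : expr) : bool := ewf e && (weight e + 12 <= W)%N.

Lemma small_ebounded s e : bounded M s -> ewf e -> (weight e <= W)%N -> ebounded B s e.
Proof.
move=> bs we le; apply: ebounded_mono (ebounded_weight M2 bs we).
by apply: leq_trans MB; rewrite leq_exp2l.
Qed.

Lemma B_gt0 : (0 < B)%N.
Proof. by apply: leq_trans MB; rewrite expn_gt0; lia. Qed.

Lemma spec_hset r e s (Q : state -> Prop) : (r < nregs)%N -> small e ->
  bounded M s -> Q (upd_reg s r (eval s e)) -> spec B (hset r e) s W Q.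
Proof.
move=> rK /andP[we le] bs q.
apply: (spec_weaken (t := (weight e).+1) (Q := Q)) => //; first by lia.
apply: spec_set => //; apply: small_ebounded => //; lia.
Qed.

Lemma bounded_upd s r v : bounded M s -> (`|v| <= M)%N -> bounded M (upd_reg s r v).
Proof. by case=> b1 b2 vM; split => // r' r'K /=; case: ifP => // _; exact: b1. Qed.

(** [e] is evaluated in a memory whose first [k] entries are already overwritten. An array may thus
    be updated in place if entry [k] depends only on cells not yet reached. *)
Lemma spec_map rd rs e s (b S : nat) (V : nat -> int) (Q : state -> Prop) :
  (rd < nregs)%N -> (rs < nregs)%N -> rd != map_idx -> rd != map_lim -> small e -> bounded M s ->
  reg s rd = b -> reg s rs = S ->
  (forall k, (k < S)%N -> (`|V k| <= M)%N) ->
  (forall k, (k < S)%N ->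
     eval (State (loop_regs s S k) (setarr (cells s) b k V)) e = V k) ->
  (forall s', reg s' =1 loop_regs s S S -> cells s' =1 setarr (cells s) b S V -> Q s') ->
  spec B (hmap rd rs e) s (W * S.+1) Q.
Proof.
move=> rdK rsK rdi rdl /andP[we le] bs rdb rsS Vb ev fin.
have SM : (S <= M)%N by case: bs => br _; have := br _ rsK; rewrite rsS.
have W1 : (1 < W)%N by have := weight_gt0 e; lia.
apply: (spec_weaken (t := (1 + 4 + S * ((3 + weight e).+1 + 6))%N) (Q := Q)) => //.
  by nia.
apply: (spec_for (n := S) (I := fun k s1 =>
  reg s1 =1 loop_regs s S k /\ cells s1 =1 setarr (cells s) b k V)) => //.
- by apply: small_ebounded => //=; lia.
- exact: B_gt0.
- split => [x|a] /=.
    by rewrite /loop_regs; do 2 case: eqP => //.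
  by rewrite setarr_out //; lia.
- move=> k s1 kS ri rl [hr hc].
  have kM : (k <= M)%N by apply: leq_trans SM; exact: ltnW.
  have bs1 : bounded M s1.
    split => [x xK|a]; first by rewrite hr; apply: loop_regs_bound.
    rewrite hc; apply: setarr_bound => [a'|x xk]; first by case: bs.
    by apply: Vb; apply: ltn_trans kS.
  have eve : eval s1 e = V k.
    by rewrite -ev //; apply: eval_ext.
  have eva : eval s1 (EBin Add (EReg rd) (EReg map_idx)) = (b + k)%N.
    by rewrite /= ri hr /loop_regs (negPf rdi) (negPf rdl) rdb.
  apply: spec_store => //.
  + by rewrite /= rdK.
  + by apply: small_ebounded => //=; rewrite ?rdK //; lia.
  + by apply: small_ebounded => //; lia.
  + rewrite eve eva; split => //; split => [x|a] /=.
      by rewrite hr /loop_regs; do 2 case: eqP => //.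
    case: eqP => [->|ne]; first by rewrite setarr_in.
    rewrite hc /setarr; congr (if _ then _ else _).
    lia.
- by move=> s1 _ _ [hr hc]; apply: fin.
Qed.

(** All partial sums have to be bounded, and not only the total: a write beyond the word size has no
    execution. *)
Lemma spec_sum acc rs e s (S : nat) (a0 : int) (V : nat -> int) (Q : state -> Prop) :
  (acc < nregs)%N -> (rs < nregs)%N -> acc != map_idx -> acc != map_lim -> small e -> bounded M s ->
  reg s acc = a0 -> reg s rs = S ->
  (forall k, (k <= S)%N -> (`|(a0 + \sum_(j < k) V j)%R| <= M)%N) ->
  (forall k, (k < S)%N ->
     eval (upd_reg (State (loop_regs s S k) (cells s)) acc (a0 + \sum_(j < k) V j)) e
     = V k) ->
  (forall s', (forall x, x != acc -> reg s' x = loop_regs s S S x) ->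
     reg s' acc = a0 + \sum_(j < S) V j ->
     cells s' =1 cells s -> Q s') ->
  spec B (hsum acc rs e) s (W * S.+1) Q.
Proof.
move=> aK rsK ai al /andP[we le] bs ra rsS Vb ev fin.
have SM : (S <= M)%N by case: bs => br _; have := br _ rsK; rewrite rsS.
have W1 : (1 < W)%N by have := weight_gt0 e; lia.
apply: (spec_weaken (t := (1 + 4 + S * ((1 + weight e).+2 + 6))%N) (Q := Q)) => //.
  by nia.
apply: (spec_for (n := S) (I := fun k s1 =>
  reg s1 =1 reg (upd_reg (State (loop_regs s S k) (cells s)) acc (a0 + \sum_(j < k) V j))
  /\ cells s1 =1 cells s)) => //.
- by apply: small_ebounded => //=; lia.
- exact: B_gt0.
- split => [x|a] //=.
  rewrite big_ord0 addr0 /loop_regs; case: (x =P acc) => [->|_].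
    by rewrite (negPf ai) (negPf al).
  by do 2 case: eqP => //.
- move=> k s1 kS ri rl [hr hc].
  have kM : (k <= M)%N by apply: leq_trans SM; exact: ltnW.
  have bs1 : bounded M s1.
    split => [x xK|a]; last by rewrite hc; case: bs.
    rewrite hr /=; case: ifP => _; first by apply: Vb; apply: ltnW.
    exact: loop_regs_bound.
  have eve : eval s1 e = V k.
    by rewrite -ev //; apply: eval_ext.
  have eva : eval s1 (EBin Add (EReg acc) e) = a0 + \sum_(j < k.+1) V j.
    by rewrite /= eve hr /= eqxx big_ord_recr /= addrA.
  apply: (@spec_set _ _ (EBin Add (EReg acc) e)) => //.
  + by rewrite /= aK.
  + by apply: small_ebounded => //=; rewrite ?aK //; lia.
  + rewrite eva /= eq_sym (negPf ai) eq_sym (negPf al); split => //.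
    split => [x|a] //=.
    case: (x =P acc) => [->|xa].
      by rewrite (negPf ai).
    by rewrite hr /= /loop_regs; do 2 case: eqP => //.
- move=> s1 _ _ [hr hc]; apply: fin => //.
  + by move=> x xa; rewrite hr /= (negPf xa).
  + by rewrite hr /= eqxx.
Qed.

End Loops.

(** * Bilinear algorithms and block recursion *)

(* Block [x] of a list of square matrices of size [p], stored row by row. *)
Definition addr (p x i j : nat) : nat := ((x * p + i) * p + j)%N.

(** Block [b * r + l] of the result combines, with coefficients [u l], the [m * m] subblocks of
    dimension [q] of block [b] of [f]. Block number and coordinates are decoded from the flat index
    [x]. *)
Definition downf (r m : nat) (u : nat -> nat -> nat -> int) (q : nat)
    (f : nat -> int) (x : nat) : int :=
  \sum_(i < m) \sum_(j < m) u (x %/ (q * q) %% r)%N i j *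
    f (addr (q * m) (x %/ (q * q) %/ r) (i * q + x %/ q %% q) (j * q + x %% q)).

(** The way back: subblock [(i, j)] of block [b] combines the blocks [b * r + l] with coefficients
    [w l i j]. *)
Definition upf (r m : nat) (w : nat -> nat -> nat -> int) (q : nat)
    (f : nat -> int) (x : nat) : int :=
  let p := (q * m)%N in
  \sum_(l < r) w l (x %/ p %% p %/ q)%N (x %% p %/ q)%N *
    f (addr q (x %/ (p * p) * r + l) (x %/ p %% p %% q) (x %% p %% q)).

(* [D] times the [m x m] matrix multiplication tensor has rank at most [r]. *)
Definition bilinear_alg (m r : nat) (D : int) (u v w : nat -> nat -> nat -> int) : Prop :=
  forall a b a' c c' b' : 'I_m,
    \sum_(l < r) w l a b * (u l a' c * v l c' b') =
    D * ((a' == a) && (c' == c) && (b' == b))%:R.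

Lemma ltn_mulD (a b c d : nat) : (a < b)%N -> (c < d)%N -> (a * d + c < b * d)%N.
Proof.
move=> ab cd; apply: (@leq_trans (a.+1 * d)); first by rewrite mulSnr ltn_add2l.
by rewrite leq_mul2r ab orbT.
Qed.

Lemma addr_col p x i j : (j < p)%N -> (addr p x i j %% p = j)%N.
Proof. by move=> jp; rewrite /addr modnMDl modn_small. Qed.

Lemma addr_row p x i j : (i < p)%N -> (j < p)%N -> (addr p x i j %/ p %% p = i)%N.
Proof.
move=> ip jp; have p0 : (0 < p)%N by apply: leq_ltn_trans jp.
by rewrite /addr divnMDl // divn_small // addn0 modnMDl modn_small.
Qed.

Lemma addr_blk p x i j : (i < p)%N -> (j < p)%N -> (addr p x i j %/ (p * p) = x)%N.
Proof.
move=> ip jp; have p0 : (0 < p)%N by apply: leq_ltn_trans jp.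
by rewrite divnMA /addr divnMDl // [(j %/ p)%N]divn_small // addn0 divnMDl // divn_small // addn0.
Qed.

Lemma addr_lt p s x i j : (x < s)%N -> (i < p)%N -> (j < p)%N ->
  (addr p x i j < s * (p * p))%N.
Proof.
by move=> xs ip jp; rewrite /addr mulnA; apply: ltn_mulD => //; apply: ltn_mulD.
Qed.

Lemma downfE r m u q f x l i j : (l < r)%N -> (i < q)%N -> (j < q)%N ->
  downf r m u q f (addr q (x * r + l) i j) =
  \sum_(a < m) \sum_(b < m) u l a b *
    f (addr (q * m) x (a * q + i) (b * q + j)).
Proof.
move=> lr iq jq; have r0 : (0 < r)%N by apply: leq_ltn_trans lr.
rewrite /downf addr_blk // addr_row // addr_col // modnMDl modn_small //.
by rewrite divnMDl // divn_small // addn0.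
Qed.

Lemma upfE r m w q f x a b i j : (a < m)%N -> (b < m)%N -> (i < q)%N -> (j < q)%N ->
  upf r m w q f (addr (q * m) x (a * q + i) (b * q + j)) =
  \sum_(l < r) w l a b * f (addr q (x * r + l) i j).
Proof.
move=> am bm iq jq; have q0 : (0 < q)%N by apply: leq_ltn_trans iq.
have ai : (a * q + i < q * m)%N by rewrite [(q * m)%N]mulnC ltn_mulD.
have bj : (b * q + j < q * m)%N by rewrite [(q * m)%N]mulnC ltn_mulD.
rewrite /upf addr_blk // addr_row // addr_col //.
by rewrite !modnMDl !modn_small // !divnMDl // !divn_small // !addn0.
Qed.

Lemma sum_split_block (m q : nat) (F : nat -> int) : (0 < q)%N ->
  \sum_(k < q * m) F k = \sum_(a < m) \sum_(i < q) F (a * q + i)%N.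
Proof.
move=> q0; elim: m => [|m IH]; first by rewrite muln0 !big_ord0.
rewrite big_ord_recr /= -IH mulnS addnC big_split_ord /=.
by congr (_ + _); apply: eq_bigr => i _; rewrite mulnC.
Qed.

(* One level of the recursion on [m x m] blocks. *)
Lemma block_mul (m r : nat) (D d : int) u v w q x (a b c : nat -> int) :
  bilinear_alg m r D u v w -> (0 < q)%N ->
  (forall l i j, (l < r)%N -> (i < q)%N -> (j < q)%N ->
     c (addr q (x * r + l) i j) =
     d * \sum_(k < q) downf r m u q a (addr q (x * r + l) i k) *
                      downf r m v q b (addr q (x * r + l) k j)) ->
  forall i j, (i < q * m)%N -> (j < q * m)%N ->
    upf r m w q c (addr (q * m) x i j) =
    d * D * \sum_(k < q * m) a (addr (q * m) x i k) * b (addr (q * m) x k j).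
Proof.
move=> dec q0 hc I J Iq Jq.
rewrite (divn_eq I q) (divn_eq J q).
have Ai : (I %/ q < m)%N by rewrite ltn_divLR // mulnC.
have Aj : (J %/ q < m)%N by rewrite ltn_divLR // mulnC.
have iq : (I %% q < q)%N by rewrite ltn_pmod.
have jq : (J %% q < q)%N by rewrite ltn_pmod.
move: (I %/ q)%N (J %/ q)%N (I %% q)%N (J %% q)%N Ai Aj iq jq => a0 b0 i j am bm iq jq.
rewrite upfE //.
pose A0 := Ordinal am; pose B0 := Ordinal bm.
pose X (a1 : 'I_m) k c1 := a (addr (q * m) x (a1 * q + i) (c1 * q + k)).
pose Y c2 k (b2 : 'I_m) := b (addr (q * m) x (c2 * q + k) (b2 * q + j)).
(* Exchanging the sums isolates, for each product of an entry of [a] and an entry of [b], its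
   coefficient in the bilinear algorithm, which [dec] evaluates to [D] times a Kronecker delta. *)
transitivity (d * \sum_(k < q) \sum_(a1 < m) \sum_(c1 < m) \sum_(c2 < m)
   \sum_(b2 < m) X a1 k c1 * Y c2 k b2 *
     (\sum_(l < r) w l a0 b0 * (u l a1 c1 * v l c2 b2))).
  transitivity (\sum_(l < r) d * \sum_(k < q) \sum_(a1 < m) \sum_(c1 < m)
     \sum_(c2 < m) \sum_(b2 < m) X a1 k c1 * Y c2 k b2 *
     (w l a0 b0 * (u l a1 c1 * v l c2 b2))).
    apply: eq_bigr => l _; rewrite hc // mulrCA; congr (_ * _).
    rewrite mulr_sumr; apply: eq_bigr => k _; rewrite !downfE //.
    rewrite mulr_suml mulr_sumr; apply: eq_bigr => a1 _.
    rewrite mulr_suml mulr_sumr; apply: eq_bigr => c1 _.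
    rewrite !mulr_sumr; apply: eq_bigr => c2 _.
    rewrite !mulr_sumr; apply: eq_bigr => b2 _.
    rewrite /X /Y; ring.
  rewrite -mulr_sumr; congr (_ * _).
  rewrite exchange_big; apply: eq_bigr => k _.
  rewrite exchange_big; apply: eq_bigr => a1 _.
  rewrite exchange_big; apply: eq_bigr => c1 _.
  rewrite exchange_big; apply: eq_bigr => c2 _.
  rewrite exchange_big; apply: eq_bigr => b2 _.
  by rewrite mulr_sumr.
rewrite -mulrA; congr (_ * _).
rewrite (@sum_split_block m q
  (fun l => a (addr (q * m) x (a0 * q + i) l) * b (addr (q * m) x l (b0 * q + j)))) //.
rewrite [in RHS]exchange_big [RHS]mulr_sumr; apply: eq_bigr => k _ /=.
rewrite (bigD1 A0) //= [X in _ + X]big1 ?addr0; last first.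
  move=> a1 na; apply: big1 => c1 _; apply: big1 => c2 _; apply: big1 => b2 _.
  by rewrite (dec A0 B0 a1 c1 c2 b2) (negPf na) mulr0 mulr0.
rewrite mulr_sumr; apply: eq_bigr => c1 _.
rewrite (bigD1 c1) //= [X in _ + X]big1 ?addr0; last first.
  move=> c2 nc; apply: big1 => b2 _.
  by rewrite (dec A0 B0 A0 c1 c2 b2) (negPf nc) andbF mulr0 mulr0.
rewrite (bigD1 B0) //= [X in _ + X]big1 ?addr0; last first.
  by move=> b2 nb; rewrite (dec A0 B0 A0 c1 c1 b2) (negPf nb) andbF mulr0 mulr0.
by rewrite (dec A0 B0 A0 c1 c1 B0) !eqxx mulr1 mulrC.
Qed.

(** * Matrix multiplication on the machine *)

Declare Scope expr_scope.
Delimit Scope expr_scope with X.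
Notation "a + b" := (EBin Add a b) : expr_scope.
Notation "a - b" := (EBin Defs.Sub a b) : expr_scope.
Notation "a * b" := (EBin Mul a b) : expr_scope.
Notation "a / b" := (EBin Div a b) : expr_scope.
Notation "a %% b" := (EBin Mod a b) : expr_scope.

Definition esum (l : seq expr) : expr := foldr (EBin Add) (ECst 0) l.

(* [1 / (1 + d^2)] is 1 if [d = 0] and 0 otherwise. *)
Definition eind (a b : expr) : expr :=
  (ECst 1 / (ECst 1 + (a - b) * (a - b)))%X.

(** Table lookup: the coefficients are not in memory, so the table is unrolled into constants. Its
    size does not depend on [n]. *)
Definition esel (k : nat) (f : nat -> int) (e : expr) : expr :=
  esum [seq (eind e (ECst i%:Z) * ECst (f i))%X | i <- iota 0 k].

Lemma eval_esum s (l : seq nat) (F : nat -> expr) :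
  eval s (esum [seq F i | i <- l]) = \sum_(i <- l) eval s (F i).
Proof.
elim: l => [|i l IH]; first by rewrite big_nil.
by rewrite big_cons -IH.
Qed.

Lemma eval_esum_iota s k (F : nat -> expr) :
  eval s (esum [seq F i | i <- iota 0 k]) = \sum_(i < k) eval s (F i).
Proof. by rewrite eval_esum -[k in iota 0 k]subn0 big_mkord. Qed.

Lemma eval_eind s a b : eval s (eind a b) = (eval s a == eval s b)%:R.
Proof.
rewrite /=; have [->|ne] := eqVneq (eval s a) (eval s b).
  by rewrite subrr mulr0 addr0 divz1.
rewrite divz_small //; apply/andP; split => //.
have : eval s a - eval s b != 0 by rewrite subr_eq0.
by move: (_ - _) => x; nia.
Qed.

Lemma eval_esel s k f e i : eval s e = i%:Z -> (i < k)%N ->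
  eval s (esel k f e) = f i.
Proof.
move=> ei ik; rewrite eval_esum_iota (bigD1 (Ordinal ik)) //=.
have E j : arith_val Mul (eval s (eind e (ECst j%:Z))) (f j) = (i == j)%:R * f j.
  by rewrite eval_eind /= ei eqz_nat.
rewrite big1 => [|j nj]; first by rewrite [LHS]addr0 [LHS]E eqxx mul1r.
rewrite [LHS]E (_ : (i == j) = false) ?mul0r //.
by apply/eqP => ij; case/eqP: nj; apply: val_inj.
Qed.

Lemma ewf_esum (l : seq nat) (F : nat -> expr) : (forall i, ewf (F i)) ->
  ewf (esum [seq F i | i <- l]).
Proof. by move=> wF; elim: l => //= i l ->; rewrite wF. Qed.

Lemma ewf_esel k f e : ewf e -> ewf (esel k f e).
Proof. by move=> we; apply: ewf_esum => i /=; rewrite we. Qed.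

(* With [L = up_log m n], [N = m ^ L] and [Z = r ^ L]: [rN], [rL] and [rD] hold
   [N], [L] and [D ^ L]; [rA], [rB], [rT] and [rC] hold the bases [Z], ..., [4Z] of
   four arrays; [rs] and [rq] hold the number of blocks and their dimension on the
   current level, [rS] the size of the array to be written. *)
Definition rn := 0%N.
Definition rN := 1%N.
Definition rL := 2%N.
Definition rD := 3%N.
Definition rA := 4%N.
Definition rB := 5%N.
Definition rT := 6%N.
Definition rC := 7%N.
Definition rq := 8%N.
Definition rs := 9%N.
Definition rS := 12%N.

Definition eX := EReg map_idx.
Definition eQ := EReg rq.

(** [i] and [j] are unrolled, but the index [l] of the linear form depends on the address and needs
    [esel]. In [eup] it is the pair of block coordinates that does, encoded as one number below
    [m * m]. *)
Definition edown (rb r m : nat) (u : nat -> nat -> nat -> int) : expr :=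
  esum [seq esum [seq
    (esel r (fun l => u l i j) (eX / (eQ * eQ) %% ECst r%:Z) *
     ELoad (EReg rb + (((eX / (eQ * eQ) / ECst r%:Z) * (eQ * ECst m%:Z)
        + (ECst i%:Z * eQ + eX / eQ %% eQ)) * (eQ * ECst m%:Z)
        + (ECst j%:Z * eQ + eX %% eQ))))%X
    | j <- iota 0 m] | i <- iota 0 m].

Definition eup (rb r m : nat) (w : nat -> nat -> nat -> int) : expr :=
  let p := (eQ * ECst m%:Z)%X in
  esum [seq
    (esel (m * m) (fun z => w l (z %/ m)%N (z %% m)%N)
       (eX / p %% p / eQ * ECst m%:Z + eX %% p / eQ) *
     ELoad (EReg rb + (((eX / (p * p) * ECst r%:Z + ECst l%:Z) * eQ
        + eX / p %% p %% eQ) * eQ + eX %% p %% eQ)))%X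
    | l <- iota 0 r].

Lemma ewf_edown rb r m u : (rb < nregs)%N -> ewf (edown rb r m u).
Proof.
move=> rbK; apply: ewf_esum => i; apply: ewf_esum => j.
by apply/andP; split; [apply: ewf_esel | rewrite /= rbK].
Qed.

Lemma ewf_eup rb r m w : (rb < nregs)%N -> ewf (eup rb r m w).
Proof.
move=> rbK; apply: ewf_esum => i.
by apply/andP; split; [apply: ewf_esel | rewrite /= rbK].
Qed.

Lemma eval_edown st rb r m u q x b s f : reg st rq = q%:Z -> reg st map_idx = x%:Z ->
  reg st rb = b%:Z -> (0 < q)%N -> (0 < r)%N ->
  (forall y, (y < s * ((q * m) * (q * m)))%N -> cells st (b + y)%N = f y) ->
  (x < s * r * (q * q))%N ->
  eval st (edown rb r m u) = downf r m u q f x.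
Proof.
move=> hq hx hb q0 r0 hc xs; rewrite eval_esum_iota; apply: eq_bigr => i _.
rewrite eval_esum_iota; apply: eq_bigr => j _.
have l_lt : (x %/ (q * q) %% r < r)%N by rewrite ltn_pmod.
have e1 : eval st (eX / (eQ * eQ) %% ECst r%:Z)%X = (x %/ (q * q) %% r)%N%:Z.
  by rewrite /= hx hq -PoszM divz_nat modz_nat.
have e2 : eval st (EReg rb + (((eX / (eQ * eQ) / ECst r%:Z) * (eQ * ECst m%:Z)
        + (ECst i%:Z * eQ + eX / eQ %% eQ)) * (eQ * ECst m%:Z)
        + (ECst j%:Z * eQ + eX %% eQ)))%X =
   (b + addr (q * m) (x %/ (q * q) %/ r) (i * q + x %/ q %% q) (j * q + x %% q))%N%:Z.
  by rewrite /= hx hq hb -!PoszM !divz_nat !modz_nat /addr !(PoszD, PoszM).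
have -> : eval st (EBin Mul (esel r (fun l => u l i j) (eX / (eQ * eQ) %% ECst r%:Z)%X)
    (ELoad (EReg rb + (((eX / (eQ * eQ) / ECst r%:Z) * (eQ * ECst m%:Z)
        + (ECst i%:Z * eQ + eX / eQ %% eQ)) * (eQ * ECst m%:Z)
        + (ECst j%:Z * eQ + eX %% eQ))))%X) =
   eval st (esel r (fun l => u l i j) (eX / (eQ * eQ) %% ECst r%:Z)%X) *
   cells st (eval st (EReg rb + (((eX / (eQ * eQ) / ECst r%:Z) * (eQ * ECst m%:Z)
        + (ECst i%:Z * eQ + eX / eQ %% eQ)) * (eQ * ECst m%:Z)
        + (ECst j%:Z * eQ + eX %% eQ)))%X) by [].
rewrite (eval_esel _ e1 l_lt) e2 hc //.
apply: addr_lt.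
- by rewrite ltn_divLR // ltn_divLR // muln_gt0 q0.
- by rewrite [(q * m)%N]mulnC ltn_mulD // ltn_pmod.
- by rewrite [(q * m)%N]mulnC ltn_mulD // ltn_pmod.
Qed.

Lemma eval_eup st rb r m w q x b s f : reg st rq = q%:Z -> reg st map_idx = x%:Z ->
  reg st rb = b%:Z -> (0 < q)%N -> (0 < m)%N ->
  (forall y, (y < s * r * (q * q))%N -> cells st (b + y)%N = f y) ->
  (x < s * ((q * m) * (q * m)))%N ->
  eval st (eup rb r m w) = upf r m w q f x.
Proof.
move=> hq hx hb q0 m0 hc xs; rewrite eval_esum_iota; apply: eq_bigr => l _.
set p := (eQ * ECst m%:Z)%X.
have p0 : (0 < q * m)%N by rewrite muln_gt0 q0.
set I := (x %/ (q * m) %% (q * m))%N; set J := (x %% (q * m))%N.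
have I_lt : (I %/ q < m)%N by rewrite ltn_divLR // mulnC ltn_pmod.
have J_lt : (J %/ q < m)%N by rewrite ltn_divLR // mulnC ltn_pmod.
set E1 := (eX / p %% p / eQ * ECst m%:Z + eX %% p / eQ)%X.
set E2 := (EReg rb + (((eX / (p * p) * ECst r%:Z + ECst l%:Z) * eQ
        + eX / p %% p %% eQ) * eQ + eX %% p %% eQ))%X.
have e1 : eval st E1 = (I %/ q * m + J %/ q)%N%:Z.
  by rewrite /= hx hq !(divz_nat, modz_nat, =^~ PoszM, =^~ PoszD).
have e2 : eval st E2 =
    (b + addr q (x %/ ((q * m) * (q * m)) * r + l) (I %% q) (J %% q))%N%:Z.
  by rewrite /= hx hq hb !(divz_nat, modz_nat, =^~ PoszM, =^~ PoszD).
have ij : (I %/ q * m + J %/ q < m * m)%N by rewrite ltn_mulD.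
transitivity (eval st (esel (m * m) (fun z => w l (z %/ m)%N (z %% m)%N) E1) *
              cells st (eval st E2)); first by [].
rewrite (eval_esel _ e1 ij) e2 hc.
  by rewrite divnMDl // [(J %/ q %/ m)%N]divn_small // addn0 modnMDl modn_small.
apply: addr_lt; rewrite ?ltn_pmod // ltn_mulD //.
by rewrite ltn_divLR // muln_gt0 p0.
Qed.

Definition ecopy : expr := ELoad (EReg rT + eX)%X.

Lemma down_timeE W t : (3 * W + 4 * t = W + (W + (2 * t + (2 * t + W))))%N.
Proof. lia. Qed.

Lemma up_timeE W t : (3 * W + 2 * t = W + (W + (2 * t + W)))%N.
Proof. lia. Qed.

(* The array is rebuilt in the scratch region first: every new entry depends on
   several old ones. *)
Definition htransform (rb : nat) (e : expr) : cmd :=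
  Seq (hmap rT rS e) (hmap rb rS ecopy).

(** After [L] levels the blocks are 1 x 1, so the [r ^ L] products are entrywise. *)
Definition edot : expr := (ELoad (EReg rA + eX) * ELoad (EReg rB + eX))%X.

Definition hdown (r m : nat) u v : cmd :=
  Seq (hset rq (eQ / ECst m%:Z)%X)
  (Seq (hset rS (EReg rs * ECst r%:Z * (eQ * eQ))%X)
  (Seq (htransform rA (edown rA r m u))
  (Seq (htransform rB (edown rB r m v))
       (hset rs (EReg rs * ECst r%:Z)%X)))).

Definition hup (r m : nat) w : cmd :=
  Seq (hset rs (EReg rs / ECst r%:Z)%X)
  (Seq (hset rS (EReg rs * ((eQ * ECst m%:Z) * (eQ * ECst m%:Z)))%X)
  (Seq (htransform rA (eup rA r m w))
       (hset rq (eQ * ECst m%:Z)%X))).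

Definition hmatmul (r m : nat) u v w (eA eB : expr) : cmd :=
  Seq (hset rq (EReg rN))
  (Seq (hset rs (ECst 1))
  (Seq (hset rS (EReg rN * EReg rN)%X)
  (Seq (hmap rA rS eA)
  (Seq (hmap rB rS eB)
  (Seq (hfor 15 16 (EReg rL) (hdown r m u v))
  (Seq (hmap rA rs edot)
       (hfor 15 16 (EReg rL) (hup r m w)))))))).

(** The registers that [hmatmul] may change, apart from temporaries. *)
Definition mmregs : seq nat := [:: rq; rs; map_idx; map_lim; rS; 15; 16]%N.

Fixpoint down_iter (r m : nat) u (L : nat) (f : nat -> int) (k : nat) : nat -> int :=
  if k is k'.+1 then downf r m u (m ^ (L - k'.+1)) (down_iter r m u L f k') else f.

Fixpoint up_iter (r m : nat) w (f : nat -> int) (k : nat) : nat -> int :=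
  if k is k'.+1 then upf r m w (m ^ k') (up_iter r m w f k') else f.

(** * Copies of a tournament and arc flips *)

Definition tourn (T : finType) (g : rel T) : Prop :=
  (forall x, g x x = false) /\ (forall x y, x != y -> g x y = ~~ g y x).

Definition garc (n : nat) (G : tournament n) : rel 'I_n := fun x y => (x, y) \in arcs G.

Lemma garcP n (G : tournament n) : tourn (garc G).
Proof.
have /andP[/forallP h1 /forallP h2] := arcsP G; split => [x|x y ne].
  by apply/negbTE/h1.
by have /forallP/(_ y)/implyP/(_ ne) := h2 x; rewrite /garc; do 2 case: (_ \in _).
Qed.

(** Both directions are prescribed, so between tournaments injectivity is automatic: [f i = f j]
    would give [t i j = t j i]. *)
Definition emb (k n : nat) (t : rel 'I_k) (g : rel 'I_n) : nat :=
  #|[set f : {ffun 'I_k -> 'I_n} |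
     [forall i, forall j, (i != j) ==> (g (f i) (f j) == t i j)]]|.

Section Copies.

Variables (k : nat) (T : tournament k).

Definition autos : {set {perm 'I_k}} :=
  [set s : {perm 'I_k} | [forall i, forall j, (i != j) ==> (garc T (s i) (s j) == garc T i j)]].

Lemma autos_gt0 : (0 < #|autos|)%N.
Proof.
apply/card_gt0P; exists 1%g; rewrite inE; apply/forallP => i; apply/forallP => j.
by rewrite !perm1 eqxx implybT.
Qed.

Lemma embP n (G : tournament n) (f : {ffun 'I_k -> 'I_n}) :
  reflect (injective f /\ forall i j, garc T i j -> garc G (f i) (f j))
    [forall i, forall j, (i != j) ==> (garc G (f i) (f j) == garc T i j)].
Proof.
have [t1 t2] := garcP T; have [g1 g2] := garcP G.
apply: (iffP idP) => [/forallP h|[inj h]].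
  have hh i j : i != j -> garc G (f i) (f j) = garc T i j.
    by move=> ne; have /forallP/(_ j)/implyP/(_ ne)/eqP := h i.
  split => [i j e|i j].
    apply/eqP/negPn/negP => ne; have := hh i j ne; have := hh j i.
    by rewrite eq_sym => /(_ ne); rewrite e g1 (t2 i j ne) => <-.
  by have [->|ne] := eqVneq i j; [rewrite t1 | rewrite hh].
apply/forallP => i; apply/forallP => j; apply/implyP => ne.
case E: (garc T i j); first by rewrite h.
have : garc T j i by have := t2 i j ne; rewrite E; case: (garc T j i).
by move/h => hji; rewrite (g2 (f i) (f j)) ?hji // (inj_eq inj).
Qed.

Definition fimage n (f : {ffun 'I_k -> 'I_n}) : {set 'I_n} * {set 'I_n * 'I_n} :=
  ([set f x | x in 'I_k], [set (f e.1, f e.2) | e in arcs T]).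

Lemma fimage_arcs n (f : {ffun 'I_k -> 'I_n}) i j : injective f ->
  ((f i, f j) \in (fimage f).2) = garc T i j.
Proof.
move=> inj; apply/imsetP/idP => [[[a b] ab [/inj-> /inj->]]|ij] //.
by exists (i, j).
Qed.

(** Sort the embeddings by their image. Those with the image of [f0] are the composites of [f0] with
    the automorphisms, so all fibres have the same size. *)
Lemma emb_copies n (G : tournament n) :
  emb (garc T) (garc G) = (copies T G * #|autos|)%N.
Proof.
rewrite /emb /copies -sum1_card.
rewrite (partition_big (@fimage n) (fun H => is_copy T G H)) /=; last first.
  move=> f; rewrite inE => /embP[inj h]; rewrite /is_copy; apply/andP; split.
    by apply/fintype.subsetP => _ /imsetP[[a b] ab ->]; apply: h.
  by apply/existsP; exists f; rewrite !eqxx !andbT; apply/injectiveP.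
rewrite -sum_nat_const [RHS](eq_bigl (fun H => is_copy T G H)); last by move=> H; rewrite inE.
apply: eq_bigr => H /andP[HG /existsP[f0 /and3P[/injectiveP inj0 /eqP H1 /eqP H2]]].
rewrite -sum1_card.
have HE : H = fimage f0 by case: (H) H1 H2 => a b /= -> ->.
rewrite sum1_card sum1_card.
pose F (s : {perm 'I_k}) := [ffun i => f0 (s i)] : {ffun 'I_k -> 'I_n}.
have Finj : injective F.
  move=> s s' /ffunP e; apply/permP => i; apply: inj0.
  by have := e i; rewrite !ffunE.
rewrite -(card_imset autos Finj); apply: eq_card => f; rewrite [LHS]/in_mem /= inE.
apply/andP/imsetP => [[/embP[inj h] /eqP fH]|[s]].
  (* Equal vertex images give [sg] with [f i = f0 (sg i)]; equal arc images make [sg] an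
     automorphism. *)
  have imf i : exists j, f i == f0 j.
    have : f i \in (fimage f).1 by apply: imset_f.
    by rewrite fH HE => /imsetP[j _ e]; exists j; rewrite e.
  pose sg i := xchoose (imf i).
  have sgE i : f i = f0 (sg i) by apply/eqP; exact: (xchooseP (imf i)).
  have sginj : injective sg by move=> i j e; apply: inj; rewrite !sgE e.
  exists (perm sginj); last by apply/ffunP => i; rewrite ffunE permE.
  rewrite inE; apply/forallP => i; apply/forallP => j; apply/implyP => _.
  by rewrite !permE -(fimage_arcs (sg i) (sg j) inj0) -!sgE -HE -fH fimage_arcs.
rewrite inE => /forallP sa ->.
have sa' i j : garc T (s i) (s j) = garc T i j.
  have [->|ne] := eqVneq i j; first by have [t1 _] := garcP T; rewrite !t1.
  by have /forallP/(_ j)/implyP/(_ ne)/eqP := sa i.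
have injF : injective (F s) by move=> i j; rewrite !ffunE => /inj0/perm_inj.
split.
  apply/embP; split => // i j ij; rewrite !ffunE.
  by apply: (fintype.subsetP HG); rewrite H2 fimage_arcs // sa'.
rewrite HE /fimage; apply/eqP; congr (_, _).
  apply/setP => y; apply/imsetP/imsetP => -[i _ ->].
    by exists (s i) => //; rewrite ffunE.
  by exists ((s^-1)%g i) => //; rewrite ffunE permKV.
apply/setP => -[y z]; apply/imsetP/imsetP => -[[i j] ij [-> ->]].
  by exists (s i, s j); rewrite ?ffunE //=; have := sa' i j; rewrite /garc => ->.
exists ((s^-1)%g i, (s^-1)%g j); last by rewrite !ffunE !permKV.
by have := sa' ((s^-1)%g i) ((s^-1)%g j); rewrite !permKV /garc => <-.
Qed.

End Copies.

Section Flips.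

Variable k : nat.
Implicit Types (t S : rel 'I_k) (a b : 'I_k).

(** A digraph with missing arcs is encoded as a relation [t] together with the set [S] of its
    adjacent pairs; nonadjacent vertices must still have distinct images. *)
Definition respects (n : nat) S t (g : rel 'I_n) (f : {ffun 'I_k -> 'I_n}) : bool :=
  [forall i, forall j, (i != j) ==>
     if S i j then g (f i) (f j) == t i j else f i != f j].

Definition count_respects (n : nat) S t (g : rel 'I_n) : nat := #|[set f | respects S t g f]|.

Definition is_pair a b : rel 'I_k := fun i j => (i == a) && (j == b) || (i == b) && (j == a).

Definition flip a b t : rel 'I_k := fun i j => if is_pair a b i j then ~~ t i j else t i j.

Definition emb_minus (n : nat) a b t (g : rel 'I_n) : nat :=
  count_respects (fun i j => ~~ is_pair a b i j) t g.

Lemma respectsP n S t (g : rel 'I_n) (f : {ffun 'I_k -> 'I_n}) :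
  reflect (forall i j, i != j -> if S i j then g (f i) (f j) = t i j else f i != f j)
    (respects S t g f).
Proof.
apply: (iffP forallP) => [h i j ne|h i].
  by have /forallP/(_ j)/implyP/(_ ne) := h i; case: ifP => // _ /eqP.
by apply/forallP => j; apply/implyP => ne; have := h i j ne; case: ifP => // _ ->.
Qed.

Lemma embE n t (g : rel 'I_n) : emb t g = count_respects (fun _ _ => true) t g.
Proof. by []. Qed.

Lemma count_respects_ext n S S' t t' (g : rel 'I_n) :
  (forall i j, i != j -> S i j = S' i j) -> (forall i j, i != j -> t i j = t' i j) ->
  count_respects S t g = count_respects S' t' g.
Proof.
move=> eS et; apply: eq_card => f; rewrite !inE.
by apply/respectsP/respectsP => h i j ne; have := h i j ne; rewrite eS ?et.
Qed.

Lemma count_respects_relabel n (s : {perm 'I_k}) S t (g : rel 'I_n) :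
  count_respects (fun i j => S (s i) (s j)) (fun i j => t (s i) (s j)) g = count_respects S t g.
Proof.
pose F (f : {ffun 'I_k -> 'I_n}) := [ffun i => f (s i)] : {ffun 'I_k -> 'I_n}.
have Finj : injective F.
  by move=> f f' /ffunP e; apply/ffunP => i; have := e ((s^-1)%g i); rewrite !ffunE permKV.
rewrite /count_respects -[in RHS](card_imset _ Finj); symmetry; apply: eq_card => f; rewrite !inE.
apply/imsetP/respectsP => [[f' + ->] i j ne|h].
  by rewrite inE => /respectsP h; rewrite !ffunE; apply: h; rewrite (inj_eq perm_inj).
exists [ffun i => f ((s^-1)%g i)]; last by apply/ffunP => i; rewrite !ffunE permK.
rewrite inE; apply/respectsP => i j ne; rewrite !ffunE.
have := h ((s^-1)%g i) ((s^-1)%g j); rewrite !permKV; apply.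
by rewrite (inj_eq perm_inj).
Qed.

Lemma is_pairC a b i j : is_pair a b i j = is_pair a b j i.
Proof. by rewrite /is_pair orbC andbC [X in _ || X]andbC. Qed.

Lemma is_pair_perm (s : {perm 'I_k}) a b i j :
  is_pair (s a) (s b) (s i) (s j) = is_pair a b i j.
Proof. by rewrite /is_pair !(inj_eq perm_inj). Qed.

Lemma tourn_flip a b t : a != b -> tourn t -> tourn (flip a b t).
Proof.
move=> ab [t1 t2]; split => [x|x y ne]; rewrite /flip.
  by rewrite t1 /is_pair; have [->|] := eqVneq x a; rewrite ?(negPf ab) ?andbF.
by rewrite [is_pair a b y x]is_pairC (t2 x y ne); case: ifP.
Qed.

(** A map counted on the right sends [a] and [b] to distinct vertices. The orientation of the arc
    between these decides whether the map is an embedding of [t] or of [flip a b t]. *)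
Lemma emb_flip n a b t (g : rel 'I_n) : a != b -> tourn t -> tourn g ->
  (emb t g + emb (flip a b t) g = emb_minus a b t g)%N.
Proof.
move=> ab [t1 t2] [g1 g2].
rewrite !embE /emb_minus /count_respects.
rewrite -[RHS](cardsID [set f : {ffun 'I_k -> 'I_n} | g (f a) (f b) == t a b]).
have pab : is_pair a b a b by rewrite /is_pair !eqxx.
have neq f i j t' : tourn t' -> g (f i) (f j) = t' i j -> g (f j) (f i) = t' j i ->
    i != j -> f i != f j.
  move=> [_ t2'] e1 e2 ne; apply/eqP => e; move: e1 e2.
  by rewrite e g1 (t2' i j ne) => e1 e2; rewrite -e2 in e1.
congr (_ + _)%N; apply: eq_card => f; rewrite !inE.
- apply/respectsP/andP => [h|[/respectsP h /eqP hab] i j ne].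
    split; last by rewrite (h a b ab).
    apply/respectsP => i j ne; rewrite (h i j ne); case: ifP => // _.
    by apply: (neq f i j t) => //; [apply: h | apply: h; rewrite eq_sym].
  have := h i j ne; case: ifP => // /negbFE.
  move=> /orP[/andP[/eqP-> /eqP->] //|/andP[/eqP-> /eqP->] fba].
  by rewrite (g2 _ _ fba) hab (t2 a b ab) negbK.
- apply/respectsP/andP => [h|[hab /respectsP h] i j ne].
    split; first by rewrite (h a b ab) /flip pab; case: (t a b).
    apply/respectsP => i j ne; have := h i j ne; rewrite /flip.
    case: ifP => //= _ e1.
    apply: (neq f i j (flip a b t)) => //; first exact: tourn_flip.
      by apply: h.
    by apply: h; rewrite eq_sym.
  rewrite /flip; have := h i j ne; case pij: (is_pair a b i j) => //=.
  move: pij => /orP[/andP[/eqP-> /eqP->] fab|/andP[/eqP-> /eqP->] fba].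
    by move: hab; case: (g _ _); case: (t a b).
  by rewrite (g2 _ _ fba) (t2 b a) 1?eq_sym //; move: hab; case: (g _ _); case: (t a b).
Qed.

End Flips.

Definition v3 : 'I_5 := @Ordinal 5 3 isT.
Definition v4 : 'I_5 := @Ordinal 5 4 isT.

(* Twins can be exchanged, which reverses just the arc between them; a
   tournament in which [v3] and [v4] are not twins becomes closer to one by
   flips, each of which costs one count of a 9-arc digraph. *)
Lemma emb_span (t : rel 'I_5) : tourn t ->
  exists l : seq (int * rel 'I_5), (forall e, List.In e l -> tourn e.2) /\
    forall n (g : rel 'I_n), tourn g ->
      (2 * emb t g)%N%:Z = \sum_(e <- l) e.1 * (emb_minus v3 v4 e.2 g)%:Z.
Proof.
(* Induction on the number of vertices that tell [v3] and [v4] apart. *)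
have [d] := ubnP #|[set i | [&& i != v3, i != v4 & t i v3 != t i v4]]|.
elim: d t => // d IH t dt tt; have [t1 t2] := tt.
have [E0|[i]] := set_0Vmem [set i | [&& i != v3, i != v4 & t i v3 != t i v4]].
  exists [:: (1, t)]; split => [e [<-|[]]//|n g tg].
  rewrite big_seq1 mul1r -(emb_flip _ tt tg) // mul2n -addnn; congr (_ + _)%N%:Z.
  have twin i : i != v3 -> i != v4 -> t i v3 = t i v4.
    move=> i3 i4; apply/eqP/negPn/negP => ne.
    by move/setP: E0 => /(_ i); rewrite !inE i3 i4 ne.
  have twin' i : i != v3 -> i != v4 -> t v3 i = t v4 i.
    by move=> i3 i4; rewrite !(t2 _ i) ?twin // eq_sym.
  rewrite !embE -(count_respects_relabel (tperm v3 v4) _ t); apply: count_respects_ext => // i j ne.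
  rewrite /flip /is_pair; case: tpermP ne => [->|->|/eqP i3 /eqP i4];
    case: tpermP => [->|->|/eqP j3 /eqP j4] ne //=; rewrite ?orbF ?orbT ?andbT ?andbF.
  - by rewrite (t2 v4 v3).
  - by rewrite (negPf j4) twin'.
  - by rewrite (t2 v3 v4).
  - by rewrite (negPf j3) twin'.
  - by rewrite ?(negPf i3) ?(negPf i4) //= twin.
  - by rewrite ?(negPf i3) ?(negPf i4) //= twin.
  - by rewrite ?(negPf i3) ?(negPf i4).
rewrite inE => /and3P[i3 i4 it].
(* This flip removes [i] from that set and changes nothing else in it. *)
pose t' := flip i v3 t.
have tt' : tourn t' by apply: tourn_flip.
have [|l [lt ll]] := IH t' _ tt'.
  rewrite -ltnS; apply: leq_trans dt; rewrite ltnS; apply: proper_card.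
  apply/properP; split.
    apply/fintype.subsetP => j; rewrite !inE => /and3P[j3 j4]; rewrite j3 j4 /t' /flip /is_pair.
    rewrite (negPf j3) /= !eqxx !andbT !andbF !orbF /=.
    have [->|//] := eqVneq j i.
    by move: it; case: (t i v3); case: (t i v4).
  exists i; rewrite ?inE ?i3 ?i4 ?it //= /t' /flip /is_pair !eqxx /= ?(negPf i3) ?andbF /=.
  by move: it; case: (t i v3); case: (t i v4).
(* Relabelling by [s] turns the pair [i], [v3] into [v3], [v4], so that all counts in the list leave
   out the same pair. *)
pose s := (tperm v3 v4 * tperm v4 i)%g.
have s3 : s v3 = i by rewrite permM tpermL tpermL.
have s4 : s v4 = v3 by rewrite permM tpermR tpermD // eq_sym.
(* By [emb_flip], [2 emb t = 2 emb_minus i v3 t - 2 emb t']; the induction hypothesis supplies the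
   last term. *)
exists ((2, fun x y => t (s x) (s y)) :: [seq (- e.1, e.2) | e <- l]); split.
  move=> e [<-|/List.in_map_iff[e' [<- h]]] /=; last exact: lt.
  by split => [x|x y ne]; [exact: t1 | apply: t2; rewrite (inj_eq perm_inj)].
move=> n g tg; rewrite big_cons big_map /=.
rewrite (eq_bigr (fun e => - (e.1 * (emb_minus v3 v4 e.2 g)%:Z))); last first.
  by move=> e _; rewrite mulNr.
rewrite sumrN -ll // PoszM.
have -> : emb_minus v3 v4 (fun x y => t (s x) (s y)) g = emb_minus i v3 t g.
  rewrite /emb_minus -(count_respects_relabel s _ t); apply: count_respects_ext => // x y _.
  by have := is_pair_perm s v3 v4 x y; rewrite s3 s4 => ->.
by rewrite -(emb_flip i3 tt tg) PoszM PoszD mulrDr addrK.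
Qed.

(** * Counting the 9-arc digraphs *)

Definition v0 : 'I_5 := @Ordinal 5 0 isT.
Definition v1 : 'I_5 := @Ordinal 5 1 isT.
Definition v2 : 'I_5 := @Ordinal 5 2 isT.

Lemma ord5P (i : 'I_5) : [\/ i = v0, i = v1, i = v2 | i = v3 \/ i = v4].
Proof.
case: i => -[|[|[|[|[|//]]]]] h.
- by constructor 1; apply: val_inj.
- by constructor 2; apply: val_inj.
- by constructor 3; apply: val_inj.
- by constructor 4; left; apply: val_inj.
- by constructor 4; right; apply: val_inj.
Qed.

Definition oarc (T : Type) (b : bool) (g : rel T) (x y : T) : bool :=
  if b then g x y else g y x.

(* [p] sees the triple as the vertex of pattern [a] does. *)
Definition sees (T : Type) (a : bool * bool * bool) (g : rel T) (x y z p : T) : bool :=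
  [&& oarc a.1.1 g x p, oarc a.1.2 g y p & oarc a.2 g z p].

Definition pattern (e : rel 'I_5) (v : 'I_5) : bool * bool * bool :=
  (e v0 v, e v1 v, e v2 v).

Definition triple_ok (T : Type) (e : rel 'I_5) (g : rel T) (x y z : T) : bool :=
  [&& oarc (e v0 v1) g x y, oarc (e v0 v2) g x z & oarc (e v1 v2) g y z].

Section Sums.

Variables (n : nat) (g : rel 'I_n) (e : rel 'I_5).
Hypotheses (tg : tourn g) (te : tourn e).

Lemma oarcP x y (i j : 'I_5) : i != j ->
  oarc (e i j) g x y <-> g x y = e i j /\ g y x = e j i.
Proof.
have [g1 g2] := tg; have [_ e2] := te.
move=> ne; rewrite (e2 j i) 1?eq_sym // /oarc.
case: (e i j); split; try by case.
- move=> gxy; split => //; have [xy|xy] := eqVneq x y.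
    by move: gxy; rewrite xy g1.
  by apply/negbTE; rewrite -(g2 x y xy).
- move=> gyx; split => //; have [xy|xy] := eqVneq x y.
    by move: gyx; rewrite xy g1.
  by apply/negbTE; rewrite (g2 x y xy) gyx.
Qed.

Definition quintuple (x : 'I_n * 'I_n * 'I_n * 'I_n * 'I_n) : {ffun 'I_5 -> 'I_n} :=
  [ffun i : 'I_5 => nth x.2 [:: x.1.1.1.1; x.1.1.1.2; x.1.1.2; x.1.2; x.2] i].

Lemma respects_mk a b c p q :
  respects (fun i j => ~~ is_pair v3 v4 i j) e g (quintuple (a, b, c, p, q)) =
  [&& triple_ok e g a b c, sees (pattern e v3) g a b c p,
      sees (pattern e v4) g a b c q & p != q].
Proof.
have E0 : quintuple (a, b, c, p, q) v0 = a by rewrite ffunE.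
have E1 : quintuple (a, b, c, p, q) v1 = b by rewrite ffunE.
have E2 : quintuple (a, b, c, p, q) v2 = c by rewrite ffunE.
have E3 : quintuple (a, b, c, p, q) v3 = p by rewrite ffunE.
have E4 : quintuple (a, b, c, p, q) v4 = q by rewrite ffunE.
move: (quintuple _) E0 E1 E2 E3 E4 => f <- <- <- <- <-.
apply/respectsP/idP => [h|].
  have arcs i j : i != j -> ~~ is_pair v3 v4 i j -> oarc (e i j) g (f i) (f j).
    move=> ne np; apply/oarcP => //; have := h i j ne; rewrite np => ->.
    by split => //; have := h j i; rewrite eq_sym is_pairC np => /(_ ne).
  have pq : f v3 != f v4 by have := h v3 v4 isT.
  by rewrite /triple_ok /sees /pattern /= pq !arcs.
move=> /and4P[/and3P[h01 h02 h12] /and3P[h03 h13 h23] /and3P[h04 h14 h24] pq].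
rewrite /= in h03 h13 h23 h04 h14 h24.
have [{}h01 h10] := (oarcP (f v0) (f v1) (isT : v0 != v1)).1 h01.
have [{}h02 h20] := (oarcP (f v0) (f v2) (isT : v0 != v2)).1 h02.
have [{}h12 h21] := (oarcP (f v1) (f v2) (isT : v1 != v2)).1 h12.
have [{}h03 h30] := (oarcP (f v0) (f v3) (isT : v0 != v3)).1 h03.
have [{}h13 h31] := (oarcP (f v1) (f v3) (isT : v1 != v3)).1 h13.
have [{}h23 h32] := (oarcP (f v2) (f v3) (isT : v2 != v3)).1 h23.
have [{}h04 h40] := (oarcP (f v0) (f v4) (isT : v0 != v4)).1 h04.
have [{}h14 h41] := (oarcP (f v1) (f v4) (isT : v1 != v4)).1 h14.
have [{}h24 h42] := (oarcP (f v2) (f v4) (isT : v2 != v4)).1 h24.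
have qp : f v4 != f v3 by rewrite eq_sym.
by move=> i j; case: (ord5P i) => [->|->|->|[->|->]];
  case: (ord5P j) => [->|->|->|[->|->]].
Qed.

Definition seen (a : bool * bool * bool) (x y z : 'I_n) : int :=
  \sum_(p < n) (sees a g x y z p)%:R.

Lemma sees_diff a b x y z p : a != b -> sees a g x y z p && sees b g x y z p = false.
Proof.
have [g1 g2] := tg.
have arcN (c d : bool) u : c != d -> oarc c g u p && oarc d g u p = false.
  rewrite /oarc; have [->|ne] := eqVneq u p; first by case: c; case: d; rewrite g1.
  by case: c; case: d => // _; rewrite (g2 u p ne); case: (g p u).
move: a b => [[a1 a2] a3] [[b1 b2] b3] ne; apply/negbTE/negP.
move=> /andP[/and3P[/= h1 h2 h3] /and3P[/= k1 k2 k3]]; case/eqP: ne.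
congr (_, _, _); apply/eqP/negPn/negP => nn.
- by have := arcN _ _ x nn; rewrite h1 k1.
- by have := arcN _ _ y nn; rewrite h2 k2.
- by have := arcN _ _ z nn; rewrite h3 k3.
Qed.

(** Without [p != q] the sum is a product. The diagonal has to be subtracted; it vanishes for
    [a != b], because a vertex realises at most one pattern. *)
Lemma sum_distinct (a b : bool * bool * bool) x y z :
  \sum_(p < n) \sum_(q < n)
     ([&& sees a g x y z p, sees b g x y z q & p != q])%:R =
  seen a x y z * seen b x y z - (a == b)%:R * seen a x y z :> int.
Proof.
apply/eqP; rewrite eq_sym subr_eq; apply/eqP.
rewrite /seen mulr_suml mulr_sumr -big_split /=; apply: eq_bigr => p _.
rewrite mulr_sumr (bigD1 p) //= [in RHS](bigD1 p) //= eqxx !andbF add0r addrC.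
congr (_ + _).
  apply: eq_bigr => q qp; rewrite [p == q]eq_sym qp andbT -natrM mulnb //.
have [->|ne] := eqVneq a b; first by rewrite mul1r -natrM mulnb andbb.
by rewrite mul0r -natrM mulnb sees_diff.
Qed.

Lemma emb_minus_sum : (emb_minus v3 v4 e g)%:Z =
  \sum_(x < n) \sum_(y < n) \sum_(z < n) (triple_ok e g x y z)%:R *
    (seen (pattern e v3) x y z * seen (pattern e v4) x y z -
     (pattern e v3 == pattern e v4)%:R * seen (pattern e v3) x y z).
Proof.
transitivity (\sum_(f : {ffun 'I_5 -> 'I_n})
    (respects (fun i j => ~~ is_pair v3 v4 i j) e g f)%:R : int).
  rewrite /emb_minus /count_respects -sum1_card -natr_sum -[LHS]natz; congr (_%:R).
  by rewrite -big_mkcond; apply: eq_bigl => f; rewrite inE.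
have bij : bijective quintuple.
  exists (fun f : {ffun 'I_5 -> 'I_n} => (f v0, f v1, f v2, f v3, f v4)).
    by move=> [[[[a b] c] p] q]; rewrite !ffunE.
  move=> f; apply/ffunP => i; rewrite ffunE.
  by case: (ord5P i) => [->|->|->|[->|->]].
rewrite (reindex quintuple) /=; last exact: onW_bij.
transitivity (\sum_x \sum_y \sum_z \sum_p \sum_q
    (respects (fun i j => ~~ is_pair v3 v4 i j) e g (quintuple (x, y, z, p, q)))%:R : int).
  by rewrite !pair_bigA /=; apply: eq_bigr => -[[[[a b] c] p] q].
apply: eq_bigr => x _; apply: eq_bigr => y _; apply: eq_bigr => z _.
rewrite -sum_distinct mulr_sumr; apply: eq_bigr => p _.
rewrite mulr_sumr; apply: eq_bigr => q _.
by rewrite respects_mk -natrM mulnb.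
Qed.

End Sums.

(** * The counting program *)

(** Defined on all of [nat] because the program also handles indices outside the vertex set, in the
    padding of the matrices. *)
Definition arcN (n : nat) (G : tournament n) : rel nat := fun x y =>
  if insub x is Some x' then if insub y is Some y' then garc G x' y' else false
  else false.

Lemma arcNE n (G : tournament n) (x y : 'I_n) : arcN G x y = garc G x y.
Proof. by rewrite /arcN !valK. Qed.

Lemma cells_input n (G : tournament n) x y : (x < n)%N -> (y < n)%N ->
  cells (input G) (x * n + y)%N = (arcN G x y)%:R.
Proof.
move=> xn yn; rewrite -[x]/(val (Ordinal xn)) -[y]/(val (Ordinal yn)) arcNE.
move: (Ordinal xn) (Ordinal yn) => {xn yn} a b; rewrite /= /garc.
case: ifP => [/existsP[[a' b'] /andP[ab]]|/negbT].
  rewrite eqz_nat /= => /eqP e.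
  have n0 : (0 < n)%N by apply: leq_ltn_trans (ltn_ord a).
  have ea : a = a' by apply: val_inj; have := congr1 (divn^~ n) e;
    rewrite !divnMDl // !divn_small // !addn0.
  have eb : b = b' by apply: val_inj; have := congr1 (modn^~ n) e;
    rewrite !modnMDl !modn_small.
  by rewrite ea eb ab.
by move/existsPn/(_ (a, b)); rewrite /= eqxx andbT => /negPf ->.
Qed.

Definition racc := 14%N.
Definition rx := 17%N.

(* The value is 1 if [e < n] and 0 otherwise, provided [n > 0]. *)
Definition eilt (e : expr) : expr := (ECst 1 / (ECst 1 + e / EReg rn))%X.

Lemma eval_eilt s e (x n : nat) : (0 < n)%N -> reg s rn = n%:Z ->
  eval s e = x%:Z -> eval s (eilt e) = (x < n)%N%:R.
Proof.
move=> n0 hn he; rewrite /= he hn divz_nat -PoszD divz_nat add1n.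
have [xn|nx] := ltnP; first by rewrite [(x %/ n)%N]divn_small.
by rewrite divn_small // ltnS divn_gt0.
Qed.

Definition earc (b : bool) (x y : expr) : expr :=
  if b then ELoad (x * EReg rn + y)%X else ELoad (y * EReg rn + x)%X.

Definition gcells (n : nat) (G : tournament n) (s : state) : Prop :=
  forall x y, (x < n)%N -> (y < n)%N -> cells s (x * n + y)%N = (arcN G x y)%:R.

Lemma eval_earc n (G : tournament n) s b e e' (x y : nat) : gcells G s ->
  reg s rn = n%:Z -> eval s e = x%:Z -> eval s e' = y%:Z -> (x < n)%N -> (y < n)%N ->
  eval s (earc b e e') = (oarc b (arcN G) x y)%:R.
Proof.
move=> gc hn he he' xn yn; case: b; rewrite /= he he' hn -PoszM -PoszD gc //.
Qed.

Definition eR : expr := (eX / EReg rN)%X.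
Definition eC : expr := (eX %% EReg rN)%X.

(** Entry [(y, p)] of the left factor for the vertex [x] held in [rx]; [eB] is entry [(p, z)] of the
    right one. In the padding the loads may read anything, but they are multiplied by 0. *)
Definition eA (a : bool * bool * bool) : expr :=
  (eilt eR * eilt eC * (earc a.1.1 (EReg rx) eC * earc a.1.2 eR eC))%X.

Definition eB (a : bool * bool * bool) : expr :=
  (eilt eR * eilt eC * earc a.2 eC eR)%X.

(** The multiplication yields [D ^+ L] times the count, and [rD] holds that factor. *)
Definition ecnt (rb : nat) : expr := (ELoad (EReg rb + eX) / EReg rD)%X.

Definition eterm (ga : int) (e : rel 'I_5) : expr :=
  (ECst ga * (eilt eR * eilt eC *
    (earc (e v0 v1) (EReg rx) eR * (earc (e v0 v2) (EReg rx) eC * earc (e v1 v2) eR eC)) *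
    (ecnt rC * ecnt rA -
     ECst (pattern e v3 == pattern e v4)%:R * ecnt rC)))%X.

(** The second multiplication reuses the arrays at [rA], [rB] and [rT], so the counts for [v3] are
    first saved at [rC]. *)
Definition hbody (r m : nat) u v w (ga : int) (e : rel 'I_5) : cmd :=
  Seq (hmatmul r m u v w (eA (pattern e v3)) (eB (pattern e v3)))
  (Seq (hset rS (EReg rN * EReg rN)%X)
  (Seq (hmap rC rS (ELoad (EReg rA + eX)%X))
  (Seq (hmatmul r m u v w (eA (pattern e v4)) (eB (pattern e v4)))
  (Seq (hset rS (EReg rN * EReg rN)%X)
       (hsum racc rS (eterm ga e)))))).

Definition hterm (r m : nat) u v w (ga : int) (e : rel 'I_5) : cmd :=
  hfor rx 18 (EReg rn) (hbody r m u v w ga e).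

Definition hterms (r m : nat) u v w (l : seq (int * rel 'I_5)) : cmd :=
  foldr (fun x c => Seq (hterm r m u v w x.1 x.2) c) Skip l.

(* Multiplies by [k] if register 19 holds 1, and by 1 if it holds 0. *)
Definition einc (k : int) (e : expr) : expr := (e * (ECst 1 + ECst (k - 1) * EReg 19))%X.

(** [L] grows while the power in [rN] is below [n]. Register 19 holds the outcome of this test, so
    the later rounds have no effect; [n] rounds suffice since [n < m ^ n]. *)
Definition hinit (r m : nat) (D : int) : cmd :=
  Seq (hset rN (ECst 1))
  (Seq (hset rA (ECst 1))
  (Seq (hset rD (ECst 1))
  (Seq (hfor 15 16 (EReg rn)
     (Seq (hset 19 (eilt (EReg rN)))
     (Seq (hset rL (EReg rL + EReg 19)%X)
     (Seq (hset rN (einc m%:Z (EReg rN)))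
     (Seq (hset rA (einc r%:Z (EReg rA)))
          (hset rD (einc D (EReg rD))))))))
  (Seq (hset rB (ECst 2 * EReg rA)%X)
  (Seq (hset rT (ECst 3 * EReg rA)%X)
       (hset rC (ECst 4 * EReg rA)%X)))))).

(** [q] will be [2 * #|autos T|], which turns the combination of counts into the number of
    copies. *)
Definition hprog (r m : nat) (D : int) u v w (l : seq (int * rel 'I_5)) (q : int) : cmd :=
  Seq (hinit r m D) (Seq (hterms r m u v w l) (hset rn (EReg racc / ECst q)%X)).

(** * The numbers that the program computes *)

Section Terms.

Variables (n : nat) (G : tournament n).

Definition seenN (a : bool * bool * bool) (x y z : nat) : int :=
  \sum_(p < n) (sees a (arcN G) x y z p)%:R.

Definition quadN (e : rel 'I_5) (x y z : nat) : int :=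
  (triple_ok e (arcN G) x y z)%:R *
    (seenN (pattern e v3) x y z * seenN (pattern e v4) x y z -
     (pattern e v3 == pattern e v4)%:R * seenN (pattern e v3) x y z).

Definition rowN (e : rel 'I_5) (x : nat) : int :=
  \sum_(y < n) \sum_(z < n) quadN e x y z.

Lemma emb_minus_rowN e : tourn e -> (emb_minus v3 v4 e (garc G))%:Z = \sum_(x < n) rowN e x.
Proof.
move=> te; rewrite (emb_minus_sum (garcP G) te); apply: eq_bigr => x _.
apply: eq_bigr => y _; apply: eq_bigr => z _.
have sE a : seen (garc G) a x y z = seenN a x y z.
  by apply: eq_bigr => p _; rewrite /sees /oarc !arcNE.
by rewrite /quadN !sE /triple_ok /oarc !arcNE.
Qed.

Lemma seenN_bound a x y z : 0 <= seenN a x y z <= n%:Z.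
Proof.
rewrite /seenN; apply/andP; split; first by apply: sumr_ge0.
have -> : n%:Z = \sum_(p < n) 1 by rewrite sumr_const card_ord natz.
by apply: ler_sum => p _; case: (sees _ _ _ _ _ _).
Qed.

Lemma quadN_bound e x y z : (`|quadN e x y z| <= 2 * (n * n))%N.
Proof.
rewrite /quadN; have := seenN_bound (pattern e v3) x y z.
have := seenN_bound (pattern e v4) x y z.
move: (seenN _ _ _ _) (seenN _ _ _ _) => p q /andP[p0 pn] /andP[q0 qn].
have n0 : (0 <= n%:Z) by [].
have h1 : q * p <= n%:Z * n%:Z by apply: ler_pM.
have h2 : 0 <= q * p by apply: mulr_ge0.
have h3 : (n <= n * n)%N by case: (n) => // k; rewrite leq_pmulr.
case: (triple_ok _ _ _ _ _); case: (_ == _); rewrite ?mul1r ?mul0r ?subr0 //; nia.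
Qed.

Variables (N : nat).
Hypothesis nN : (n <= N)%N.

Definition amat (a : bool * bool * bool) (x k : nat) : int :=
  [&& (k %/ N < n)%N, (k %% N < n)%N, oarc a.1.1 (arcN G) x (k %% N)%N
    & oarc a.1.2 (arcN G) (k %/ N)%N (k %% N)%N]%:R.

Definition bmat (a : bool * bool * bool) (k : nat) : int :=
  [&& (k %/ N < n)%N, (k %% N < n)%N & oarc a.2 (arcN G) (k %% N)%N (k %/ N)%N]%:R.

Lemma amat_bound a x k : (`|amat a x k| <= 1)%N.
Proof. by rewrite /amat; case: (andb _ _). Qed.

Lemma bmat_bound a k : (`|bmat a k| <= 1)%N.
Proof. by rewrite /bmat; case: (andb _ _). Qed.

Lemma sum_ord_widen (F : nat -> int) : (forall p, (n <= p)%N -> F p = 0) ->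
  \sum_(p < N) F p = \sum_(p < n) F p.
Proof.
move=> F0; rewrite (big_ord_widen N F nN) [LHS](bigID (fun p : 'I_N => (p < n)%N)) /=.
by rewrite [X in _ + X]big1 ?addr0 // => p; rewrite -leqNgt; apply: F0.
Qed.

Lemma amat_bmat a x y z : (y < N)%N -> (z < N)%N ->
  \sum_(p < N) amat a x (y * N + p) * bmat a (p * N + z) =
  if (y < n)%N && (z < n)%N then seenN a x y z else 0.
Proof.
move=> yN zN; have N0 : (0 < N)%N by apply: leq_ltn_trans yN.
have E p : (p < N)%N -> amat a x (y * N + p) * bmat a (p * N + z) =
    (if [&& (y < n)%N, (z < n)%N & (p < n)%N] then (sees a (arcN G) x y z p)%:R else 0).
  move=> pN; rewrite /amat /bmat !divnMDl // !modnMDl !divn_small // !modn_small //.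
  rewrite !addn0 /sees; case: (y < n)%N; case: (z < n)%N; case: (p < n)%N;
    rewrite ?mul0r ?mulr0 //= -natrM mulnb andbA //.
rewrite (eq_bigr (fun p : 'I_N => if [&& (y < n)%N, (z < n)%N & (p < n)%N]
  then (sees a (arcN G) x y z p)%:R else 0)); last by move=> p _; apply: E.
case: (y < n)%N; case: (z < n)%N => /=; try by rewrite big1.
rewrite (@sum_ord_widen (fun p => if (p < n)%N then (sees a (arcN G) x y z p)%:R else 0)).
  by apply: eq_bigr => p _; rewrite ltn_ord.
by move=> p np; rewrite ltnNge np.
Qed.

Definition Vterm (ga : int) (e : rel 'I_5) (x k : nat) : int :=
  if (k %/ N < n)%N && (k %% N < n)%N then ga * quadN e x (k %/ N)%N (k %% N)%N else 0.

Lemma Vterm_sum ga e x : \sum_(k < N * N) Vterm ga e x k = ga * rowN e x.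
Proof.
have [N0|N0] := posnP N.
  have n0 : n = 0%N by apply/eqP; rewrite -leqn0 -N0.
  by rewrite N0 big_ord0 /rowN big1 ?mulr0 // => -[i hi]; exfalso; rewrite n0 in hi.
rewrite (@sum_split_block N N) // /rowN mulr_sumr.
pose Y y := if (y < n)%N then ga * \sum_(z < n) quadN e x y z else 0.
transitivity (\sum_(y < N) Y y).
  apply: eq_bigr => y _.
  pose Zf z := if (z < n)%N then if (y < n)%N then ga * quadN e x y z else 0 else 0.
  transitivity (\sum_(z < N) Zf z).
    apply: eq_bigr => z _; rewrite /Vterm /Zf divnMDl // divn_small // addn0.
    by rewrite modnMDl modn_small //; case: (y < n)%N; case: (z < n)%N.
  rewrite (@sum_ord_widen Zf) => [|z nz]; last by rewrite /Zf ltnNge nz.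
  rewrite /Y /Zf; case: (y < n)%N; last by rewrite big1 // => z _; rewrite ltn_ord.
  by rewrite mulr_sumr; apply: eq_bigr => z _; rewrite ltn_ord.
rewrite (@sum_ord_widen Y) => [|y ny]; last by rewrite /Y ltnNge ny.
by apply: eq_bigr => y _; rewrite /Y ltn_ord.
Qed.

Lemma Vterm_bound ga e x k : (`|Vterm ga e x k| <= `|ga| * (2 * (n * n)))%N.
Proof.
by rewrite /Vterm; case: ifP => // _; rewrite abszM leq_mul // quadN_bound.
Qed.

End Terms.

Section EvalTerms.

Variables (n : nat) (G : tournament n) (N : nat) (s : state) (x k : nat).
Hypotheses (gc : gcells G s) (hn : reg s rn = n%:Z) (hN : reg s rN = N%:Z).
Hypotheses (hk : reg s map_idx = k%:Z) (hx : reg s rx = x%:Z) (xn : (x < n)%N).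

Lemma n_gt0 : (0 < n)%N. Proof. exact: leq_ltn_trans xn. Qed.

Lemma eval_eR : eval s eR = (k %/ N)%N%:Z.
Proof. by rewrite /= hk hN divz_nat. Qed.

Lemma eval_eC : eval s eC = (k %% N)%N%:Z.
Proof. by rewrite /= hk hN modz_nat. Qed.

Lemma eval_ex : eval s (EReg rx) = x%:Z. Proof. exact: hx. Qed.

Lemma eval_mul a b : eval s (a * b)%X = eval s a * eval s b.
Proof. by []. Qed.

Lemma eval_eA a : eval s (eA a) = amat G N a x k.
Proof.
rewrite /eA !eval_mul !(eval_eilt n_gt0 hn eval_eR, eval_eilt n_gt0 hn eval_eC) /amat.
have [yn|_] := boolP (k %/ N < n)%N; last by rewrite !mul0r.
have [zn|_] := boolP (k %% N < n)%N; last by rewrite mulr0 mul0r.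
rewrite (eval_earc _ gc hn eval_ex eval_eC) // (eval_earc _ gc hn eval_eR eval_eC) //.
by rewrite !mul1r -natrM mulnb.
Qed.

Lemma eval_eB a : eval s (eB a) = bmat G N a k.
Proof.
rewrite /eB !eval_mul !(eval_eilt n_gt0 hn eval_eR, eval_eilt n_gt0 hn eval_eC) /bmat.
have [yn|_] := boolP (k %/ N < n)%N; last by rewrite !mul0r.
have [zn|_] := boolP (k %% N < n)%N; last by rewrite mulr0 mul0r.
by rewrite (eval_earc _ gc hn eval_eC eval_eR) // !mul1r.
Qed.

(** The counts have to be right only in the [n x n] part: elsewhere the guards make the term 0. *)
Lemma eval_eterm ga e (yn := (k %/ N < n)%N) (zn := (k %% N < n)%N) :
  (yn && zn -> eval s (ecnt rC) = seenN G (pattern e v3) x (k %/ N) (k %% N)) ->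
  (yn && zn -> eval s (ecnt rA) = seenN G (pattern e v4) x (k %/ N) (k %% N)) ->
  eval s (eterm ga e) = Vterm G N ga e x k.
Proof.
move=> h3 h4.
rewrite /eterm !eval_mul !(eval_eilt n_gt0 hn eval_eR, eval_eilt n_gt0 hn eval_eC) /Vterm.
rewrite -/yn -/zn in h3 h4 *.
case: (boolP yn) h3 h4 => [yn1|_] h3 h4; last by rewrite !mul0r mulr0.
case: (boolP zn) h3 h4 => [zn1|_] h3 h4; last by rewrite mulr0 !mul0r mulr0.
rewrite !mul1r; congr (_ * _).
rewrite (eval_earc _ gc hn eval_ex eval_eR) // (eval_earc _ gc hn eval_ex eval_eC) //.
rewrite (eval_earc _ gc hn eval_eR eval_eC) //.
rewrite -[eval s (ecnt rC * _ - _)%X]/(eval s (ecnt rC) * eval s (ecnt rA) -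
  (pattern e v3 == pattern e v4)%:R * eval s (ecnt rC)).
by rewrite h3 // h4 // /quadN /triple_ok -!natrM !mulnb.
Qed.

End EvalTerms.

(** * Correctness and cost of the program *)

Definition arr (s : state) (b len : nat) (f : nat -> int) : Prop :=
  forall y, (y < len)%N -> cells s (b + y)%N = f y.

Lemma Posz_exp (a k : nat) : (a ^ k)%N%:Z = a%:Z ^+ k.
Proof. by rewrite -natz natrX natz. Qed.

Section MM.

Variables (B M W : nat).
Hypotheses (M2 : (2 <= M)%N) (MB : (M ^ W <= B)%N).

Lemma spec_transform rb e s (b t S : nat) (V : nat -> int) (Q : state -> Prop) :
  (rb < map_idx)%N -> small W e -> small W ecopy -> bounded M s ->
  reg s rb = b -> reg s rT = t -> reg s rS = S -> (b + S <= t)%N ->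
  (forall k, (k < S)%N -> (`|V k| <= M)%N) ->
  (forall k, (k < S)%N ->
     eval (State (loop_regs s S k) (setarr (cells s) t k V)) e = V k) ->
  (forall s', reg s' =1 loop_regs s S S ->
     cells s' =1 setarr (setarr (cells s) t S V) b S V -> bounded M s' -> Q s') ->
  spec B (htransform rb e) s (W * S.+1 + W * S.+1) Q.
Proof.
move=> rbi se sc bs hb ht hS bSt Vb ev fin.
have SM : (S <= M)%N by case: bs => br _; have := br rS isT; rewrite hS.
have rbK : (rb < nregs)%N by apply: ltn_trans rbi _.
have rbi1 : rb != map_idx by rewrite neq_ltn rbi.
have rbi2 : rb != map_lim by rewrite neq_ltn (ltn_trans rbi).
apply: (spec_seq (Q1 := fun s1 => [/\ bounded M s1, reg s1 =1 loop_regs s S S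
    & cells s1 =1 setarr (cells s) t S V])).
  apply: (spec_map M2 MB (b := t) (V := V)) => // s1 hr hc; split => //.
  split => [x xK|a]; first by rewrite hr; apply: loop_regs_bound.
  by rewrite hc; apply: setarr_bound => //; case: bs.
move=> s1 [bs1 hr hc].
apply: (spec_map M2 MB (b := b) (V := V)) => //.
- by rewrite hr /loop_regs (negPf rbi1) (negPf rbi2).
- by rewrite hr.
- move=> k kS; have E1 : loop_regs s1 S k rT = t by rewrite /loop_regs /= hr /loop_regs /= ht.
  have E2 : loop_regs s1 S k map_idx = k by [].
  transitivity (setarr (cells s1) b k V (loop_regs s1 S k rT + loop_regs s1 S k map_idx)) => //.
  rewrite E1 E2 -PoszD setarr_out; last by lia.
  by rewrite hc setarr_in.
- move=> s2 hr2 hc2; apply: fin.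
  + by move=> x; rewrite hr2 /loop_regs; case: ifP => // h1; case: ifP => // h2;
      rewrite hr /loop_regs h1 h2.
  + by move=> a; rewrite hc2 /setarr; case: ifP => // _; rewrite hc.
  + split => [x xK|a]; first by rewrite hr2; apply: loop_regs_bound.
    by rewrite hc2; apply: setarr_bound => //; case: bs1.
Qed.

Variables (m r c L N Z : nat) (D : int).
Variables (u v w : nat -> nat -> nat -> int).
Hypotheses (m0 : (0 < m)%N) (mr : (m * m <= r)%N).
Hypotheses (NE : N = (m ^ L)%N) (ZE : Z = (r ^ L)%N).
Hypotheses (ZM : (4 * Z <= M)%N) (NM : (N <= M)%N) (cM : (c ^ (3 * L) <= M)%N).
Hypothesis c0 : (0 < c)%N.
Hypothesis uc : forall l, (l < r)%N -> (\sum_(i < m) \sum_(j < m) `|u l i j| <= c)%N.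
Hypothesis vc : forall l, (l < r)%N -> (\sum_(i < m) \sum_(j < m) `|v l i j| <= c)%N.
Hypothesis wc : forall i j, (i < m)%N -> (j < m)%N -> (\sum_(l < r) `|w l i j| <= c)%N.
Hypothesis dec : bilinear_alg m r D u v w.

(** The input lies below [Z] and the saved counts start at [4 * Z]; a multiplication works in
    between. *)
Definition mm_frame (s s' : state) : Prop :=
  [/\ bounded M s', (forall x, x \notin mmregs -> reg s' x = reg s x)
    & (forall a : int, (a < Z%:Z) || ((4 * Z)%N%:Z <= a) -> cells s' a = cells s a)].

Lemma r_gt0 : (0 < r)%N.
Proof. by apply: leq_trans mr; rewrite muln_gt0 m0. Qed.

Lemma ZleM : (Z <= M)%N.
Proof. by apply: leq_trans ZM; rewrite leq_pmull. Qed.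

(** As [m * m <= r], the total size of the blocks does not decrease with the depth, so the [Z] cells
    needed by the last level suffice for all of them. *)
Lemma size_le k : (k <= L)%N -> (r ^ k * (m ^ (L - k) * m ^ (L - k)) <= Z)%N.
Proof.
move=> kL; rewrite ZE -{3}(subnKC kL) expnD leq_mul2l -expnMn; apply/orP; right.
by case: (L - k)%N => // j; rewrite leq_exp2r.
Qed.

Lemma leq_norm_sum (n : nat) (F : 'I_n -> int) :
  (`|(\sum_(i < n) F i)%R| <= \sum_(i < n) `|F i|)%N.
Proof.
elim/big_ind2: _ => // x a y b ha hb.
by apply: leq_trans (leq_add ha hb); lia.
Qed.

Lemma downf_bound (t : nat -> nat -> nat -> int) q f (F : nat) : (forall l, (l < r)%N ->
    (\sum_(i < m) \sum_(j < m) `|t l i j| <= c)%N) ->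
  (forall x, (`|f x| <= F)%N) -> forall x, (`|downf r m t q f x| <= c * F)%N.
Proof.
move=> tc fF x; have lr : (x %/ (q * q) %% r < r)%N by rewrite ltn_pmod ?r_gt0.
apply: leq_trans (leq_norm_sum _) _.
apply: (@leq_trans (\sum_(i < m) (\sum_(j < m) `|t (x %/ (q * q) %% r)%N i j|) * F)).
  apply: leq_sum => i _; apply: leq_trans (leq_norm_sum _) _.
  by rewrite big_distrl; apply: leq_sum => j _; rewrite abszM leq_mul.
by rewrite -big_distrl leq_mul // tc.
Qed.

Lemma upf_bound q f (F : nat) : (0 < q)%N ->
  (forall x, (`|f x| <= F)%N) -> forall x, (`|upf r m w q f x| <= c * F)%N.
Proof.
move=> q0 fF x; apply: leq_trans (leq_norm_sum _) _.
set i := (_ %/ _ %% _ %/ _)%N; set j := (_ %% _ %/ _)%N.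
have qm : (0 < q * m)%N by rewrite muln_gt0 q0.
have im : (i < m)%N by rewrite /i ltn_divLR // mulnC ltn_pmod // mulnC.
have jm : (j < m)%N by rewrite /j ltn_divLR // mulnC ltn_pmod // mulnC.
apply: (@leq_trans (\sum_(l < r) `|w l i j| * F)).
  by apply: leq_sum => l _; rewrite abszM leq_mul.
by rewrite -big_distrl leq_mul // wc.
Qed.

Lemma down_iter_bound (t : nat -> nat -> nat -> int) a k : (forall l, (l < r)%N ->
    (\sum_(i < m) \sum_(j < m) `|t l i j| <= c)%N) ->
  (forall x, (`|a x| <= 1)%N) -> forall x, (`|down_iter r m t L a k x| <= c ^ k)%N.
Proof.
move=> tc a1; elim: k => [|k IH] x /=; first by rewrite expn0.
by rewrite expnS; apply: downf_bound.
Qed.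

Lemma up_iter_bound f (F k : nat) : (forall x, (`|f x| <= F)%N) ->
  forall x, (`|up_iter r m w f k x| <= c ^ k * F)%N.
Proof.
move=> fF; elim: k => [|k IH] x /=; first by rewrite expn0 mul1n.
by rewrite expnS -mulnA; apply: upf_bound; rewrite ?expn_gt0 ?m0.
Qed.

(** The exponent [3 * L] accounts for a growth by [c] per level: [L] levels down for each of the two
    factors, and [L] levels up for their product. *)
Lemma cpow_le k : (k <= 3 * L)%N -> (c ^ k <= M)%N.
Proof.
move=> kL; apply: leq_trans cM.
by move: c0 kL; case: (c) => // -[|d] _ kL; rewrite ?exp1n // leq_exp2l.
Qed.

(** Going up one level is [block_mul], with the blocks at depth [L - k] as factors; at height 0 the
    blocks are single numbers. *)
Lemma up_iter_mul a b k x i j : (k <= L)%N -> (i < m ^ k)%N -> (j < m ^ k)%N ->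
  up_iter r m w (fun x => down_iter r m u L a L x * down_iter r m v L b L x) k (addr (m ^ k) x i j)
  = D ^+ k * \sum_(l < m ^ k)
      down_iter r m u L a (L - k) (addr (m ^ k) x i l) *
      down_iter r m v L b (L - k) (addr (m ^ k) x l j).
Proof.
elim: k x i j => [|k IH] x i j kL ik jk.
  rewrite /= subn0 expr0 mul1r !expn0 big_ord1.
  by move: ik jk; rewrite expn0 !ltnS !leqn0 => /eqP-> /eqP->.
have Lk : (L - k = (L - k.+1).+1)%N by lia.
have Lk' : (L - (L - k.+1).+1 = k)%N by lia.
rewrite /= expnS [(m * m ^ k)%N]mulnC exprSr.
apply: (block_mul (u := u) (v := v)) => //.
- by rewrite expn_gt0 m0.
- move=> l i' j' lr i'q j'q; rewrite IH ?(ltnW kL) // Lk /= Lk'.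
  by [].
- by rewrite mulnC -expnS.
- by rewrite mulnC -expnS.
Qed.

Lemma mm_frame_upd s s1 x y : x \in mmregs -> mm_frame s s1 -> (`|y| <= M)%N ->
  mm_frame s (upd_reg s1 x y).
Proof.
move=> xm [bs hr hc] yM; split => //; first exact: bounded_upd.
by move=> z zm /=; case: eqP => [zx|_]; [rewrite -zx (negPf zm) in xm | apply: hr].
Qed.

Lemma mm_frame_loop s s1 s2 (S : nat) : mm_frame s s1 -> reg s2 =1 loop_regs s1 S S ->
  forall x, x \notin mmregs -> reg s2 x = reg s x.
Proof.
move=> [_ hr _] e x xm; rewrite e /loop_regs.
case: eqP => [xi|_]; first by rewrite xi in xm.
case: eqP => [xi|_]; first by rewrite xi in xm.
exact: hr.
Qed.

(** The registers [rA], [rB], [rT], [rC] are numbered 4 to 7 and hold [Z] to [4 * Z], whence the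
    base [(ib - 3) * Z]. *)
Lemma spec_frame_map ib e s s1 (S : nat) (V : nat -> int) (Q : state -> Prop) :
  (rA <= ib <= rC)%N -> (ib < rC)%N -> small W e -> mm_frame s s1 ->
  reg s ib = ((ib - 3) * Z)%N -> forall rz, (rz < map_idx)%N || (rz == rS) ->
  reg s1 rz = S -> (S <= Z)%N ->
  (forall k, (k < S)%N -> (`|V k| <= M)%N) ->
  (forall k, (k < S)%N ->
     eval (State (loop_regs s1 S k) (setarr (cells s1) ((ib - 3) * Z) k V)) e = V k) ->
  (forall s2, mm_frame s s2 -> reg s2 =1 loop_regs s1 S S ->
     cells s2 =1 setarr (cells s1) ((ib - 3) * Z) S V -> Q s2) ->
  spec B (hmap ib rz e) s1 (W * Z.+1) Q.
Proof.
move=> ib1 ib2 se f hib rz hrz hS SZ Vb ev fin.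
apply: (spec_weaken (t := (W * S.+1)%N) (Q := Q)) => //; first by rewrite leq_mul2l ltnS SZ orbT.
have [bs hr hc] := f; have rzK : (rz < nregs)%N by move: hrz; rewrite /rS /map_idx /nregs; lia.
have ibm : ib \notin mmregs.
  by move: ib1 ib2; rewrite !inE /rA /rC /rq /rs /map_idx /map_lim /rS; lia.
have ibK : (ib < nregs)%N by apply: leq_trans ib2 _.
have ibi : ib != map_idx by apply: contraNneq ibm => ->.
have ibl : ib != map_lim by apply: contraNneq ibm => ->.
apply: (spec_map M2 MB (b := ((ib - 3) * Z)%N) (V := V)) => //; first by rewrite hr.
move=> s2 hr2 hc2; apply: fin => //; split.
- split => [x xK|a]; last by rewrite hc2; apply: setarr_bound => //; case: bs.
  by rewrite hr2; apply: loop_regs_bound => //; lia.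
- exact: mm_frame_loop hr2.
- move=> a ha; rewrite hc2 setarr_out ?hc //.
  move: ib1 ib2 ha; rewrite /rA /rC => ib1 ib2 ha.
  have : (Z <= (ib - 3) * Z)%N by rewrite leq_pmull //; lia.
  have : ((ib - 3) * Z + Z <= 4 * Z)%N by rewrite -mulSnr leq_mul2r; lia.
  move: ((ib - 3) * Z)%N => bz; lia.
Qed.

Lemma spec_frame_transform ib e s s1 (S : nat) (V : nat -> int) (Q : state -> Prop) :
  (rA <= ib <= rB)%N -> small W e -> small W ecopy -> mm_frame s s1 ->
  reg s ib = ((ib - 3) * Z)%N -> reg s rT = (3 * Z)%N ->
  reg s1 rS = S -> (S <= Z)%N ->
  (forall k, (k < S)%N -> (`|V k| <= M)%N) ->
  (forall k, (k < S)%N ->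
     eval (State (loop_regs s1 S k) (setarr (cells s1) (3 * Z) k V)) e = V k) ->
  (forall s2, mm_frame s s2 -> reg s2 =1 loop_regs s1 S S ->
     arr s2 ((ib - 3) * Z) S V ->
     (forall k, (k < 3 * Z)%N ->
        (k < (ib - 3) * Z)%N || ((ib - 3) * Z + Z <= k)%N ->
        cells s2 k = cells s1 k) -> Q s2) ->
  spec B (htransform ib e) s1 (2 * (W * Z.+1)) Q.
Proof.
move=> /andP[ib1 ib2] se sc f hib hT hS SZ Vb ev fin.
have [bs hr hc] := f.
have lo : (Z <= (ib - 3) * Z)%N by rewrite leq_pmull //; move: ib1; rewrite /rA; lia.
have hi : ((ib - 3) * Z + Z <= 3 * Z)%N.
  by rewrite -mulSnr leq_mul2r; move: ib2; rewrite /rB; lia.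
have ibm : ib \notin mmregs.
  by move: ib1 ib2; rewrite !inE /rA /rB /rq /rs /map_idx /map_lim /rS; lia.
have wS : (W * S.+1 <= W * Z.+1)%N by rewrite leq_mul2l ltnS SZ orbT.
apply: (spec_weaken (t := (W * S.+1 + W * S.+1)%N) (Q := Q)) => //; first by lia.
apply: (spec_transform (b := ((ib - 3) * Z)%N) (t := (3 * Z)%N) (V := V)) => //.
- by move: ib2; rewrite /rB /map_idx; lia.
- by rewrite hr.
- by rewrite hr.
- by apply: leq_trans hi; rewrite leq_add2l.
move=> s2 hr2 hc2 bs2; apply: fin => //.
- split => //; first exact: mm_frame_loop hr2.
  by move=> a ha; rewrite hc2 !setarr_out ?hc //; lia.
- by move=> y yS; rewrite hc2 setarr_in.
- by move=> k k3 hk; rewrite hc2 !setarr_out //; lia.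
Qed.

Definition base (s : state) : Prop :=
  [/\ reg s rN = N, reg s rL = L, reg s rA = Z, reg s rB = (2 * Z)%N
    & reg s rT = (3 * Z)%N].

Definition Idown s a b k s1 : Prop :=
  [/\ mm_frame s s1, reg s1 rq = (m ^ (L - k))%N, reg s1 rs = (r ^ k)%N,
      arr s1 Z (r ^ k * (m ^ (L - k) * m ^ (L - k))) (down_iter r m u L a k)
    & arr s1 (2 * Z) (r ^ k * (m ^ (L - k) * m ^ (L - k))) (down_iter r m v L b k)].

Hypothesis scopy : small W ecopy.
Hypothesis sdot : small W edot.
Hypothesis sdA : small W (edown rA r m u).
Hypothesis sdB : small W (edown rB r m v).
Hypothesis sup : small W (eup rA r m w).
Hypothesis sq1 : small W (eQ / ECst m%:Z)%X.
Hypothesis sq2 : small W (eQ * ECst m%:Z)%X.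
Hypothesis sS1 : small W (EReg rs * ECst r%:Z * (eQ * eQ))%X.
Hypothesis sS2 : small W (EReg rs * ((eQ * ECst m%:Z) * (eQ * ECst m%:Z)))%X.
Hypothesis ss1 : small W (EReg rs * ECst r%:Z)%X.
Hypothesis ss2 : small W (EReg rs / ECst r%:Z)%X.

Lemma pow_leN k : (k <= L)%N -> (m ^ k <= M)%N.
Proof.
move=> kL; apply: leq_trans NM; rewrite NE -(subnK kL) expnD.
by rewrite leq_pmull // expn_gt0 m0.
Qed.

Lemma pow_leZ k : (k <= L)%N -> (r ^ k <= Z)%N.
Proof.
move=> kL; rewrite ZE -(subnK kL) expnD.
by rewrite leq_pmull // expn_gt0 r_gt0.
Qed.

Lemma spec_down s a b k s1 : base s -> (k < L)%N ->
  (forall x, (`|a x| <= 1)%N) -> (forall x, (`|b x| <= 1)%N) ->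
  Idown s a b k s1 ->
  spec B (hdown r m u v) s1 (3 * W + 4 * (W * Z.+1))
    (fun s2 => [/\ Idown s a b k.+1 s2, reg s2 15%N = reg s1 15%N
                 & reg s2 16%N = reg s1 16%N]).
Proof.
move=> [hN hL hA hB hT] kL a1 b1 [f hq hs arA arB].
set q := (m ^ (L - k.+1))%N.
have q0 : (0 < q)%N by rewrite expn_gt0 m0.
have pq : (m ^ (L - k) = q * m)%N by rewrite mulnC -expnS subnSK.
have sz := size_le (ltnW kL); have sz' := size_le kL; rewrite -/q in sz'.
rewrite pq in hq arA arB sz.
set S := (r ^ k.+1 * (q * q))%N in sz' *.
have dlb (t : nat -> nat -> nat -> int) y : (forall l, (l < r)%N ->
    (\sum_(i < m) \sum_(j < m) `|t l i j| <= c)%N) ->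
  (forall x, (`|y x| <= 1)%N) -> forall x, (`|down_iter r m t L y k.+1 x| <= M)%N.
  move=> tc y1 x; apply: leq_trans (down_iter_bound _ tc y1 x) _.
  by apply: cpow_le; apply: leq_trans kL _; rewrite leq_pmull.
rewrite down_timeE.
apply: (spec_seq (Q1 := fun s2 => s2 = upd_reg s1 rq q)) => [|_ ->].
  apply: (spec_hset M2 MB) => //; first by case: f.
  by rewrite /= hq divz_nat mulnK.
have f2 : mm_frame s (upd_reg s1 rq q).
  by apply: mm_frame_upd => //; apply: pow_leN; apply: leq_subr.
apply: (spec_seq (Q1 := fun s2 => s2 = upd_reg (upd_reg s1 rq q) rS S)) => [|_ ->].
  apply: (spec_hset M2 MB) => //; first by case: f2.
  by rewrite /= hs -!PoszM -expnSr.
have f3 : mm_frame s (upd_reg (upd_reg s1 rq q) rS S).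
  by apply: mm_frame_upd => //=; apply: leq_trans sz' ZleM.
set s3 := upd_reg _ rS S in f3 *.
have xlt x : (x < S)%N -> (x < r ^ k * r * (q * q))%N by rewrite -expnSr.
apply: (spec_seq (Q1 := fun s4 => [/\ mm_frame s s4, reg s4 =1 loop_regs s3 S S,
   arr s4 Z S (down_iter r m u L a k.+1) &
   arr s4 (2 * Z) (r ^ k * ((q * m) * (q * m))) (down_iter r m v L b k)])).
  apply: (spec_frame_transform (s := s) (V := down_iter r m u L a k.+1) (S := S)) => //.
  - by rewrite mul1n.
  - by move=> x _; apply: dlb.
  - move=> x xS; apply: (@eval_edown _ rA r m u q x Z (r ^ k)) => //.
    + by rewrite -hA; case: f => _ hr _; rewrite /= /loop_regs /= hr.
    + exact: r_gt0.
    + move=> y ylt; have yZ := leq_trans ylt sz.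
      rewrite /= setarr_out; last by clear -yZ; lia.
      exact: arA.
    + exact: xlt.
  - move=> s4 f4 hr4 hA4 hB4; split => //.
    + by rewrite -[Z]mul1n.
    + move=> y ylt; have yZ := leq_trans ylt sz.
      rewrite hB4 /=; [exact: arB | by clear -yZ; lia | by rewrite /rA; clear -yZ; lia].
move=> s4 [f4 hr4 arA4 arB4].
apply: (spec_seq (Q1 := fun s5 => [/\ mm_frame s s5, reg s5 =1 loop_regs s3 S S,
   arr s5 Z S (down_iter r m u L a k.+1) & arr s5 (2 * Z) S (down_iter r m v L b k.+1)])).
  apply: (spec_frame_transform (s := s) (V := down_iter r m v L b k.+1) (S := S)) => //.
  - by move=> x _; apply: dlb.
  - move=> x xS; apply: (@eval_edown _ rB r m v q x (2 * Z) (r ^ k)) => //.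
    + by rewrite /= /loop_regs /= hr4 /loop_regs /=.
    + by rewrite -hB; case: f4 => _ hr _; rewrite /= /loop_regs /= hr.
    + exact: r_gt0.
    + move=> y ylt; have yZ := leq_trans ylt sz.
      rewrite /= setarr_out; last by clear -yZ; lia.
      exact: arB4.
    + exact: xlt.
  - move=> s5 f5 hr5 hB5 hA5; split => //.
    + move=> x; rewrite hr5 /loop_regs; case: ifP => // h1; case: ifP => // h2.
      by rewrite hr4 /loop_regs h1 h2.
    + move=> y ylt; have yZ := leq_trans ylt sz'.
      by rewrite hA5; [exact: arA4 | clear -yZ; lia | rewrite /rB; clear -yZ; lia].
move=> s5 [f5 hr5 arA5 arB5].
apply: (spec_hset M2 MB) => //; first by case: f5.
have -> : eval s5 (EReg rs * ECst r%:Z)%X = (r ^ k.+1)%N.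
  by rewrite /= hr5 /loop_regs /= hs -PoszM -expnSr.
split; [split | by rewrite /= hr5 /loop_regs | by rewrite /= hr5 /loop_regs] => //.
- by apply: mm_frame_upd => //; apply: leq_trans (pow_leZ kL) ZleM.
- by rewrite /= hr5 /loop_regs.
Qed.

Definition dot a b x : int := down_iter r m u L a L x * down_iter r m v L b L x.

Definition Iup s f k s1 : Prop :=
  [/\ mm_frame s s1, reg s1 rq = (m ^ k)%N, reg s1 rs = (r ^ (L - k))%N
    & arr s1 Z (r ^ (L - k) * (m ^ k * m ^ k)) (up_iter r m w f k)].

Lemma spec_up s f k s1 : base s -> (k < L)%N ->
  (forall x, (`|f x| <= c ^ (2 * L))%N) -> Iup s f k s1 ->
  spec B (hup r m w) s1 (3 * W + 2 * (W * Z.+1))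
    (fun s2 => [/\ Iup s f k.+1 s2, reg s2 15%N = reg s1 15%N
                 & reg s2 16%N = reg s1 16%N]).
Proof.
move=> [hN hL hA hB hT] kL f1 [fr1 hq hs arA].
set q := (m ^ k)%N in hq arA.
have q0 : (0 < q)%N by rewrite expn_gt0 m0.
have pq : (m ^ k.+1 = q * m)%N by rewrite mulnC -expnS.
have rr : (r ^ (L - k) = r ^ (L - k.+1) * r)%N by rewrite -expnSr subnSK.
have sz := size_le (leq_subr k L); rewrite subKn ?(ltnW kL) // in sz.
have sz' := size_le (leq_subr k.+1 L); rewrite subKn // in sz'.
set S := (r ^ (L - k.+1) * (m ^ k.+1 * m ^ k.+1))%N in sz' *.
have SE : S = (r ^ (L - k.+1) * ((q * m) * (q * m)))%N by rewrite /S pq.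
have ulb x : (`|up_iter r m w f k.+1 x| <= M)%N.
  apply: leq_trans (up_iter_bound _ f1 x) _; rewrite -expnD; apply: cpow_le.
  by rewrite [(3 * L)%N]mulSn leq_add2r.
have -> : (3 * W + 2 * (W * Z.+1) = W + (W + (2 * (W * Z.+1) + W)))%N.
  by rewrite up_timeE.
apply: (spec_seq (Q1 := fun s2 => s2 = upd_reg s1 rs (r ^ (L - k.+1))%N)) => [|_ ->].
  apply: (spec_hset M2 MB) => //; first by case: fr1.
  by rewrite /= hs divz_nat rr mulnK // r_gt0.
have f2 : mm_frame s (upd_reg s1 rs (r ^ (L - k.+1))%N).
  by apply: mm_frame_upd => //; apply: leq_trans (pow_leZ (leq_subr _ _)) ZleM.
apply: (spec_seq (Q1 := fun s2 =>
    s2 = upd_reg (upd_reg s1 rs (r ^ (L - k.+1))%N) rS S)) => [|_ ->].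
  apply: (spec_hset M2 MB) => //; first by case: f2.
  by rewrite /= hq -!PoszM SE.
have f3 : mm_frame s (upd_reg (upd_reg s1 rs (r ^ (L - k.+1))%N) rS S).
  by apply: mm_frame_upd => //=; apply: leq_trans sz' ZleM.
set s3 := upd_reg _ rS S in f3 *.
apply: (spec_seq (Q1 := fun s4 => [/\ mm_frame s s4, reg s4 =1 loop_regs s3 S S
   & arr s4 Z S (up_iter r m w f k.+1)])).
  apply: (spec_frame_transform (s := s) (V := up_iter r m w f k.+1) (S := S)) => //.
  - by rewrite mul1n.
  - move=> x xS; apply: (@eval_eup _ rA r m w q x Z (r ^ (L - k.+1))) => //.
    + by rewrite -hA; case: fr1 => _ hr _; rewrite /= /loop_regs /= hr.
    + move=> y ylt; rewrite -rr in ylt; have yZ := leq_trans ylt sz.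
      rewrite /= setarr_out; last by clear -yZ; lia.
      exact: arA.
    + by rewrite -SE.
  - by move=> s4 f4 hr4 hA4 _; split => //; rewrite -[Z]mul1n.
move=> s4 [f4 hr4 arA4].
apply: (spec_hset M2 MB) => //; first by case: f4.
have -> : eval s4 (eQ * ECst m%:Z)%X = (m ^ k.+1)%N.
  by rewrite /= hr4 /loop_regs /= hq -PoszM pq.
split; [split | by rewrite /= hr4 /loop_regs | by rewrite /= hr4 /loop_regs] => //.
- by apply: mm_frame_upd => //; apply: pow_leN.
- by rewrite /= hr4 /loop_regs.
Qed.

(** Each of the [2 * L] levels is charged with the full array size [Z]. This costs the factor
    [L.+1], which is harmless for the exponent. *)
Lemma spec_matmul s a b eA eB (Q : state -> Prop) :
  base s -> bounded M s -> small W eA -> small W eB ->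
  (forall x, (`|a x| <= 1)%N) -> (forall x, (`|b x| <= 1)%N) ->
  (forall s1 x, mm_frame s s1 -> reg s1 map_idx = x%:Z -> (x < N * N)%N -> eval s1 eA = a x) ->
  (forall s1 x, mm_frame s s1 -> reg s1 map_idx = x%:Z -> (x < N * N)%N -> eval s1 eB = b x) ->
  (forall s1, mm_frame s s1 ->
     (forall i j, (i < N)%N -> (j < N)%N -> cells s1 (Z + (i * N + j))%N =
        D ^+ L * \sum_(k < N) a (i * N + k)%N * b (k * N + j)%N) -> Q s1) ->
  spec B (hmatmul r m u v w eA eB) s (30 * W * L.+1 * Z.+1) Q.
Proof.
move=> bse bs seA seB a1 b1 evA evB fin.
have [hN hL hA hB hT] := bse.
have W0 : (0 < W)%N by case/andP: seA => _; apply: leq_trans; rewrite addnS.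
have NZ : (N * N <= Z)%N by have := size_le (leq0n L); rewrite subn0 expn0 mul1n NE.
have smallR x : (x < nregs)%N -> small W (EReg x).
  by move=> xK; case/andP: scopy => _ h; rewrite /small /= xK; apply: leq_trans h.
have sN2 : small W (EReg rN * EReg rN)%X.
  by case/andP: scopy => _ h; rewrite /small /=; apply: leq_trans h.
have s1C : small W (ECst 1).
  by case/andP: scopy => _ h; rewrite /small /=; apply: leq_trans h.
have M1 : (1 <= M)%N by apply: ltnW.
have N0 : (0 < N)%N by rewrite NE expn_gt0 m0.
have f0 : mm_frame s s by split.
apply: (@spec_weaken B _ s (W + (W + (W + (W * Z.+1 + (W * Z.+1 +
  ((1 + 4 + L * ((3 * W + 4 * (W * Z.+1)) + 6)) + (W * Z.+1 +
   (1 + 4 + L * ((3 * W + 2 * (W * Z.+1)) + 6)))))))))%N _ Q Q) => //.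
  by clear -W0; nia.
apply: (spec_seq (Q1 := fun s2 => s2 = upd_reg s rq N)) => [|_ ->].
  by apply: (spec_hset M2 MB) => //; [exact: smallR | rewrite /= hN].
have f1 : mm_frame s (upd_reg s rq N) by apply: mm_frame_upd.
apply: (spec_seq (Q1 := fun s2 => s2 = upd_reg (upd_reg s rq N) rs 1)) => [|_ ->].
  by apply: (spec_hset M2 MB) => //; case: f1.
have f2 : mm_frame s (upd_reg (upd_reg s rq N) rs 1) by apply: mm_frame_upd.
apply: (spec_seq (Q1 := fun s2 =>
   s2 = upd_reg (upd_reg (upd_reg s rq N) rs 1) rS (N * N)%N)) => [|_ ->].
  by apply: (spec_hset M2 MB) => //; [case: f2 | rewrite /= hN PoszM].
have f3 : mm_frame s (upd_reg (upd_reg (upd_reg s rq N) rs 1) rS (N * N)%N).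
  by apply: mm_frame_upd => //; apply: leq_trans NZ ZleM.
set s3 := upd_reg _ rS _ in f3 *.
(* [eA] and [eB] are evaluated while the arrays are being filled; these intermediate states satisfy
   the frame, too. *)
have fr_state s2 ib k V : mm_frame s s2 -> (k <= N * N)%N -> (1 <= ib <= 2)%N ->
    (forall x, (`|V x| <= 1)%N) ->
    mm_frame s (State (loop_regs s2 (N * N) k) (setarr (cells s2) (ib * Z) k V)).
  move=> [bs2 hr2 hc2] kN /andP[ib1 ib2] Vb.
  have kM := leq_trans kN (leq_trans NZ ZleM).
  split.
  - split => [x xK|y]; first by apply: loop_regs_bound => //; apply: leq_trans NZ ZleM.
    apply: setarr_bound => [z|x _]; first by case: bs2.
    exact: leq_trans M1.
  - move=> x xm; rewrite /= -hr2 // /loop_regs.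
    case: eqP => [xi|_]; first by rewrite xi in xm.
    by case: eqP => [xi|_]; first by rewrite xi in xm.
  - move=> y hy; rewrite /= setarr_out ?hc2 //.
    have kZ := leq_trans kN NZ.
    have : (Z <= ib * Z)%N by rewrite leq_pmull.
    have : (ib * Z <= 2 * Z)%N by rewrite leq_mul2r ib2 orbT.
    by move: (ib * Z)%N => bz h1 h2; clear -h1 h2 kZ hy; lia.
apply: (spec_seq (Q1 := fun s4 => [/\ mm_frame s s4, reg s4 =1 loop_regs s3 (N * N) (N * N)
    & arr s4 Z (N * N) a])).
  apply: (@spec_frame_map rA _ s s3 (N * N)%N a) => //.
  - by rewrite mul1n.
  - by move=> k _; apply: leq_trans (a1 k) M1.
  - move=> k kN; apply: evA => //; apply: fr_state => //; exact: ltnW.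
  - move=> s4 f4 hr4 hc4; split => // y yl.
    by rewrite hc4 mul1n setarr_in.
move=> s4 [f4 hr4 arA4].
apply: (spec_seq (Q1 := fun s5 => Idown s a b 0 s5)).
  apply: (@spec_frame_map rB _ s s4 (N * N)%N b _ _ _ _ _ _ rS) => //.
  - by move=> k _; apply: leq_trans (b1 k) M1.
  - move=> k kN; apply: evB => //; apply: fr_state => //; exact: ltnW.
  - move=> s5 f5 hr5; rewrite -[((rB - 3) * Z)%N]/(2 * Z)%N => hc5; split => //.
    + by rewrite hr5 /loop_regs /= hr4 /loop_regs /= subn0 NE.
    + by rewrite hr5 /loop_regs /= hr4 /loop_regs /= expn0.
    + move=> y; rewrite expn0 mul1n subn0 -NE => yl /=.
      rewrite hc5 setarr_out ?arA4 //.
      by have yZ := leq_trans yl NZ; clear -yZ; lia.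
    + move=> y; rewrite expn0 mul1n subn0 -NE => yl /=.
      by rewrite hc5 setarr_in.
move=> s5 I5.
have frsame s1 s2 : mm_frame s s1 -> mm_frame s s2 -> forall x, x \notin mmregs ->
    reg s1 x = reg s2 x.
  by move=> [_ h1 _] [_ h2 _] x xm; rewrite h1 // h2.
have LM : (L <= M)%N by case: bs => h _; have := h rL isT; rewrite hL.
have sRL := smallR rL isT.
apply: (spec_seq (Q1 := fun s6 => Idown s a b L s6)).
  have [f5 hq5 hs5 hA5 hB5] := I5.
  have [bs5 hr5 hc5] := f5.
  apply: (spec_for (n := L) (I := fun k s1 => Idown s a b k s1)) => //.
  - by apply: (small_ebounded M2 MB) => //; case/andP: sRL => _; apply: leq_trans.
  - exact: (B_gt0 M2 MB).
  - by rewrite /= hr5.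
  - split => //=.
    by do 2 apply: mm_frame_upd => //.
  - move=> k s1 kL e15 e16 I1.
    apply: spec_weaken (spec_down bse kL a1 b1 I1) => // s2 [I2 h15 h16].
    split; [by rewrite h15 | by rewrite h16 | ].
    case: I2 => f q2 r2 A2 B2; split => //.
    by apply: mm_frame_upd => //; apply: leq_trans LM.
move=> s6 [f6 hq6 hs6 hA6 hB6].
rewrite subnn expn0 !muln1 in hq6 hA6 hB6.
have pwb x : (`|dot a b x| <= c ^ (2 * L))%N.
  by rewrite abszM mul2n -addnn expnD leq_mul // down_iter_bound.
have rZ : (r ^ L)%N = Z by rewrite ZE.
rewrite rZ in hs6 hA6 hB6.
have pwM x : (`|dot a b x| <= M)%N.
  by apply: leq_trans (pwb x) _; apply: cpow_le; rewrite leq_mul2r orbT.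
apply: (spec_seq (Q1 := fun s7 => Iup s (dot a b) 0 s7)).
  apply: (@spec_frame_map rA _ s s6 Z (dot a b) _ _ _ _ _ _ rs) => //.
  - by rewrite mul1n.
  - move=> k kZ; rewrite mul1n.
    have [_ hr6 _] := f6.
    have E1 : loop_regs s6 Z k rA = Z by rewrite /loop_regs /= hr6.
    have E2 : loop_regs s6 Z k rB = (2 * Z)%N by rewrite /loop_regs /= hr6.
    have E3 : loop_regs s6 Z k map_idx = k by [].
    transitivity (setarr (cells s6) Z k (dot a b) (loop_regs s6 Z k rA + loop_regs s6 Z k map_idx)
      * setarr (cells s6) Z k (dot a b) (loop_regs s6 Z k rB + loop_regs s6 Z k map_idx)) => //.
    rewrite E1 E2 E3 -!PoszD !setarr_out ?hA6 ?hB6 //; clear -kZ; lia.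
  - move=> s7 f7 hr7 hc7; split => //.
    + by rewrite hr7 /loop_regs /= hq6.
    + by rewrite hr7 /loop_regs /= hs6 subn0 rZ.
    + move=> y; rewrite subn0 rZ muln1 => yl; rewrite hc7 mul1n setarr_in //.
move=> s7 I7.
have [f7 hq7 hs7 hA7] := I7.
have [bs7 hr7 hc7] := f7.
apply: (spec_for (n := L) (I := fun k s1 => Iup s (dot a b) k s1)) => //.
- by apply: (small_ebounded M2 MB) => //; case/andP: sRL => _; apply: leq_trans.
- exact: (B_gt0 M2 MB).
- by rewrite /= hr7.
- split => //=.
  by do 2 apply: mm_frame_upd => //.
- move=> k s1 kL e15 e16 I1.
  apply: spec_weaken (spec_up bse kL pwb I1) => // s2 [I2 h15 h16].
  split; [by rewrite h15 | by rewrite h16 | ].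
  case: I2 => f q2 r2 A2; split => //.
  by apply: mm_frame_upd => //; apply: leq_trans LM.
move=> s1 _ _ [f8 hq8 hs8 hA8]; apply: fin => // i j iN jN.
rewrite hA8; last by rewrite subnn expn0 mul1n -NE ltn_mulD.
rewrite NE in iN jN.
have := up_iter_mul a b 0 (leqnn L) iN jN.
by rewrite subnn /= /addr mul0n add0n -NE => ->.
Qed.

(** * The counting loops *)

Variables (n : nat) (G : tournament n).
Hypothesis nN : (n <= N)%N.
Hypothesis D0 : D != 0.

Definition ready (s : state) (A : int) : Prop :=
  [/\ bounded M s, base s,
      [/\ reg s rn = n, reg s rD = D ^+ L & reg s rC = (4 * Z)%N],
      reg s racc = A & gcells G s].

Lemma NN_le : (N * N <= Z)%N.
Proof. by have := size_le (leq0n L); rewrite subn0 expn0 mul1n NE. Qed.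

(** The adjacency matrix ends before the first array begins, so it is never overwritten. *)
Lemma cell_le x y : (x < n)%N -> (y < n)%N -> (x * n + y < Z)%N.
Proof.
move=> xn yn; apply: leq_trans NN_le; apply: leq_trans (ltn_mulD xn yn) _.
exact: leq_mul.
Qed.

Lemma mm_frame_ready s s1 A : ready s A -> mm_frame s s1 -> ready s1 A.
Proof.
move=> [bs [h1 h2 h3 h4 h5] [k1 k2 k3] hA hc] [bs1 hr hcl].
split; [exact: bs1 | by split; rewrite hr | by split; rewrite hr | by rewrite hr | ].
move=> x y xn yn; rewrite hcl ?hc //.
by apply/orP; left; rewrite ltz_nat cell_le.
Qed.

(* Outside [n x n] the matrices are padded by 0. *)
Definition cval a (x k : nat) : int :=
  if (k %/ N < n)%N && (k %% N < n)%N then seenN G a x (k %/ N) (k %% N) else 0.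

Lemma spec_matmul_seen s A a (x : nat) (Q : state -> Prop) : ready s A -> reg s rx = x ->
  (x < n)%N -> small W (eA a) -> small W (eB a) ->
  (forall s1, mm_frame s s1 -> arr s1 Z (N * N) (fun k => D ^+ L * cval a x k) -> Q s1) ->
  spec B (hmatmul r m u v w (eA a) (eB a)) s (30 * W * L.+1 * Z.+1) Q.
Proof.
move=> rs hx xn sA sB fin; have [bs bse _ _ _] := rs.
apply: (spec_matmul (a := amat G N a x) (b := bmat G N a)) => //.
- exact: amat_bound.
- exact: bmat_bound.
- move=> s1 k f hk _; have [_ [hN _ _ _ _] [hn _ _] _ gc] := mm_frame_ready rs f.
  by apply: eval_eA => //; case: f => _ hr _; rewrite hr.
- move=> s1 k f hk _; have [_ [hN _ _ _ _] [hn _ _] _ gc] := mm_frame_ready rs f.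
  by apply: (@eval_eB n G N s1 x).
- move=> s1 f h; apply: fin => // k kN.
  have N0 : (0 < N)%N by move: kN; case: (N).
  have h1 : (k %/ N < N)%N by rewrite ltn_divLR.
  have h2 : (k %% N < N)%N by rewrite ltn_pmod.
  by rewrite {1}(divn_eq k N) h // amat_bmat.
Qed.

Lemma spec_body s A ga e (x : nat) : ready s A -> reg s rx = x -> (x < n)%N ->
  (forall a, small W (eA a)) -> (forall a, small W (eB a)) -> small W (eterm ga e) ->
  (forall k, (k <= N * N)%N -> (`|(A + \sum_(j < k) Vterm G N ga e x j)%R| <= M)%N) ->
  spec B (hbody r m u v w ga e) s (70 * W * L.+1 * Z.+1)
    (fun s' => [/\ ready s' (A + ga * rowN G e x), reg s' rx = x & reg s' 18%N = reg s 18%N]).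
Proof.
move=> rs hx xn sA sB se bound.
have W0 : (0 < W)%N by case/andP: se => _; apply: leq_trans; rewrite addnS.
have sN2 : small W (EReg rN * EReg rN)%X.
  by case/andP: scopy => _ h; rewrite /small /=; apply: leq_trans h.
have scp : small W (ELoad (EReg rA + eX)%X).
  by case/andP: scopy => _ h; rewrite /small /=; apply: leq_trans h.
have NNM : (N * N <= M)%N by apply: leq_trans NN_le ZleM.
apply: (@spec_weaken B _ s (30 * W * L.+1 * Z.+1 + (W + (W * (N * N).+1 +
   (30 * W * L.+1 * Z.+1 + (W + W * (N * N).+1)))))%N) => [|s' h|]; [|exact: h|].
  have : (W * (N * N).+1 <= W * Z.+1)%N by rewrite leq_mul2l ltnS NN_le orbT.
  have h1 : (W * Z.+1 <= W * L.+1 * Z.+1)%N by rewrite leq_mul2r leq_pmulr // orbT.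
  have h2 : (W <= W * L.+1 * Z.+1)%N by rewrite -mulnA leq_pmulr // muln_gt0.
  rewrite -!mulnA in h1 h2 *; move: (W * (N * N).+1)%N (W * Z.+1)%N h1 h2.
  by move: (W * (L.+1 * Z.+1))%N => a b c' h1 h2 h3; clear -h1 h2 h3; lia.
apply: (spec_seq (Q1 := fun s1 => mm_frame s s1 /\
    arr s1 Z (N * N) (fun k => D ^+ L * cval (pattern e v3) x k))).
  by apply: (spec_matmul_seen rs hx xn) => // s1 f h; split.
move=> s1 [f1 ar1]; have r1 := mm_frame_ready rs f1.
have [bs1 [hN1 hL1 hA1 hB1 hT1] [hn1 hD1 hC1] hac1 gc1] := r1.
have hx1 : reg s1 rx = x by case: f1 => _ hr _; rewrite hr.
have h181 : reg s1 18%N = reg s 18%N by case: f1 => _ hr _; rewrite hr.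
apply: (spec_seq (Q1 := fun s2 => s2 = upd_reg s1 rS (N * N)%N)) => [|_ ->].
  by apply: (spec_hset M2 MB) => //; rewrite /= hN1 PoszM.
have bs2 := bounded_upd rS bs1 (NNM : `|(N * N)%N%:Z| <= M)%N.
pose V k := D ^+ L * cval (pattern e v3) x k.
have VM k : (k < N * N)%N -> (`|V k| <= M)%N.
  move=> kN; have <- : cells s1 (Z + k)%N = V k by apply: ar1.
  by case: bs1.
apply: (spec_seq (Q1 := fun s3 => [/\ ready s3 A, reg s3 rx = x, reg s3 18%N = reg s 18%N
    & arr s3 (4 * Z) (N * N) V])).
  apply: (spec_map M2 MB (b := (4 * Z)%N) (S := (N * N)%N) (V := V)) => //.
  - move=> k kN; set h := setarr _ _ _ _.
    have E1 : loop_regs (upd_reg s1 rS (N * N)%N) (N * N) k rA = Z by [].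
    have E2 : loop_regs (upd_reg s1 rS (N * N)%N) (N * N) k map_idx = k by [].
    transitivity (h (loop_regs (upd_reg s1 rS (N * N)%N) (N * N) k rA +
      loop_regs (upd_reg s1 rS (N * N)%N) (N * N) k map_idx)) => //.
    rewrite E1 E2 -PoszD /h setarr_out /=; first exact: ar1.
    have kZ := leq_trans kN NN_le; clear -kZ; lia.
  - move=> s3 hr3 hc3; split.
    + split; [ | by split; rewrite hr3 | by split; rewrite hr3 | by rewrite hr3 | ].
      * split => [y yK|a]; first by rewrite hr3; apply: loop_regs_bound.
        by rewrite hc3; apply: setarr_bound => //; case: bs2.
      * move=> y z yn zn; rewrite hc3 setarr_out /=; first exact: gc1.
        have kZ := cell_le yn zn; clear -kZ; lia.
    + by rewrite hr3.
    + by rewrite hr3.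
    + by move=> k kN; rewrite hc3 setarr_in.
move=> s3 [r3 hx3 h183 ar3].
apply: (spec_seq (Q1 := fun s4 => mm_frame s3 s4 /\
    arr s4 Z (N * N) (fun k => D ^+ L * cval (pattern e v4) x k))).
  by apply: (spec_matmul_seen r3 hx3 xn) => // s4 f h; split.
move=> s4 [f4 ar4]; have r4 := mm_frame_ready r3 f4.
have [bs4 [hN4 hL4 hA4 hB4 hT4] [hn4 hD4 hC4] hac4 gc4] := r4.
have hx4 : reg s4 rx = x by case: f4 => _ hr _; rewrite hr.
have h184 : reg s4 18%N = reg s 18%N by case: f4 => _ hr _; rewrite hr.
have arC4 : arr s4 (4 * Z) (N * N) V.
  move=> k kN; rewrite -ar3 //; case: f4 => _ _; apply.
  by apply/orP; right; rewrite lez_nat leq_addr.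
apply: (spec_seq (Q1 := fun s5 => s5 = upd_reg s4 rS (N * N)%N)) => [|_ ->].
  by apply: (spec_hset M2 MB) => //; rewrite /= hN4 PoszM.
have bs5 := bounded_upd rS bs4 (NNM : `|(N * N)%N%:Z| <= M)%N.
have DL0 : D ^+ L != 0 by rewrite expf_neq0.
apply: (spec_sum M2 MB (a0 := A) (S := (N * N)%N) (V := Vterm G N ga e x)) => //.
- move=> k kN; apply: (@eval_eterm n G N _ x) => //.
  + move=> nn; rewrite -[LHS]/((cells s4 (reg s4 rC + k%:Z) %/ reg s4 rD)%Z).
    by rewrite hC4 hD4 -PoszD arC4 // /V /cval nn mulKz.
  + move=> nn; rewrite -[LHS]/((cells s4 (reg s4 rA + k%:Z) %/ reg s4 rD)%Z).
    by rewrite hA4 hD4 -PoszD ar4 // /cval nn mulKz.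
- rewrite Vterm_sum // => s6 hr6 hac6 hc6; split; rewrite ?hr6 //.
  split; [ | by split; rewrite hr6 | by split; rewrite hr6 | exact: hac6 | ].
  + split => [y yK|a]; last by rewrite hc6; case: bs5.
    have [->|ne] := eqVneq y racc; last by rewrite hr6 //; apply: loop_regs_bound.
    by rewrite hac6 -(Vterm_sum G nN); apply: bound.
  + by move=> y z yn zn; rewrite hc6; apply: gc4.
Qed.

Hypothesis sA : forall a, small W (eA a).
Hypothesis sB : forall a, small W (eB a).

Definition rowB : nat := (N * N * (2 * (n * n)))%N.

Lemma Vterm_partial ga e x k : (k <= N * N)%N ->
  (`|(\sum_(j < k) Vterm G N ga e x j)%R| <= `|ga| * rowB)%N.
Proof.
move=> kN; apply: leq_trans (leq_norm_sum _) _.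
apply: (@leq_trans (\sum_(j < k) `|ga| * (2 * (n * n)))%N).
  by apply: leq_sum => j _; apply: Vterm_bound.
by rewrite sum_nat_const card_ord /rowB mulnCA leq_mul2l leq_mul2r kN !orbT.
Qed.

Lemma rowN_bound ga e x : (`|(ga * rowN G e x)%R| <= `|ga| * rowB)%N.
Proof. by rewrite -(Vterm_sum G nN); apply: Vterm_partial. Qed.

Lemma rows_bound ga e x : (`|(\sum_(j < x) ga * rowN G e j)%R| <= x * (`|ga| * rowB))%N.
Proof.
apply: leq_trans (leq_norm_sum _) _; rewrite -[x in (x * _)%N]card_ord -sum_nat_const.
by apply: leq_sum => j _; apply: rowN_bound.
Qed.

Lemma n_leM : (n <= M)%N. Proof. exact: leq_trans nN NM. Qed.

Lemma ready_upd s A z y : (z == rx) || (z == 18)%N -> (`|y| <= M)%N ->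
  ready s A -> ready (upd_reg s z y) A.
Proof.
move=> hz yM [bs [h1 h2 h3 h4 h5] [k1 k2 k3] hA hc].
have ne i : (i != rx) && (i != 18)%N -> (i == z) = false.
  by case/orP: hz => /eqP-> /andP[/negPf h /negPf h'].
split; first exact: bounded_upd.
- by split; rewrite /= ne.
- by split; rewrite /= ne.
- by rewrite /= ne.
- exact: hc.
Qed.

Definition unit_time : nat := (W * n.+1 * L.+1 * Z.+1)%N.

Lemma spec_term s A ga e : ready s A -> small W (eterm ga e) ->
  (`|A| + `|ga| * (n * rowB) <= M)%N ->
  spec B (hterm r m u v w ga e) s (81 * unit_time)
    (fun s' => ready s' (A + \sum_(x < n) ga * rowN G e x)).
Proof.
move=> rs se AM; have [bs bse [hn hD hC] hA gc] := rs.
have W0 : (0 < W)%N by case/andP: se => _; apply: leq_trans; rewrite addnS.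
have srn : small W (EReg rn).
  by case/andP: scopy => _ h; rewrite /small /=; apply: leq_trans h.
apply: (@spec_weaken B _ s (1 + 4 + n * (70 * W * L.+1 * Z.+1 + 6))%N) => [|s' h|]; [|exact: h|].
  rewrite /unit_time; have : (0 < W * L.+1 * Z.+1)%N by rewrite !muln_gt0 W0.
  have -> : (W * n.+1 * L.+1 * Z.+1 = n.+1 * (W * L.+1 * Z.+1))%N.
    by rewrite [(W * n.+1)%N]mulnC -!mulnA.
  by rewrite -!mulnA; move: (W * (L.+1 * Z.+1))%N => a a0; clear -a0; nia.
apply: (spec_for (n := n) (I := fun k s1 => ready s1 (A + \sum_(j < k) ga * rowN G e j))) => //.
- by apply: (small_ebounded M2 MB) => //; case/andP: srn => _; apply: leq_trans.
- exact: (B_gt0 M2 MB).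
- by rewrite big_ord0 addr0; do 2 apply: ready_upd => //; exact: n_leM.
- move=> k s1 kn e1 e2 r1.
  apply: spec_weaken (spec_body r1 e1 kn sA sB se _) => //.
    move=> s2 [r2 h1 h2]; split => //; first by rewrite h2.
    rewrite big_ord_recr addrA; apply: ready_upd r2 => //.
    exact: leq_trans kn n_leM.
  move=> k1 k1N.
  have b1 := Vterm_partial ga e k k1N; have b2 := rows_bound ga e k.
  have b3 : (k * (`|ga| * rowB) + `|ga| * rowB <= `|ga| * (n * rowB))%N.
    by rewrite -mulSnr mulnCA leq_mul2l leq_mul2r kn !orbT.
  move: b1 b2 b3 AM; move: (_ * rowB)%N (_ * (n * rowB))%N (k * _)%N => y1 y2 y3.
  move: (\sum_(j < k) _) (\sum_(j < k1) _) => z1 z2; clear; lia.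
Qed.

Lemma spec_terms s A l : ready s A -> (forall x, List.In x l -> small W (eterm x.1 x.2)) ->
  (`|A| + (\sum_(x <- l) `|x.1|) * (n * rowB) <= M)%N ->
  spec B (hterms r m u v w l) s (size l * (81 * unit_time) + 1)
    (fun s' => ready s' (A + \sum_(e <- l) e.1 * \sum_(x < n) rowN G e.2 x)).
Proof.
elim: l s A => [|[ga e] l IH] s A rs sl AM.
  by apply: spec_skip; rewrite big_nil addr0.
rewrite [size _]/= mulSn -addnA.
rewrite big_cons mulnDl /= in AM.
apply: (spec_seq (Q1 := fun s1 => ready s1 (A + \sum_(x < n) ga * rowN G e x))).
  apply: spec_term => //; first by apply: (sl (ga, e)); left.
  by apply: leq_trans AM; rewrite leq_add2l leq_addr.
move=> s1 r1; apply: spec_weaken (IH _ _ r1 _ _) => //.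
- by move=> s'; rewrite big_cons /= addrA mulr_sumr.
- by move=> x xl; apply: sl; right.
- apply: leq_trans AM; rewrite addnA leq_add2r.
  have := rows_bound ga e n; rewrite mulnCA.
  by move: (\sum_(j < n) _) (_ * (n * rowB))%N => z1 z2; clear; lia.
Qed.

(** * Initialisation and the whole program *)

Hypothesis m1 : (1 < m)%N.
Hypothesis LE : L = up_log m n.
Hypothesis Dc : (`|D| <= c)%N.
Hypothesis silt : small W (eilt (EReg rN)).
Hypothesis sinc : forall k e, (k = m%:Z \/ k = r%:Z \/ k = D) ->
  (e < nregs)%N -> small W (einc k (EReg e)).
Hypothesis smulr : forall k, (k <= 4)%N -> small W (ECst k%:Z * EReg rA)%X.
Hypothesis sincL : small W (EReg rL + EReg 19)%X.

(** Either the power has reached [n], or every round so far has increased the exponent. After [n]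
    rounds both cases give [n <= m ^ j]. *)
Definition Iinit (k : nat) (s : state) : Prop :=
  exists j, [/\ (j <= L)%N, (n <= m ^ j)%N \/ (k <= j)%N,
    [/\ bounded M s, reg s rn = n, reg s racc = 0 & cells s =1 cells (input G)],
    reg s rL = j & [/\ reg s rN = (m ^ j)%N, reg s rA = (r ^ j)%N & reg s rD = D ^+ j]].

Lemma powD_le j : (j <= L)%N -> (`|(D ^+ j)%R| <= M)%N.
Proof.
move=> jL; rewrite abszX; apply: (@leq_trans (c ^ j)).
  by case: (j) => // i; rewrite leq_exp2r.
by apply: cpow_le; apply: leq_trans jL _; rewrite leq_pmull.
Qed.

Lemma eval_einc s k e (j : nat) (b : bool) x : reg s 19%N = b%:R -> eval s e = x * k ^+ j ->
  eval s (einc k e) = x * k ^+ (j + b).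
Proof.
move=> h he; rewrite /= he h; case: b h => _ /=.
  by rewrite addn1 exprSr; ring.
by rewrite addn0; ring.
Qed.

Lemma L_leM : (L <= M)%N.
Proof. by apply: leq_trans NM; rewrite NE ltnW // ltn_expl. Qed.

Lemma spec_init_step k s1 : (k < n)%N -> Iinit k s1 ->
  spec B (Seq (hset 19 (eilt (EReg rN)))
     (Seq (hset rL (EReg rL + EReg 19)%X)
     (Seq (hset rN (einc m%:Z (EReg rN)))
     (Seq (hset rA (einc r%:Z (EReg rA)))
          (hset rD (einc D (EReg rD))))))) s1 (5 * W)
   (fun s2 => [/\ Iinit k.+1 s2, reg s2 15%N = reg s1 15%N & reg s2 16%N = reg s1 16%N]).
Proof.
move=> kn [j [jL jk [bs hn hacc hc] hL [hN hA hD]]].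
pose b := (m ^ j < n)%N.
have n0 : (0 < n)%N by apply: leq_ltn_trans kn.
(* An increment takes place only if [m ^ j < n <= m ^ L]. *)
have bL : (j + b <= L)%N.
  rewrite /b; case: (ltnP (m ^ j) n) => h; last by rewrite addn0.
  rewrite addn1 -(ltn_exp2l _ _ m1); apply: leq_trans h _.
  by rewrite LE up_logP.
have M1 : (1 <= M)%N by apply: ltnW.
have -> : (5 * W = W + (W + (W + (W + W))))%N by clear; lia.
pose t1 := upd_reg s1 19 b%:R.
apply: (spec_seq (Q1 := fun s2 => s2 = t1)) => [|_ ->].
  by apply: (spec_hset M2 MB) => //; rewrite (@eval_eilt s1 (EReg rN) _ n n0 hn hN).
have b1 : bounded M t1 by apply: bounded_upd => //; case: (b).
pose t2 := upd_reg t1 rL (j + b)%N.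
apply: (spec_seq (Q1 := fun s2 => s2 = t2)) => [|_ ->].
  by apply: (spec_hset M2 MB) => //; rewrite /= hL -natz -natrD natz.
have b2 : bounded M t2 by apply: bounded_upd => //; apply: leq_trans L_leM.
pose t3 := upd_reg t2 rN (m ^ (j + b))%N.
apply: (spec_seq (Q1 := fun s2 => s2 = t3)) => [|_ ->].
  apply: (spec_hset M2 MB) => //; first by apply: sinc => //; left.
  by rewrite (@eval_einc _ _ _ j b 1) //= ?hN mul1r ?Posz_exp // /t3 Posz_exp.
have b3 : bounded M t3 by apply: bounded_upd => //; apply: pow_leN.
pose t4 := upd_reg t3 rA (r ^ (j + b))%N.
apply: (spec_seq (Q1 := fun s2 => s2 = t4)) => [|_ ->].
  apply: (spec_hset M2 MB) => //; first by apply: sinc => //; right; left.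
  by rewrite (@eval_einc _ _ _ j b 1) //= ?hA mul1r ?Posz_exp // /t4 Posz_exp.
have b4 : bounded M t4.
  by apply: bounded_upd => //; apply: leq_trans (pow_leZ bL) ZleM.
apply: (spec_hset M2 MB) => //; first by apply: sinc => //; right; right.
rewrite (@eval_einc _ _ _ j b 1) //= ?hD ?mul1r //; split => //.
exists (j + b)%N; split => //.
- rewrite /b; case: (ltnP (m ^ j) n) => h; last by left; rewrite addn0.
  by case: jk => [h'|kj]; [rewrite leqNgt h in h' | right; rewrite addn1 ltnS].
- by split => //; apply: bounded_upd => //; apply: powD_le.
Qed.

Lemma spec_init : spec B (hinit r m D) (input G) (20 * W * n.+1) (fun s => ready s 0).
Proof.
have M1 : (1 <= M)%N by apply: ltnW.
have W0 : (0 < W)%N by case/andP: silt => _; apply: leq_trans; rewrite addnS.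
have s1C : small W (ECst 1).
  by case/andP: scopy => _ h; rewrite /small /=; apply: leq_trans h.
have srn : small W (EReg rn).
  by case/andP: scopy => _ h; rewrite /small /=; apply: leq_trans h.
have b0 : bounded M (input G).
  split => [x _ /=|a /=]; first by case: ifP => // _; exact: n_leM.
  by case: ifP.
apply: (@spec_weaken B _ _ (W + (W + (W + ((1 + 4 + n * (5 * W + 6)) + (W + (W + W))))))%N)
   => [|s' h|]; [clear -W0; nia | exact: h |].
pose t1 := upd_reg (input G) rN 1.
apply: (spec_seq (Q1 := fun s2 => s2 = t1)) => [|_ ->].
  exact: (spec_hset M2 MB).
have b1 : bounded M t1 by apply: bounded_upd.
pose t2 := upd_reg t1 rA 1.
apply: (spec_seq (Q1 := fun s2 => s2 = t2)) => [|_ ->].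
  exact: (spec_hset M2 MB).
have b2 : bounded M t2 by apply: bounded_upd.
pose t3 := upd_reg t2 rD 1.
apply: (spec_seq (Q1 := fun s2 => s2 = t3)) => [|_ ->].
  exact: (spec_hset M2 MB).
have b3 : bounded M t3 by apply: bounded_upd.
have Iupd k s (z : nat) y : (z == 15)%N || (z == 16)%N -> (`|y| <= M)%N -> Iinit k s ->
    Iinit k (upd_reg s z y).
  move=> hz yM [j [h1 h2 [h3 h4 h5 h6] h7 [h8 h9 h10]]].
  have ne (i : nat) : (i != 15)%N && (i != 16)%N -> (i == z) = false.
    by case/orP: hz => /eqP-> /andP[/negPf h /negPf h'].
  exists j; split => //=; rewrite ?ne //; split => //; rewrite ?ne //.
  exact: bounded_upd.
apply: (spec_seq (Q1 := fun s => Iinit n s)).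
  apply: (spec_for (n := n) (I := Iinit)) => //.
  - by apply: (small_ebounded M2 MB) => //; case/andP: srn => _; apply: leq_trans.
  - exact: (B_gt0 M2 MB).
  - apply: (Iupd) => //; apply: (Iupd) => //; first exact: n_leM.
    by exists 0%N; split => //; right.
  - move=> k s1 kn e1 e2 I1.
    apply: spec_weaken (spec_init_step kn I1) => // s2 [I2 h1 h2].
    split; [by rewrite h1 | by rewrite h2 |].
    by apply: Iupd => //; apply: leq_trans kn n_leM.
move=> s4 [j [jL jk [bs hn hacc hc] hL [hN hA hD]]].
have jE : j = L.
  apply/eqP; rewrite eqn_leq jL LE up_log_min //.
  by case: jk => // nj; apply: leq_trans nj _; rewrite ltnW // ltn_expl.
rewrite {}jE in hL hN hA hD; rewrite -NE in hN; rewrite -ZE in hA.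
have kZM k : (k <= 4)%N -> (k * Z <= M)%N.
  by move=> k4; apply: leq_trans ZM; rewrite leq_mul2r k4 orbT.
pose t5 := upd_reg s4 rB (2 * Z)%N.
apply: (spec_seq (Q1 := fun s2 => s2 = t5)) => [|_ ->].
  by apply: (spec_hset M2 MB) => //; [apply: smulr | rewrite /= hA -PoszM].
have b5 : bounded M t5 by apply: bounded_upd => //; apply: kZM.
pose t6 := upd_reg t5 rT (3 * Z)%N.
apply: (spec_seq (Q1 := fun s2 => s2 = t6)) => [|_ ->].
  by apply: (spec_hset M2 MB) => //; [apply: smulr | rewrite /= hA -PoszM].
have b6 : bounded M t6 by apply: bounded_upd => //; apply: kZM.
apply: (spec_hset M2 MB) => //; first by apply: smulr.
rewrite /= hA -PoszM; split => //.
- by apply: bounded_upd => //; apply: kZM.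
- by move=> x y xn yn; rewrite /= hc; apply: cells_input.
Qed.

Lemma spec_prog l (q a : int) :
  (forall x, List.In x l -> small W (eterm x.1 x.2)) ->
  ((\sum_(x <- l) `|x.1|) * (n * rowB) <= M)%N ->
  small W (EReg racc / ECst q)%X -> q != 0 ->
  \sum_(e <- l) e.1 * \sum_(x < n) rowN G e.2 x = q * a ->
  spec B (hprog r m D u v w l q) (input G) ((size l + 1) * (120 * unit_time))
    (fun s => reg s 0%N = a).
Proof.
move=> sl map_lim sq q0 E.
have W0 : (0 < W)%N by case/andP: silt => _; apply: leq_trans; rewrite addnS.
apply: (@spec_weaken B _ _ (20 * W * n.+1 + ((size l * (81 * unit_time) + 1) + W))%N)
   => [|s' h|]; [|exact: h|].
  have h1 : (W * n.+1 <= unit_time)%N.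
    by rewrite /unit_time -mulnA leq_pmulr.
  have h2 : (W <= W * n.+1)%N by rewrite leq_pmulr.
  by rewrite -mulnA; move: unit_time (W * n.+1)%N h1 h2 => y1 y2; clear -W0; nia.
apply: spec_seq spec_init _ => s1 r1.
apply: (spec_seq (spec_terms r1 sl _)) => [|s2 [bs _ _ hacc _]]; first by [].
apply: (spec_hset M2 MB) => //.
by rewrite /= hacc E add0r mulKz.
Qed.

End MM.

(** * From straight-line programs to bilinear algorithms *)

(* [N / E = a + b X + c X^2 + O(X^3)], provided [E.[0] != 0]. *)
Definition jet (N E : {poly rat}) (a b c : rat) : Prop :=
  exists Q, N = (a%:P + b%:P * 'X + c%:P * 'X^2) * E + Q * 'X^3.

Lemma jetD N1 E1 a1 b1 c1 N2 E2 a2 b2 c2 :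
  jet N1 E1 a1 b1 c1 -> jet N2 E2 a2 b2 c2 ->
  jet (N1 * E2 + N2 * E1) (E1 * E2) (a1 + a2) (b1 + b2) (c1 + c2).
Proof.
move=> [Q1 ->] [Q2 ->]; exists (Q1 * E2 + Q2 * E1).
rewrite !rmorphD /=; ring.
Qed.

Lemma jetN N E a b c : jet N E a b c -> jet (- N) E (- a) (- b) (- c).
Proof. by move=> [Q ->]; exists (- Q); rewrite !rmorphN /=; ring. Qed.

Lemma jetM N1 E1 a1 b1 c1 N2 E2 a2 b2 c2 :
  jet N1 E1 a1 b1 c1 -> jet N2 E2 a2 b2 c2 ->
  jet (N1 * N2) (E1 * E2) (a1 * a2) (a1 * b2 + b1 * a2)
      (a1 * c2 + b1 * b2 + c1 * a2).
Proof.
move=> [Q1 ->] [Q2 ->].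
exists ((b1%:P * c2%:P + c1%:P * b2%:P + c1%:P * c2%:P * 'X) * E1 * E2 +
  Q1 * (a2%:P + b2%:P * 'X + c2%:P * 'X^2) * E2 +
  Q2 * (a1%:P + b1%:P * 'X + c1%:P * 'X^2) * E1 + Q1 * Q2 * 'X^3).
rewrite !rmorphD !rmorphM /=; ring.
Qed.

(** The coefficients of the quotient are characterised by multiplying back with [a2], [b2], [c2],
    which avoids inverses in the statement. *)
Lemma jet_div N1 E1 N2 E2 a b c a2 b2 c2 :
  jet N1 E1 (a * a2) (a * b2 + b * a2) (a * c2 + b * b2 + c * a2) ->
  jet N2 E2 a2 b2 c2 -> jet (N1 * E2) (E1 * N2) a b c.
Proof.
move=> [Q1 ->] [Q2 ->].
exists (Q1 * E2 - (a%:P + b%:P * 'X + c%:P * 'X^2) * E1 * Q2 -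
  (b%:P * c2%:P + c%:P * b2%:P + c%:P * c2%:P * 'X) * E1 * E2).
rewrite !rmorphD !rmorphM /=; ring.
Qed.

Lemma jet0 N E a b c : jet N E a b c -> N.[0] = a * E.[0].
Proof. by move=> [Q ->]; rewrite !hornerE /=; ring. Qed.

Lemma poly_eq0_horner (p : {poly rat}) : (forall t, p.[t] = 0) -> p = 0.
Proof.
move=> p0; apply/eqP; apply/negPn/negP => pn0.
have := @max_poly_roots _ p [seq i%:R | i <- iota 0 (size p)] pn0.
rewrite size_map size_iota ltnn => h; suff : false by [].
apply: h; first by apply/allP => x _; rewrite /root p0.
by rewrite map_inj_uniq ?iota_uniq // => i j /eqP; rewrite eqr_nat => /eqP.
Qed.

(** The expansion minus [P X^2] gives a polynomial that vanishes everywhere, hence is 0. Its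
    coefficients in degrees 0, 1 and 2 yield [a = 0], [b = 0] and [c = P] in turn. *)
Lemma jet_quad N E a b c P : jet N E a b c -> E.[0] != 0 ->
  (forall t, P * t ^+ 2 * E.[t] = N.[t]) -> c = P.
Proof.
move=> [Q eN] E0 hN.
have : (a%:P + b%:P * 'X + (c - P)%:P * 'X^2) * E + Q * 'X^3 = 0.
  apply: poly_eq0_horner => t; have := hN t; rewrite eN !hornerE /= => h.
  by move: h; set et := E.[t]; set qt := Q.[t] => h; ring: h.
rewrite (_ : _ * E + _ = a%:P * E + (b%:P * E) * 'X^1 + ((c - P)%:P * E) * 'X^2
   + Q * 'X^3); last by ring.
move=> h.
have E00 : E`_0 != 0 by rewrite -horner_coef0.
have := congr1 (fun p : {poly rat} => p`_0) h.
rewrite !coefD !coefMXn !coefCM coef0 /= !addr0 => /eqP.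
rewrite mulf_eq0 (negPf E00) orbF => /eqP a0.
have := congr1 (fun p : {poly rat} => p`_1) h.
rewrite !coefD !coefMXn !coefCM coef0 /= a0 mul0r add0r !addr0 => /eqP.
rewrite mulf_eq0 (negPf E00) orbF => /eqP b0.
have := congr1 (fun p : {poly rat} => p`_2) h.
rewrite !coefD !coefMXn !coefCM coef0 /= a0 b0 !mul0r !add0r !addr0 => /eqP.
by rewrite mulf_eq0 (negPf E00) orbF subr_eq0 => /eqP.
Qed.

(** * Quadratic parts of the results of a straight-line program *)

Section Strassen.

Variable n : nat.

Definition lform : Type := ('M[rat]_n * 'M[rat]_n)%type.

Definition lin1 (F A : 'M[rat]_n) : rat := \sum_i \sum_j F i j * A i j.

Definition lin (F : lform) (A B : 'M[rat]_n) : rat := lin1 F.1 A + lin1 F.2 B.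

Lemma lin1D F G A : lin1 (F + G) A = lin1 F A + lin1 G A.
Proof.
rewrite -big_split /=; apply: eq_bigr => i _; rewrite -big_split /=.
by apply: eq_bigr => j _; rewrite mxE mulrDl.
Qed.

Lemma lin1Z c F A : lin1 (c *: F) A = c * lin1 F A.
Proof.
rewrite mulr_sumr; apply: eq_bigr => i _; rewrite mulr_sumr.
by apply: eq_bigr => j _; rewrite mxE mulrA.
Qed.

Lemma lin1_delta F i j : lin1 F (delta_mx i j) = F i j.
Proof.
rewrite /lin1 (bigD1 i) //= [X in _ + X]big1 ?addr0; last first.
  by move=> i' ne; apply: big1 => j' _; rewrite mxE (negPf ne) mulr0.
rewrite (bigD1 j) //= [X in _ + X]big1 ?addr0; last first.
  by move=> j' ne; rewrite mxE (negPf ne) andbF mulr0.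
by rewrite mxE !eqxx mulr1.
Qed.

Lemma lin1_delta_l i j A : lin1 (delta_mx i j) A = A i j.
Proof.
rewrite -[RHS]lin1_delta; apply: eq_bigr => i' _; apply: eq_bigr => j' _.
by rewrite mulrC.
Qed.

Lemma lin10 F : lin1 F 0 = 0.
Proof. by apply: big1 => i _; apply: big1 => j _; rewrite mxE mulr0. Qed.

Lemma lin0l A : lin1 0 A = 0.
Proof. by apply: big1 => i _; apply: big1 => j _; rewrite mxE mul0r. Qed.

Definition quad (Phi : seq (lform * lform)) (c : nat -> rat) (A B : 'M[rat]_n) : rat :=
  \sum_(l < size Phi) c l * (lin (nth (0, 0) Phi l).1 A B * lin (nth (0, 0) Phi l).2 A B).

(* [y] is a rational function, regular along every line through 0, whose
   quadratic part at 0 is a combination of the products in [Phi]. *)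
Definition good (Phi : seq (lform * lform)) (y : 'M[rat]_n -> 'M[rat]_n -> rat) : Prop :=
  exists a F c, forall A B, exists N E : {poly rat},
    [/\ forall t, E.[t] != 0, forall t, y (t *: A) (t *: B) * E.[t] = N.[t]
      & jet N E a (lin F A B) (quad Phi c A B)].

Lemma quad_rcons Phi x c A B : quad (rcons Phi x) c A B =
  quad Phi c A B + c (size Phi) * (lin x.1 A B * lin x.2 A B).
Proof.
rewrite /quad size_rcons big_ord_recr /= nth_rcons ltnn eqxx; congr (_ + _).
by apply: eq_bigr => l _; rewrite nth_rcons ltn_ord.
Qed.

Definition extend (k : nat) (c : nat -> rat) (e : rat) (l : nat) : rat :=
  if (l < k)%N then c l else e.

Lemma quad_ext Phi x c e A B : quad (rcons Phi x) (extend (size Phi) c e) A B =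
  quad Phi c A B + e * (lin x.1 A B * lin x.2 A B).
Proof.
rewrite quad_rcons /extend ltnn; congr (_ + _).
by apply: eq_bigr => l _; rewrite ltn_ord.
Qed.

Lemma quadD Phi c1 c2 A B :
  quad Phi (fun l => c1 l + c2 l) A B = quad Phi c1 A B + quad Phi c2 A B.
Proof. by rewrite -big_split; apply: eq_bigr => l _; rewrite mulrDl. Qed.

Lemma quadZ Phi a c A B : quad Phi (fun l => a * c l) A B = a * quad Phi c A B.
Proof. by rewrite /quad mulr_sumr; apply: eq_bigr => l _; rewrite -mulrA. Qed.

Lemma linD F G A B : lin (F + G) A B = lin F A B + lin G A B.
Proof. by rewrite /lin /= !lin1D; ring. Qed.

Lemma linZ c F A B : lin (c *: F) A B = c * lin F A B.
Proof. by rewrite /lin /= !lin1Z; ring. Qed.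

Lemma good_ext Phi x y : good Phi y -> good (rcons Phi x) y.
Proof.
move=> [a [F [c h]]]; exists a, F, (extend (size Phi) c 0) => A B.
by have [N [E [h1 h2 h3]]] := h A B; exists N, E; rewrite quad_ext mul0r addr0.
Qed.

Lemma good_const Phi k : good Phi (fun _ _ => k).
Proof.
exists k, 0, (fun=> 0) => A B; exists k%:P, 1; split.
- by move=> t; rewrite hornerE oner_neq0.
- by move=> t; rewrite !hornerE.
- exists 0; rewrite /lin !lin0l addr0 /quad big1 => [|l _]; last by rewrite mul0r.
  by rewrite !mul0r !addr0 mulr1.
Qed.

Lemma good_var Phi (x : mx_index n) : good Phi (fun A B => mx_entries A B x).
Proof.
exists 0, (match x with inl e => (delta_mx e.1 e.2, 0) | inr e => (0, delta_mx e.1 e.2) end),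
  (fun=> 0) => A B; exists ((mx_entries A B x)%:P * 'X), 1; split.
- by move=> t; rewrite hornerE oner_neq0.
- by move=> t; rewrite !hornerE; case: x => e; rewrite /= mxE mulrC.
- exists 0; rewrite /quad big1 => [|l _]; last by rewrite mul0r.
  rewrite /lin !mul0r !addr0 add0r mulr1; case: x => e /=;
  by rewrite lin0l lin1_delta_l ?addr0 ?add0r.
Qed.

Lemma good_add Phi y1 y2 : good Phi y1 -> good Phi y2 ->
  good Phi (fun A B => y1 A B + y2 A B).
Proof.
move=> [a1 [F1 [c1 h1]]] [a2 [F2 [c2 h2]]].
exists (a1 + a2), (F1 + F2), (fun l => c1 l + c2 l) => A B.
have [N1 [E1 [n1 v1 j1]]] := h1 A B; have [N2 [E2 [n2 v2 j2]]] := h2 A B.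
exists (N1 * E2 + N2 * E1), (E1 * E2); split.
- by move=> t; rewrite hornerM mulf_neq0.
- by move=> t /=; rewrite !(hornerD, hornerM) -v1 -v2; ring.
- by rewrite linD quadD; apply: jetD.
Qed.

Lemma good_opp Phi y : good Phi y -> good Phi (fun A B => - y A B).
Proof.
move=> [a [F [c h]]]; exists (- a), (-1 *: F), (fun l => -1 * c l) => A B.
have [N [E [n1 v1 j1]]] := h A B; exists (- N), E; split => //.
- by move=> t /=; rewrite hornerN -v1; ring.
- by rewrite linZ quadZ !mulN1r; apply: jetN.
Qed.

(** The quadratic part of a product is a combination of the old quadratic parts plus the product of
    the two linear parts, and only the latter is new. *)
Lemma good_mul Phi y1 y2 : good Phi y1 -> good Phi y2 ->
  exists x, good (rcons Phi x) (fun A B => y1 A B * y2 A B).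
Proof.
move=> [a1 [F1 [c1 h1]]] [a2 [F2 [c2 h2]]]; exists (F1, F2).
exists (a1 * a2), (a1 *: F2 + a2 *: F1),
  (extend (size Phi) (fun l => a1 * c2 l + a2 * c1 l) 1) => A B.
have [N1 [E1 [n1 v1 j1]]] := h1 A B; have [N2 [E2 [n2 v2 j2]]] := h2 A B.
exists (N1 * N2), (E1 * E2); split.
- by move=> t; rewrite hornerM mulf_neq0.
- by move=> t /=; rewrite !(hornerD, hornerM) -v1 -v2; ring.
- rewrite linD !linZ quad_ext quadD !quadZ mul1r /=.
  have := jetM j1 j2; congr (jet _ _ _ _ _); ring.
Qed.

(** Solve [y * y2 = y1] degree by degree: the only new product is that of the linear parts of [y]
    and [y2]. Dividing by [a2], the value of [y2] at 0, is possible because [y2] never vanishes. *)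
Lemma good_div Phi y1 y2 : good Phi y1 -> good Phi y2 ->
  (forall A B, y2 A B != 0) ->
  exists x, good (rcons Phi x) (fun A B => y1 A B / y2 A B).
Proof.
move=> [a1 [F1 [c1 h1]]] [a2 [F2 [c2 h2]]] nz.
have a2n0 : a2 != 0.
  have [N2 [E2 [n2 v2 j2]]] := h2 0 0.
  have : N2.[0] != 0 by rewrite -v2 mulf_neq0.
  by rewrite (jet0 j2) mulf_eq0 negb_or => /andP[].
pose a := a1 / a2; pose F := a2^-1 *: (F1 + (- a) *: F2); exists (F, F2).
exists a, F, (extend (size Phi) (fun l => a2^-1 * (c1 l + (- a) * c2 l)) (- a2^-1)) => A B.
have [N1 [E1 [n1 v1 j1]]] := h1 A B; have [N2 [E2 [n2 v2 j2]]] := h2 A B.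
exists (N1 * E2), (E1 * N2); split.
- by move=> t; rewrite hornerM -v2 !mulf_neq0.
- move=> t /=; rewrite !hornerM -v1 -v2.
  move: (nz (t *: A) (t *: B)); move: (y1 _ _) (y2 _ _) E1.[t] E2.[t].
  by move=> p q e1 e2 q0; field.
- rewrite quad_ext (quadZ Phi a2^-1 (fun l => c1 l + - a * c2 l)).
  rewrite (quadD Phi c1 (fun l => - a * c2 l)) (quadZ Phi (- a) c2).
  apply: (@jet_div N1 E1 N2 E2 _ _ _ a2 (lin F2 A B) (quad Phi c2 A B)); last exact: j2.
  move: j1; rewrite [(F, F2).1]/= [(F, F2).2]/= /F linZ linD linZ.
  move: (quad _ c1 _ _) (quad _ c2 _ _) (lin F1 _ _) (lin F2 _ _) => q1 q2 l1 l2.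
  rewrite /a; congr (jet _ _ _ _ _); field; exact: a2n0.
Qed.

Lemma good_arg Phi ys (x : slp_arg rat (mx_index n)) :
  (forall y, List.In y ys -> good Phi y) ->
  good Phi (fun A B => slp_arg_val (mx_entries A B) [seq y A B | y <- ys] x).
Proof.
move=> gys; case: x => [x|k|j] /=; [exact: good_var | exact: good_const |].
elim: ys j gys => [|y ys IH] [|j] gys /=; try exact: good_const.
- by apply: gys; left.
- by apply: IH => z hz; apply: gys; right.
Qed.

(** The results are kept as functions of the input matrices; that the run succeeds on all inputs
    makes every divisor a function without zeros. *)
Lemma slp_good (p : slp rat (mx_index n)) Phi ys :
  (forall y, List.In y ys -> good Phi y) ->
  (forall A B, exists vs, slp_run (mx_entries A B) p [seq y A B | y <- ys] = Some vs) ->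
  exists Phi' ys', [/\ size Phi' = (size Phi + size p)%N,
    forall y, List.In y ys' -> good Phi' y &
    forall A B, slp_run (mx_entries A B) p [seq y A B | y <- ys] =
                Some [seq y A B | y <- ys']].
Proof.
elim: p Phi ys => [|[[op x1] x2] p IH] Phi ys gys run.
  by exists Phi, ys; rewrite addn0.
have g1 := good_arg x1 gys; have g2 := good_arg x2 gys.
set y1 := (fun A B => _) in g1; set y2 := (fun A B => _) in g2.
pose y A B := match op with FAdd => y1 A B + y2 A B | FSub => y1 A B - y2 A B
  | FMul => y1 A B * y2 A B | FDiv => y1 A B / y2 A B end.
have valE A B : field_op_val op (y1 A B) (y2 A B) = Some (y A B).
  rewrite /y; have [vs] := run A B; rewrite /= -/(y1 A B) -/(y2 A B).
  by case: (op) => //=; case: eqP.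
have [x gy] : exists x, good (rcons Phi x) y.
  rewrite /y; case: (op) valE => valE.
  (* Additive operations create no product; a dummy keeps the size of [Phi] in step with the
     program. *)
  - by exists (0, 0); apply: good_ext; apply: good_add.
  - by exists (0, 0); apply: good_ext; apply: good_add => //; apply: good_opp.
  - exact: good_mul.
  - apply: good_div => // A B; have := valE A B; rewrite /=.
    by case: eqP.
have mapE A B : [seq z A B | z <- rcons ys y] = rcons [seq z A B | z <- ys] (y A B).
  by rewrite map_rcons.
have stepE A B : slp_run (mx_entries A B) ((op, x1, x2) :: p) [seq z A B | z <- ys] =
  slp_run (mx_entries A B) p [seq z A B | z <- rcons ys y].
  by rewrite mapE /= -/(y1 A B) -/(y2 A B) valE.
have [||Phi' [ys' [sz gys' runE]]] := IH (rcons Phi x) (rcons ys y).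
- move=> z; rewrite -cats1 => hz.
  have [hz'|[<-//|[]]] := List.in_app_or _ _ _ hz.
  by apply: good_ext; apply: gys.
- by move=> A B; have [vs] := run A B; rewrite stepE; exists vs.
exists Phi', ys'; split => //; first by rewrite sz size_rcons addSnnS.
by move=> A B; rewrite stepE.
Qed.

End Strassen.

(** On the line [t (A, B)] an entry of the product is [t ^ 2] times the entry of [A *m B], so
    [jet_quad] identifies the latter with the quadratic part. *)
Lemma slp_quad n (p : slp rat (mx_index n)) out : multiplies p out ->
  exists (Phi : seq (lform n * lform n)) (c : 'I_n -> 'I_n -> nat -> rat),
    size Phi = size p /\ forall i j A B, quad Phi (c i j) A B = (A *m B) i j.
Proof.
move=> mul.
have [||Phi [ys [sz gys runE]]] := @slp_good n p [::] [::].
- by [].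
- by move=> A B; have [vs [h _]] := mul A B; exists vs.
have H i j : exists c, forall A B, quad Phi c A B = (A *m B) i j.
  have [a [F [c h]]] := good_arg (out i j) gys; exists c => A B.
  have [N [E [nz v1 jt]]] := h A B; apply: jet_quad jt (nz 0) _ => t.
  rewrite -v1; congr (_ * _).
  have [vs [h1 h2]] := mul (t *: A) (t *: B); have := h2 i j.
  have := runE (t *: A) (t *: B); rewrite /= in h1 *; rewrite h1 => -[<-] ->.
  by rewrite -scalemxAl -scalemxAr scalerA [RHS]mxE mulrC expr2.
have [c hc] := fin_all_exists (fun i => fin_all_exists (H i)).
by exists Phi, c.
Qed.

Lemma mul_delta_mxE n (i j k l : 'I_n) : forall a b,
  (delta_mx i j *m delta_mx k l : 'M[rat]_n) a b =
  ((i == a) && (k == j) && (l == b))%:R.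
Proof.
move=> a b; rewrite mul_delta_mx_cond; case: (j =P k) => [->|ne].
  by rewrite mulr1n mxE eqxx andbT [i == a]eq_sym [l == b]eq_sym.
by rewrite mulr0n mxE; have [kj|_] := eqVneq k j; [case: ne | rewrite andbF].
Qed.

Definition natfun (m : nat) (F : 'I_m -> 'I_m -> int) (i j : nat) : int :=
  if insub i is Some i' then if insub j is Some j' then F i' j' else 0 else 0.

Lemma natfunE m F (i j : 'I_m) : natfun F i j = F i j.
Proof. by rewrite /natfun !valK. Qed.

Lemma common_denominator (T : finType) (f : T -> rat) :
  exists (d : int) (g : T -> int), d != 0 /\ forall x, f x * d%:~R = (g x)%:~R.
Proof.
exists (\prod_y denq (f y)), (fun x => numq (f x) * \prod_(y | y != x) denq (f y)).
split; first by apply/prodf_neq0 => y _; exact: denq_neq0.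
move=> x; rewrite (bigD1 x) //= !intrM mulrA; congr (_ * _).
by rewrite -{1}(divq_num_den (f x)) mulfVK // intr_eq0 denq_neq0.
Qed.

Lemma slp_bilinear_alg n (p : slp rat (mx_index n)) out : multiplies p out ->
  exists D u v w, D != 0 /\ bilinear_alg n (2 * size p) D u v w.
Proof.
move=> /slp_quad[Phi [c [sz hq]]].
pose s := size Phi.
pose x0 : lform n := 0.
pose P l := (nth (x0, x0) Phi l).1; pose P' l := (nth (x0, x0) Phi l).2.
(* Each product of two forms in [(A, B)] contributes two bilinear products: the [A] part of either
   form times the [B] part of the other. *)
pose U (l : nat) (a b : 'I_n) := if (l < s)%N then (P l).1 a b else (P' (l - s)%N).1 a b.
pose V (l : nat) (a b : 'I_n) := if (l < s)%N then (P' l).2 a b else (P (l - s)%N).2 a b.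
pose X (l : nat) (a b : 'I_n) := if (l < s)%N then c a b l else c a b (l - s)%N.
have dec a b a' k k' b' : \sum_(l < s + s) X l a b * (U l a' k * V l k' b') =
    ((a' == a) && (k' == k) && (b' == b))%:R.
  rewrite -mul_delta_mxE -hq.
  (* What is not mixed in a product of forms is its value at [(A, 0)] plus that at [(0, B)], and
     there the matrix product vanishes. *)
  have q1 : quad Phi (c a b) (delta_mx a' k) 0 = 0 by rewrite hq mulmx0 mxE.
  have q2 : quad Phi (c a b) 0 (delta_mx k' b') = 0 by rewrite hq mul0mx mxE.
  suff -> : quad Phi (c a b) (delta_mx a' k) (delta_mx k' b') =
      \sum_(l < s + s) X l a b * (U l a' k * V l k' b') +
      quad Phi (c a b) (delta_mx a' k) 0 + quad Phi (c a b) 0 (delta_mx k' b').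
    by rewrite q1 q2 !addr0.
  rewrite big_split_ord /= /quad -!big_split /=; apply: eq_bigr => l _.
  rewrite /X /U /V ltn_ord ltnNge leq_addr /= addKn /lin !lin10 !lin1_delta.
  by rewrite -/(P l) -/(P' l); ring.
pose T := ('I_(s + s) * 'I_n * 'I_n)%type.
have [d1 [g1 [d1n h1]]] := common_denominator (fun x : T => U x.1.1 x.1.2 x.2).
have [d2 [g2 [d2n h2]]] := common_denominator (fun x : T => V x.1.1 x.1.2 x.2).
have [d3 [g3 [d3n h3]]] := common_denominator (fun x : T => X x.1.1 x.1.2 x.2).
pose lift (g : T -> int) (l : nat) : nat -> nat -> int :=
  if insub l is Some l' then natfun (fun i j => g (l', i, j)) else fun _ _ => 0.
have liftE g (l : 'I_(s + s)) (i j : 'I_n) : lift g l i j = g (l, i, j).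
  by rewrite /lift valK natfunE.
exists (d1 * d2 * d3), (lift g1), (lift g2), (lift g3); split.
  by rewrite !mulf_neq0.
rewrite mul2n -addnn -sz -/s => a b a' k k' b'.
apply/eqP; rewrite -(eqr_int rat); apply/eqP.
rewrite rmorph_sum /= intrM.
have -> : (((a' == a) && (k' == k) && (b' == b))%:R : int)%:~R =
    \sum_(l < s + s) X l a b * (U l a' k * V l k' b').
  by rewrite dec; case: (_ && _).
rewrite mulr_sumr; apply: eq_bigr => l _.
rewrite !liftE !intrM -(h1 (l, a', k)) -(h2 (l, k', b')) -(h3 (l, a, b)) /=.
ring.
Qed.

(** With the inner indices fixed at 0, dividing by [D] factors the identity matrix of size [m * m]
    through dimension [r]. This bound is what makes the arrays fit, in [size_le]. *)
Lemma bilinear_alg_rank m r D u v w : (0 < m)%N -> D != 0 -> bilinear_alg m r D u v w ->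
  (m * m <= r)%N.
Proof.
case: m => // m _ D0 dec.
pose T : finType := ('I_m.+1 * 'I_m.+1)%type.
pose ev (x : 'I_#|{: T}|) : 'I_m.+1 * 'I_m.+1 := enum_val x.
pose A : 'M[rat]_(#|{: T}|, r) :=
  \matrix_(x, l) ((w l (ev x).1 (ev x).2)%:~R / D%:~R).
pose C : 'M[rat]_(r, #|{: T}|) :=
  \matrix_(l, x) ((u l (ev x).1 0%N * v l 0%N (ev x).2)%:~R).
have : A *m C = 1%:M.
  apply/matrixP => x y; rewrite !mxE.
  transitivity ((\sum_(l < r) w l (ev x).1 (ev x).2 *
     (u l (ev y).1 0%N * v l 0%N (ev y).2))%:~R / D%:~R : rat).
    rewrite rmorph_sum /= mulr_suml; apply: eq_bigr => l _.
    by rewrite !mxE [in RHS]intrM mulrAC.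
  have := dec (ev x).1 (ev x).2 (ev y).1 0 0 (ev y).2.
  move=> ->; rewrite eqxx andbT intrM mulrC mulKf ?intr_eq0 //.
  rewrite -xpair_eqE -!surjective_pairing (inj_eq (@enum_val_inj _ _)) eq_sym.
  by case: (x == y).
move/mulmx1_min; rewrite card_prod card_ord //.
Qed.

(** * The exponent *)

Lemma eq_sum_In (T : Type) (l : seq T) (f g : T -> int) :
  (forall x, List.In x l -> f x = g x) -> \sum_(x <- l) f x = \sum_(x <- l) g x.
Proof.
elim: l => [|x l IH] h; first by rewrite !big_nil.
by rewrite !big_cons h ?IH //; [move=> y yl; apply: h; right | left].
Qed.

Lemma leq_sum_In (T : Type) (l : seq T) (f : T -> nat) x : List.In x l ->
  (f x <= \sum_(y <- l) f y)%N.
Proof.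
elim: l => [|y l IH] //=; rewrite big_cons => -[->|/IH h]; first exact: leq_addr.
exact: leq_trans h (leq_addl _ _).
Qed.

(** All but one of the factors [m] have a product below [n], and the last one is below [2 ^ m]. *)
Lemma up_log_pow_le m n : (1 < m)%N -> (m ^ up_log m n <= n.+2 ^ m.+1)%N.
Proof.
move=> m1; have [->|L0] := posnP (up_log m n).
  by rewrite expn0 expn_gt0.
have n1 : (1 < n)%N by move: L0; rewrite up_log_gt0 => /andP[].
have h := up_log_gtn m1 n1.
rewrite -(prednK L0) !expnS mulnC; apply: leq_mul.
  by apply: leq_trans (ltnW h) _; rewrite -addn2 leq_addr.
apply: ltnW; apply: leq_trans (ltn_expl m (isT : 1 < 2)%N) _.
by case: (m) => // k; rewrite leq_exp2r.
Qed.

(** Since [k < m ^ k], a constant to the power [L] is polynomial in [m ^ L]. *)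
Lemma expn_swap_le (m k L : nat) : (1 < m)%N -> (k ^ L <= (m ^ L) ^ k)%N.
Proof.
move=> m1; rewrite -expnM mulnC expnM.
by case: L => // L; rewrite leq_exp2r // ltnW // ltn_expl.
Qed.

Lemma leq_expl (k X : nat) : (1 < X)%N -> (k <= X ^ k)%N.
Proof. by move=> X1; rewrite ltnW // ltn_expl. Qed.

Lemma ewf_earc b e e' : ewf (earc b e e') = ewf e && ewf e'.
Proof. by case: b; rewrite /= !andbT // andbC. Qed.

Ltac in_list := simpl; repeat first [left; reflexivity | right].

Lemma count_alg (m r : nat) (D : int) u v w (T : tournament 5) :
  (1 < m)%N -> D != 0 -> bilinear_alg m r D u v w ->
  exists (P : cmd) (w0 K0 : nat), forall (n : nat) (G : tournament n),
    exists (s : state) (t : nat),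
    [/\ exec (n.+2 ^ w0) P (input G) s t,
        (t <= K0 * (n.+1 * (up_log m n).+1 * (r ^ up_log m n).+1))%N
      & reg s 0 = (copies T G)%:Z].
Proof.
move=> m1 D0 dec.
have m0 : (0 < m)%N by apply: ltnW.
have mr : (m * m <= r)%N by apply: bilinear_alg_rank dec.
have [l [lt lE]] := emb_span (garcP T).
pose q : int := (2 * #|autos T|)%N.
have q0 : q != 0 by rewrite eqz_nat muln_eq0 /= -lt0n autos_gt0.
pose cc (t : nat -> nat -> nat -> int) := (\sum_(l < r) \sum_(i < m) \sum_(j < m) `|t l i j|)%N.
pose c := (cc u + cc v + cc w + `|D|).+1.
(* One [W] must serve all expressions of the program, so their weights are added up. Patterns and
   register numbers do not change a weight, so [eA], [eB] and [einc] are listed for one choice of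
   them. *)
pose es0 := [:: ecopy; edot; edown rA r m u; edown rB r m v; eup rA r m w;
  (eQ / ECst m%:Z)%X; (eQ * ECst m%:Z)%X; (EReg rs * ECst r%:Z * (eQ * eQ))%X;
  (EReg rs * ((eQ * ECst m%:Z) * (eQ * ECst m%:Z)))%X; (EReg rs * ECst r%:Z)%X;
  (EReg rs / ECst r%:Z)%X; eA (true, true, true); eB (true, true, true);
  eilt (EReg rN); einc m%:Z (EReg rn); einc r%:Z (EReg rn); einc D (EReg rn);
  (EReg rL + EReg 19)%X; (EReg racc / ECst q)%X].
pose es := es0 ++ [seq eterm x.1 x.2 | x <- l].
pose W := (20 + \sum_(e <- es) weight e)%N.
have smallI e : ewf e -> List.In e es -> small W e.
  move=> we /(leq_sum_In weight) h; rewrite /small we /= /W; clear -h; lia.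
pose Gam := (\sum_(x <- l) `|x.1|)%N.
(* One summand for each of the bounds [M2], [NM], [ZM], [cM] and [GM] below. [M = X ^ w1] bounds the
   stored values, and [M ^ W] everything written. *)
pose w1 := (1 + m.+1 + (3 + m.+1 * r) + m.+1 * c * 3 + (Gam + (2 * m.+1 + 4)))%N.
exists (hprog r m D u v w l q), (w1 * W)%N, ((size l + 1) * (120 * W))%N => n G.
pose L := up_log m n; pose X := n.+2; pose M := (X ^ w1)%N.
have X1 : (1 < X)%N by [].
have leX a b : (a <= b)%N -> (X ^ a <= X ^ b)%N by rewrite leq_exp2l.
have NX : (m ^ L <= X ^ m.+1)%N by apply: up_log_pow_le.
have powX k : (k ^ L <= X ^ (m.+1 * k))%N.
  apply: leq_trans (expn_swap_le k L m1) _; rewrite expnM.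
  by case: (k) => // k'; rewrite leq_exp2r.
have M2 : (2 <= M)%N.
  by apply: leq_trans (leX 1 w1 _); rewrite ?expn1 // /w1 -!addnA.
have NM : (m ^ L <= M)%N.
  by apply: leq_trans NX (leX _ _ _); rewrite /w1; clear; lia.
have ZM : (4 * r ^ L <= M)%N.
  apply: (@leq_trans (X ^ 3 * X ^ (m.+1 * r))).
    apply: leq_mul (powX r); apply: (@leq_trans (2 ^ 3)) => //.
    by rewrite leq_exp2r.
  by rewrite -expnD; apply: leX; rewrite /w1; clear; lia.
have cM : (c ^ (3 * L) <= M)%N.
  apply: (@leq_trans (X ^ (m.+1 * c * 3))).
    by rewrite mulnC !expnM leq_exp2r // -!expnM.
  by apply: leX; rewrite /w1; clear; lia.
have nX : (n <= X ^ 1)%N by rewrite expn1 /X -addn2 leq_addr.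
have GM : (Gam * (n * rowB (m ^ L) n) <= M)%N.
  apply: (@leq_trans (X ^ Gam * (X ^ 1 * (X ^ m.+1 * X ^ m.+1 * (X ^ 1 * (X ^ 1 * X ^ 1)))))).
    by rewrite /rowB; do !apply: leq_mul => //; apply: leq_expl.
  by rewrite -!expnD; apply: leX; rewrite /w1; clear; lia.
have nN : (n <= m ^ L)%N by apply: up_logP.
have ccP (t : nat -> nat -> nat -> int) : forall l, (l < r)%N ->
    (\sum_(i < m) \sum_(j < m) `|t l i j| <= cc t)%N.
  by move=> i ir; rewrite /cc (bigD1 (Ordinal ir)) //= leq_addr.
have sterm x : List.In x l -> small W (eterm x.1 x.2).
  move=> xl; apply: smallI; last first.
    rewrite /es; apply/(List.in_or_app es0 [seq eterm y.1 y.2 | y <- l]); right.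
    by apply/List.in_map_iff; exists x.
  by rewrite /= !ewf_earc.
have in_es e : List.In e es0 -> List.In e es.
  by move=> h; apply: (List.in_or_app es0 [seq eterm y.1 y.2 | y <- l]); left.
have s1 : small W ecopy by apply: smallI => //; apply: in_es; in_list.
have s2 : small W edot by apply: smallI => //; apply: in_es; in_list.
have s3 : small W (edown rA r m u).
  by apply: smallI; [exact: ewf_edown | apply: in_es; in_list].
have s4 : small W (edown rB r m v).
  by apply: smallI; [exact: ewf_edown | apply: in_es; in_list].
have s5 : small W (eup rA r m w).
  by apply: smallI; [exact: ewf_eup | apply: in_es; in_list].
have s6 : small W (eQ / ECst m%:Z)%X.
  by apply: smallI => //; apply: in_es; in_list.
have s7 : small W (eQ * ECst m%:Z)%X.
  by apply: smallI => //; apply: in_es; in_list.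
have s8 : small W (EReg rs * ECst r%:Z * (eQ * eQ))%X.
  by apply: smallI => //; apply: in_es; in_list.
have s9 : small W (EReg rs * ((eQ * ECst m%:Z) * (eQ * ECst m%:Z)))%X.
  by apply: smallI => //; apply: in_es; in_list.
have s10 : small W (EReg rs * ECst r%:Z)%X.
  by apply: smallI => //; apply: in_es; in_list.
have s11 : small W (EReg rs / ECst r%:Z)%X.
  by apply: smallI => //; apply: in_es; in_list.
have s12 a : small W (eA a).
  have : small W (eA (true, true, true)).
    by apply: smallI => //; apply: in_es; in_list.
  by case: a => [[[] []] []].
have s13 a : small W (eB a).
  have : small W (eB (true, true, true)).
    by apply: smallI => //; apply: in_es; in_list.
  by case: a => [[[] []] []].
have s14 : small W (eilt (EReg rN)).
  by apply: smallI => //; apply: in_es; in_list.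
have s15 k e : k = m%:Z \/ k = r%:Z \/ k = D -> (e < nregs)%N -> small W (einc k (EReg e)).
  move=> hk eK; have : small W (einc k (EReg rn)).
    apply: smallI => //; apply: in_es.
    by case: hk => [->|[->|->]]; in_list.
  by rewrite /small /= eK.
have s16 : small W (EReg rL + EReg 19)%X.
  by apply: smallI => //; apply: in_es; in_list.
have s17 : small W (EReg racc / ECst q)%X.
  by apply: smallI => //; apply: in_es; in_list.
have s18 k : (k <= 4)%N -> small W (ECst k%:Z * EReg rA)%X.
  by move=> k4; rewrite /small /= /W; clear -k4; lia.
have sp : spec (M ^ W) (hprog r m D u v w l q) (input G)
    ((size l + 1) * (120 * unit_time W L (r ^ L) n)) (fun s => reg s 0%N = copies T G).
  apply: (@spec_prog (M ^ W) M W M2 (leqnn _) m r c L (m ^ L) (r ^ L) D u v w) => //.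
  - move=> i ir; apply: leq_trans (ccP u i ir) _; rewrite /c; clear; lia.
  - move=> i ir; apply: leq_trans (ccP v i ir) _; rewrite /c; clear; lia.
  - move=> i j im jm; apply: (@leq_trans (cc w)); last by rewrite /c; clear; lia.
    apply: leq_sum => k _; rewrite (bigD1 (Ordinal im)) //= (bigD1 (Ordinal jm)) //=.
    by rewrite -addnA leq_addr.
  - by rewrite /c; clear; lia.
  - transitivity (\sum_(e <- l) e.1 * (emb_minus v3 v4 e.2 (garc G))%:Z).
      by apply: eq_sum_In => x xl; rewrite (emb_minus_rowN _ (lt x xl)).
    rewrite -lE ?emb_copies; last exact: garcP.
    by rewrite /q -PoszM mulnA mulnAC.
have [s' [t [s'' [ex le [ag _] rE]]]] := sp (input G) (conj (fun _ _ => erefl) (fun _ => erefl)).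
exists s', t; split.
- by rewrite expnM.
- by apply: leq_trans le _; rewrite /unit_time -!mulnA.
- by rewrite -ag.
Qed.

Lemma big_O_powP (R : realType) (f : nat -> nat) (t : R) : big_O_pow f t <->
  exists (C : R) (n0 : nat), 0 < C /\
    forall n, (n0 <= n)%N -> (f n)%:R <= C * n%:R `^ t.
Proof.
rewrite /big_O_pow; split.
  move/eqO_exP => [C C0 [n0 _ h]]; exists C, n0; split => // n nn0.
  by have := h n nn0; rewrite /= !ger0_norm ?powR_ge0.
move=> [C [n0 [C0 h]]]; apply/eqO_exP; exists C => //; exists n0 => // n /= nn0.
by rewrite !ger0_norm ?powR_ge0 // h.
Qed.

(** The factor [L.+1 <= 2 ^ L] is absorbed by doubling [r]. One level is split off because only
    [m ^ (L - 1)] is below [n]. *)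
Lemma time_bound_nat (K0 r L n : nat) : (0 < L)%N -> (0 < r)%N -> (0 < n)%N ->
  (K0 * (n.+1 * L.+1 * (r ^ L).+1) <= 8 * K0 * r * (n * (2 * r) ^ L.-1))%N.
Proof.
move=> L0 r0 n0.
have -> : (8 * K0 * r * (n * (2 * r) ^ L.-1) = K0 * ((2 * n) * 2 ^ L * (2 * r ^ L)))%N.
  by rewrite expnMn; case: L L0 => // L _; rewrite /= !expnS; ring.
rewrite leq_mul2l; apply/orP; right; apply: leq_mul; first apply: leq_mul.
- by clear -n0; lia.
- exact: ltn_expl.
- have : (0 < r ^ L)%N by rewrite expn_gt0 r0.
  by move: (r ^ L)%N => y; clear; lia.
Qed.

Lemma count_time_mem (R : realType) (T : tournament 5) (t e : R) :
  mx_mul_time R rat t -> 0 < e -> count_time R T (t + 1 + e).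
Proof.
move=> [f [hf /big_O_powP[C [n0 [C0 hC]]]]] e0.
(* Chosen so that [2 r = 4 size p <= 4 C m ^ t <= m ^ (t + e)]. The 4 comes from the two mixed parts
   of a product and from the doubling in [time_bound_nat]. *)
pose y : R := (4 * C) `^ e^-1.
pose m := maxn (Num.bound y) (maxn n0 2).
have m1 : (1 < m)%N by rewrite /m !leq_max /= !orbT.
have mn0 : (n0 <= m)%N by rewrite /m !leq_max leqnn /= orbT.
have my : y <= m%:R.
  apply: le_trans (ltW (archi_boundP (powR_ge0 _ _))) _.
  by rewrite ler_nat leq_max leqnn.
have Cm : 4 * C <= m%:R `^ e.
  have <- : y `^ e = 4 * C.
    by rewrite /y -powRrM mulVf ?gt_eqF // powRr1 // mulr_ge0 // ltW.
  by apply: ge0_ler_powR => //; rewrite ?nnegrE ?powR_ge0 // ltW.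
have [p [out [mul sz]]] := hf m.
have [D [u [v [w [D0 dec]]]]] := slp_bilinear_alg mul.
set r := (2 * size p)%N in dec.
have mr : (m * m <= r)%N by apply: bilinear_alg_rank dec => //; apply: ltnW.
have r4 : (1 < r)%N by apply: leq_trans mr; clear -m1; nia.
have mpos : (0 : R) < m%:R by rewrite ltr0n ltnW.
have rm : (2 * r)%N%:R <= m%:R `^ (t + e).
  rewrite powRD; last by rewrite (gt_eqF mpos) implybT.
  apply: le_trans (ler_wpM2l (powR_ge0 _ _) Cm).
  apply: (@le_trans _ _ (4 * (f m)%:R)).
    by rewrite -natrM ler_nat /r mulnA leq_mul2l sz orbT.
  by rewrite [leRHS]mulrCA ler_pM2l // mulrC hC.
(* Needed for [x ^ (t + e)] to be monotone in [x]; a negative exponent would give [2 r <= 1]. *)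
have a0 : 0 <= t + e.
  rewrite leNgt; apply/negP => a0.
  have : m%:R `^ (t + e) <= m%:R `^ 0 :> R.
    by apply: ler_powR; [rewrite ler1n ltnW | exact: ltW].
  rewrite powRr0 => h; have := le_trans rm h; rewrite lern1.
  by clear -r4; lia.
have [P [w0 [K0 hP]]] := count_alg T m1 D0 dec.
exists P, w0, (fun n => K0 * (n.+1 * (up_log m n).+1 * (r ^ up_log m n).+1))%N.
split; first by move=> n G; apply: hP.
apply/big_O_powP; exists ((8 * K0 * r).+1%:R), 2%N; split; first by rewrite ltr0n.
move=> n n2; set L := up_log m n.
have L0 : (0 < L)%N by rewrite up_log_gt0 m1.
have npos : (0 : R) < n%:R by rewrite ltr0n ltnW.
(* Exchanging the two exponents leaves [m ^ (L - 1) < n] to be raised to the power [t + e]. *)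
have hn : (2 * r)%N%:R ^+ L.-1 <= n%:R `^ (t + e) :> R.
  apply: (@le_trans _ _ ((m%:R `^ (t + e)) ^+ L.-1)).
    by rewrite lerXn2r ?nnegrE ?powR_ge0.
  rewrite -powR_mulrn ?powR_ge0 // powRAC powR_mulrn //.
  apply: ge0_ler_powR => //; rewrite ?nnegrE //.
  by rewrite -natrX ler_nat ltnW // up_log_gtn.
apply: (@le_trans _ _ ((8 * K0 * r * (n * (2 * r) ^ L.-1))%N%:R)).
  by rewrite ler_nat time_bound_nat // ltnW.
rewrite natrM; apply: ler_pM => //; first by rewrite ler_nat.
have -> : t + 1 + e = 1 + (t + e) by ring.
rewrite natrM natrX powRD; last by rewrite (gt_eqF npos) implybT.
by rewrite powRr1 // ler_wpM2l.
Qed.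

Theorem theorem1p6 (R : realType) : (c_max R 5 <= omega R rat + 1)%E.
Proof.
rewrite /c_max; elim/big_ind: _ => [|x y hx hy|T _].
- exact: leNye.
- by rewrite ge_max hx hy.
(* With 1 moved to the left, it suffices to compare with each member of the set whose infimum is
   [omega], up to an arbitrary [e > 0]. *)
rewrite -leeBlDr //; apply: le_ereal_inf_tmp => _ [t ht <-].
rewrite leeBlDr //; apply/lee_addgt0Pr => e e0.
by apply: ereal_inf_lbound; exists (t + 1 + e); [exact: count_time_mem|].
Qed.
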